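(* The exotic diffeomorphisms $\sigma$ of $S^6$ and $S^{14}$ naturally define explicit loops $\hat\sigma$ in $\mathrm{Diff}^+(S^5)$ and $\mathrm{Diff}^+(S^{13})$, respectively, with $\partial(\hat\sigma)=\sigma$.
   Context: $\mathrm{Diff}^+$ denotes the group of orientation-preserving diffeomorphisms, and $\Re$ the real part. Let $\mathbb{K}$ be the quaternions and $n=6$, or $\mathbb{K}$ the Cayley numbers and $n=14$, and write $S^n=\{(p,w)\in\mathbb{K}\times\mathbb{K}:\Re(p)=0,\ |p|^2+|w|^2=1\}$. Define $\mathrm{b}$ from $S^n$ to the unit sphere of $\mathbb{K}$ by $\mathrm{b}(p,w)=\frac{w}{|w|}\,e^{\pi p}\,\frac{\bar w}{|w|}$ if $w\neq0$ and $\mathrm{b}(p,w)=-1$ if $w=0$, where $e^{\pi p}=\cos(\pi|p|)+\sin(\pi|p|)\frac{p}{|p|}$ (and $e^0=1$). The diffeomorphism $\sigma:S^n\to S^n$ is $\sigma(p,w)=\bigl(\mathrm{b}(p,w)\,p\,\overline{\mathrm{b}(p,w)},\ \mathrm{b}(p,w)\,w\,\overline{\mathrm{b}(p,w)}\bigr)$; it is a real analytic, orientation-preserving diffeomorphism that is not isotopic to the identity (''exotic''). The boundary homomorphism $\partial:\pi_1\mathrm{Diff}^+(S^{n-1})\to\pi_0\mathrm{Diff}^+(S^n)$ is defined as follows. Elements of $\pi_1\mathrm{Diff}^+(S^{n-1})$ can be represented by paths $\hat\beta:[0,1]\to\mathrm{Diff}^+(S^{n-1})$ that map a neighborhood of $\{0,1\}$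 to the identity map and induce a smooth map $\hat\beta:S^{n-1}\times[0,1]\to S^{n-1}$. The map $\partial(\hat\beta):S^{n-1}\times[0,1]\to S^{n-1}\times[0,1]$, $(x,t)\mapsto(\hat\beta(x,t),t)$, is an orientation-preserving diffeomorphism of the cylinder that coincides with the identity in a neighborhood of the boundary, and so it induces an orientation-preserving diffeomorphism of $S^n$, also denoted $\partial(\hat\beta)$. *)

(* Defs.v *)
From HB Require Import structures.
From mathcomp Require Import all_boot all_order all_algebra.
From mathcomp Require Import all_classical all_reals all_analysis.

Set Implicit Arguments.
Unset Strict Implicit.
Unset Printing Implicit Defensive.

Import Order.TTheory GRing.Theory Num.Theory.
Import numFieldNormedType.Exports.

Local Open Scope classical_set_scope.
Local Open Scope ring_scope.

(* The library norm on 'rV[R]_n is the sup norm, whence this definition. *)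
Definition enorm (R : realType) (n : nat) (x : 'rV[R]_n) : R :=
  Num.sqrt (\sum_i x 0 i ^+ 2).

(* The sphere S^(n-1) in R^n. *)
Definition sphere (R : realType) (n : nat) : set 'rV[R]_n :=
  [set x | enorm x = 1].
Arguments sphere : clear implicits.

Section Smooth.
Variables (R : realType) (V W : normedModType R).

(* Meant for U open and V of finite dimension. *)
Fixpoint Ck (k : nat) (U : set V) (f : V -> W) : Prop :=
  if k is k'.+1 then
    (forall x, U x -> differentiable f x) /\
    (forall v, Ck k' U (fun x => 'D_v f x))
  else forall x, U x -> {for x, continuous f}.

(* C^infinity maps on an arbitrary subset A of V (a sphere, or the product of
   a sphere with a cube): near each point of A, f is the restriction to A of a
   C^infinity map defined on an open subset of V. *)
Definition smooth_on (A : set V) (f : V -> W) : Prop :=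
  forall x, A x -> exists (U : set V) (F : V -> W),
    [/\ open U, U x, forall k, Ck k U F &
        forall y, U y -> A y -> f y = F y].

End Smooth.

(* A self-map of S^(n-1) is represented by a map of the ambient space R^n, of
   which only the values on the sphere are relevant. *)
Section Diffeomorphisms.
Variables (R : realType) (n : nat).
Local Notation S := (sphere R n).
Local Notation I := ([set` `[0, 1]] : set R).
Implicit Types f g : 'rV[R]_n -> 'rV[R]_n.

Definition eq_on_sphere f g : Prop := forall x, S x -> f x = g x.

Definition diffeo f : Prop :=
  [/\ set_fun S S f, smooth_on S f &
      exists g, [/\ set_fun S S g, smooth_on S g,
                    forall x, S x -> g (f x) = x &
                    forall x, S x -> f (g x) = x]].

Definition radial_extension f (x : 'rV[R]_n) : 'rV[R]_n :=
  enorm x *: f ((enorm x)^-1 *: x).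

(* At x in the sphere the differential of the radial extension is that of f on
   the tangent space of the sphere at x, and sends the outward normal x to the
   outward normal f x. The sphere being oriented as the boundary of the ball,
   the sign of the Jacobian therefore tells whether f preserves orientation. *)
Definition orientation_preserving f : Prop :=
  forall x, S x -> 0 < \det ('J (radial_extension f) x).

(* Diff^+(S^(n-1)) *)
Definition Diffp : set ('rV[R]_n -> 'rV[R]_n) :=
  [set f | diffeo f /\ orientation_preserving f].

Definition isotopic f g : Prop :=
  exists H : R -> 'rV[R]_n -> 'rV[R]_n,
    [/\ smooth_on (I `*` S) (fun sx : R * 'rV[R]_n => H sx.1 sx.2),
        forall s, s \in `[0, 1] -> Diffp (H s),
        eq_on_sphere (H 0) f & eq_on_sphere (H 1) g].

(* The class of f in pi_0 Diff^+(S^(n-1)). *)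
Definition pi0_class f : set ('rV[R]_n -> 'rV[R]_n) := [set g | isotopic f g].

(* Loops in Diff^+(S^(n-1)) based at the identity. *)
Definition smooth_loop (a : R -> 'rV[R]_n -> 'rV[R]_n) : Prop :=
  [/\ smooth_on (I `*` S) (fun tx : R * 'rV[R]_n => a tx.1 tx.2),
      forall t, t \in `[0, 1] -> Diffp (a t),
      eq_on_sphere (a 0) id & eq_on_sphere (a 1) id].

Definition loop_homotopic (a b : R -> 'rV[R]_n -> 'rV[R]_n) : Prop :=
  exists H : R -> R -> 'rV[R]_n -> 'rV[R]_n,
    [/\ smooth_on (I `*` I `*` S)
          (fun stx : R * R * 'rV[R]_n => H stx.1.1 stx.1.2 stx.2),
        forall s, s \in `[0, 1] -> smooth_loop (H s),
        forall t, t \in `[0, 1] -> eq_on_sphere (H 0 t) (a t) &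
        forall t, t \in `[0, 1] -> eq_on_sphere (H 1 t) (b t)].

(* The class of a in pi_1 Diff^+(S^(n-1)). *)
Definition pi1_class (a : R -> 'rV[R]_n -> 'rV[R]_n) :
    set (R -> 'rV[R]_n -> 'rV[R]_n) :=
  [set b | smooth_loop b /\ loop_homotopic a b].

Definition flat_at_ends (a : R -> 'rV[R]_n -> 'rV[R]_n) : Prop :=
  exists2 e : R, 0 < e &
    forall t, t \in `[0, 1] -> t < e \/ 1 - e < t -> eq_on_sphere (a t) id.

End Diffeomorphisms.

(* The boundary homomorphism. The cylinder S^(n-1) x [0,1] is mapped onto S^n,
   in R^(1 + n), by cylinder_to_sphere, which collapses the two ends to the
   poles; the coordinates of y = cylinder_to_sphere t x are recovered as
   t = acos (- h) / pi and x = z / |z|, where y = (h, z). *)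
Section Boundary.
Variables (R : realType) (n : nat).

Definition cylinder_to_sphere (t : R) (x : 'rV[R]_n) : 'rV[R]_(1 + n) :=
  row_mx (- cos (pi * t))%:M (sin (pi * t) *: x).

(* The map of S^n induced by (x, t) |-> (b t x, t). It fixes the poles z = 0. *)
Definition boundary (b : R -> 'rV[R]_n -> 'rV[R]_n) (y : 'rV[R]_(1 + n)) :
    'rV[R]_(1 + n) :=
  let h := lsubmx y in
  let z := rsubmx y in
  row_mx h (enorm z *: b (acos (- h 0 0) / pi) ((enorm z)^-1 *: z)).

(* The image of a class A in pi_1 Diff^+(S^(n-1)), as a class in
   pi_0 Diff^+(S^n), computed from the representatives of A that are the
   identity near 0 and 1. *)
Definition boundary_class (A : set (R -> 'rV[R]_n -> 'rV[R]_n)) :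
    set ('rV[R]_(1 + n) -> 'rV[R]_(1 + n)) :=
  [set g | exists b, [/\ A b, flat_at_ends b & isotopic (boundary b) g]].

End Boundary.

Inductive hypercomplex := Quaternions | CayleyNumbers.

Definition imdim (K : hypercomplex) : nat :=
  match K with Quaternions => 3 | CayleyNumbers => 7 end.

(* Elements of an algebra with d imaginary units are row vectors of length
   1 + d, real coordinate first. *)
Section Algebra.
Variable R : realType.

Definition kconj d (a : 'rV[R]_(1 + d)) : 'rV[R]_(1 + d) :=
  row_mx (lsubmx a) (- rsubmx a).

(* Cayley-Dickson doubling: (a, b) (c, e) = (a c - e^* b, e a + b c^* ). *)
Definition doubling d (mul : 'rV[R]_(1 + d) -> 'rV[R]_(1 + d) -> 'rV[R]_(1 + d))
    (x y : 'rV[R]_((1 + d) + (1 + d))) : 'rV[R]_((1 + d) + (1 + d)) :=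
  let a := lsubmx x in let b := rsubmx x in
  let c := lsubmx y in let e := rsubmx y in
  row_mx (mul a c - mul (kconj e) b) (mul e a + mul b (kconj c)).

Definition real_mul (a b : 'rV[R]_(1 + 0)) : 'rV[R]_(1 + 0) := a *m b.
Definition complex_mul : 'rV[R]_(1 + 1) -> 'rV[R]_(1 + 1) -> 'rV[R]_(1 + 1) :=
  @doubling 0 real_mul.
Definition quaternion_mul :
    'rV[R]_(1 + 3) -> 'rV[R]_(1 + 3) -> 'rV[R]_(1 + 3) :=
  @doubling 1 complex_mul.
Definition cayley_mul : 'rV[R]_(1 + 7) -> 'rV[R]_(1 + 7) -> 'rV[R]_(1 + 7) :=
  @doubling 3 quaternion_mul.

Definition kmul (K : hypercomplex) :
    'rV[R]_(1 + imdim K) -> 'rV[R]_(1 + imdim K) -> 'rV[R]_(1 + imdim K) :=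
  match K with
  | Quaternions => quaternion_mul
  | CayleyNumbers => cayley_mul
  end.

Definition kone d : 'rV[R]_(1 + d) := row_mx 1%:M 0.

(* The inclusion of the imaginary elements. *)
Definition imag d (p : 'rV[R]_d) : 'rV[R]_(1 + d) := row_mx 0 p.

(* e^(pi p) for p imaginary; the value at p = 0 is 1 since 0 / 0 = 0. *)
Definition exp_pi d (p : 'rV[R]_d) : 'rV[R]_(1 + d) :=
  row_mx (cos (pi * enorm p))%:M ((sin (pi * enorm p) / enorm p) *: p).

End Algebra.

(* With d the number of imaginary units of K and n = 2 d (so n = 6 or 14), a
   point (p, w) of S^n, p imaginary, is the row vector (Re w, p, Im w) of length
   1 + (d + d). Re w is thus the height with respect to the poles (0, 1) and
   (0, -1), and S^(n-1) consists of the pairs (p, v) with p, v imaginary. *)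
Section Sigma.
Variables (R : realType) (K : hypercomplex).
Local Notation d := (imdim K).
Local Notation "x ** y" := (@kmul R K x y) (at level 40, left associativity).

Definition pair_pt (p : 'rV[R]_d) (w : 'rV[R]_(1 + d)) : 'rV[R]_(1 + (d + d)) :=
  row_mx (lsubmx w) (row_mx p (rsubmx w)).
Definition p_of (y : 'rV[R]_(1 + (d + d))) : 'rV[R]_d := lsubmx (rsubmx y).
Definition w_of (y : 'rV[R]_(1 + (d + d))) : 'rV[R]_(1 + d) :=
  row_mx (lsubmx y) (rsubmx (rsubmx y)).

Definition bmap (p : 'rV[R]_d) (w : 'rV[R]_(1 + d)) : 'rV[R]_(1 + d) :=
  if w == 0 then - kone R d
  else let u := (enorm w)^-1 *: w in u ** exp_pi p ** kconj u.

Definition conj_by (b q : 'rV[R]_(1 + d)) : 'rV[R]_(1 + d) :=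
  b ** q ** kconj b.

(* conj_by b q is imaginary when q is, so that rsubmx below only drops a zero
   coordinate. *)
Definition conj_im (b : 'rV[R]_(1 + d)) (q : 'rV[R]_d) : 'rV[R]_d :=
  rsubmx (conj_by b (imag q)).

Definition sigma (y : 'rV[R]_(1 + (d + d))) : 'rV[R]_(1 + (d + d)) :=
  let p := p_of y in
  let w := w_of y in
  pair_pt (conj_im (bmap p w) p) (conj_by (bmap p w) w).

(* sigma preserves Re w; sigma_hat t is its restriction to the slice
   Re w = - cos (pi t), rescaled to a map of S^(n-1):
   (p, v) |-> (b p b^*, b v b^* ) for b = b(P, W), where
   P = sin (pi t) p and W = - cos (pi t) + sin (pi t) v. *)
Definition sigma_hat (t : R) (x : 'rV[R]_(d + d)) : 'rV[R]_(d + d) :=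
  let y := cylinder_to_sphere t x in
  let b := bmap (p_of y) (w_of y) in
  row_mx (conj_im b (lsubmx x)) (conj_im b (rsubmx x)).

End Sigma.

(* Main.v *)
(* The element b(p, w) is u e^(pi p) u^* with u = w/|w|. It lies in the algebra
   generated by p and w, which is associative by Artin's theorem, so that
   conjugating both p and w by c = b(p, w) or by c = b(p, w)^* does not change
   b(p, w). Hence conjugation by b^* inverts sigma, and likewise every slice
   sigma_hat t. A path of diffeomorphisms whose Jacobians are positive at one
   time is orientation-preserving at all times; this applies to sigma_hat,
   which starts at the identity, and polar coordinates turn sigma_hat into sigma.

   The loop sigma_hat is not the identity near its ends, so it is reparametrized
   by a smooth step function. Moving the point at which b is evaluated along the
   meridian of y commutes with simultaneous conjugation, so the resulting
   deformation of sigma into the boundary of the reparametrized loop consists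
   again of diffeomorphisms. A homotopy of loops, reparametrized in the same
   way, becomes an isotopy of the boundary maps; reparametrizing a loop that is
   already flat at its ends does not change the isotopy class. *)
Require Import Defs.
From HB Require Import structures.
From mathcomp Require Import all_boot all_order all_algebra.
From mathcomp Require Import all_classical all_reals all_analysis.
From mathcomp Require Import ring lra.
Set Implicit Arguments.
Unset Strict Implicit.
Unset Printing Implicit Defensive.

Import Order.TTheory GRing.Theory Num.Theory.
Import numFieldNormedType.Exports.

Local Open Scope classical_set_scope.
Local Open Scope ring_scope.

(** * Smooth maps on arbitrary subsets *)

(** [Diffp] asks for a smooth inverse of each map separately, so a loop or a homotopy of loops
    provides slice inverses whose dependence on the parameters is unknown. The inverse of a boundary
    map is assembled from such slices, and its smoothness comes from an inverse function theorem: a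
    bijection of the compact sphere has a continuous inverse, which a nonvanishing Jacobian makes
    smooth. For a boundary map that Jacobian is computed from the slices; the variation of time adds
    a rank one term that leaves the determinant unchanged.

    The second obstacle is smoothness where the formulas degenerate. Polar coordinates fail at the
    poles, where flatness makes the maps explicit. The expression of b(p, w) divides by |p| and by
    |w|: the first division disappears once cosine and the sine quotient are written as entire
    functions of a square, the second is cancelled near w = 0 by the equation of the sphere.

    Artin's theorem takes the form of a multiplication table on four coordinates, whose
    associativity is a polynomial identity in traces and norms. *)

Section Differential.
Variables (R : realType).
Implicit Types V W : normedModType R.

(** Serves wherever a differential has to be exhibited by hand, notably for the flat functions at 0
    and for a local inverse. *)
Lemma is_diff_eps V W (f : V -> W) (x : V) (L : {linear V -> W}) :
  continuous L ->
  (forall e, 0 < e ->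
     \forall h \near (0 : V), `|f (h + x) - f x - L h| <= e * `|h|) ->
  is_diff x f L.
Proof.
move=> cL fL.
have E : f \o shift x = cst (f x) + L +o_ (0 : V) id.
  apply/eqaddoP => e e0; near=> h.
  by rewrite /= opprD addrA; near: h; exact: fL.
have dE := diff_unique cL E.
by apply: DiffDef => //; apply/diff_locallyP; rewrite dE.
Unshelve. all: by end_near. Qed.

Lemma diff_eps V W (f : V -> W) (x : V) : differentiable f x ->
  forall e, 0 < e ->
    \forall h \near (0 : V), `|f (h + x) - f x - 'd f x h| <= e * `|h|.
Proof.
move=> /diff_locally /eqaddoP + e e0 => /(_ _ e0) H; near=> h.
have : `|(f \o shift x - (cst (f x) + 'd f x)) h| <= e * `|h| by near: h.
by rewrite /= opprD addrA.
Unshelve. all: by end_near. Qed.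

Lemma near_eq_differentiable V W (f g : V -> W) (x : V) :
  (\forall y \near x, f y = g y) -> differentiable f x -> differentiable g x.
Proof.
move=> fg df; suff : is_diff x g ('d f x) by move=> [].
apply: is_diff_eps; first exact: diff_continuous.
move=> e e0; have /nbhs0P fg0 := fg; near=> h.
rewrite -(nbhs_singleton fg).
have -> : g (h + x) = f (h + x).
  by apply/esym; rewrite addrC; near: h.
by near: h; exact: diff_eps.
Unshelve. all: by end_near. Qed.

End Differential.

(** * Finite-dimensional spaces through continuous coordinates *)

Section Basis.
Variable R : realType.
Implicit Types V W : normedModType R.

(** Finite dimension in the form used by the chain rule: a vector-valued derivative is expanded into
    scalar coordinates times fixed vectors. *)
Definition finite_basis V := exists (m : nat) (e : 'I_m -> V)
  (c : 'I_m -> {linear V -> R}),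
  (forall i, continuous (c i)) /\ forall x, x = \sum_i c i x *: e i.

Lemma linear_pack V W (f : V -> W) : linear f ->
  exists L : {linear V -> W}, (L : V -> W) = f.
Proof.
move=> lf.
pose i := GRing.isLinear.Build _ _ _ _ f lf.
pose L : {linear V -> W} := HB.pack f i.
by exists L.
Qed.

Lemma finite_basis_real : finite_basis R.
Proof.
have [L LE] := @linear_pack R R id (fun _ _ _ => erefl).
exists 1%N, (fun _ => 1), (fun _ => L); split.
  by move=> _; rewrite LE => x.
by move=> x; rewrite big_ord1 LE; rewrite /GRing.scale/= mulr1.
Qed.

Lemma finite_basis_rV n : finite_basis 'rV[R]_n.
Proof.
have H (i : 'I_n) : linear (fun x : 'rV[R]_n => x 0 i).
  by move=> a x y; rewrite !mxE.
exists n, (fun i => delta_mx 0 i), (fun i => sval (cid (linear_pack (H i)))).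
split=> [i|x].
  by case: cid => L /= ->; exact: coord_continuous.
rewrite [LHS]row_sum_delta; apply: eq_bigr => i _.
by case: cid => L /= ->.
Qed.

Lemma finite_basis_prod V W : finite_basis V -> finite_basis W ->
  finite_basis (V * W)%type.
Proof.
move=> [m [e [c [cc E]]]] [m' [e' [c' [cc' E']]]].
have H1 i : linear (fun x : V * W => c i x.1) by move=> a x y; rewrite linearP.
have H2 i : linear (fun x : V * W => c' i x.2) by move=> a x y; rewrite linearP.
exists (m + m')%N, (fun i => match fintype.split i with inl j => (e j, 0) | inr j => (0, e'
    j) end),
  (fun i => match fintype.split i with inl j => sval (cid (linear_pack (H1 j)))
                             | inr j => sval (cid (linear_pack (H2 j))) end).
split=> [i|[x y]].
  case: (fintype.split i) => j; case: cid => L /= ->.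
    by move=> x; apply: continuous_comp; [exact: cvg_fst|exact: cc].
  by move=> x; apply: continuous_comp; [exact: cvg_snd|exact: cc'].
rewrite big_split_ord/=.
under eq_bigr => i _ do rewrite (unsplitK (inl _)).
under [X in _ + X]eq_bigr => i _ do rewrite (unsplitK (inr _)).
rewrite [LHS](_ : _ = (x, 0) + (0, y)); last by congr pair; rewrite ?addr0 ?add0r.
congr (_ + _).
  rewrite [X in (X, _)]E (big_morph (fun a => (a, 0 : W)) (id1 := 0) (op1 := +%R)) //.
    by apply: eq_bigr => i _; case: cid => L /= ->; congr pair; rewrite scaler0.
  by move=> a b; congr pair; rewrite addr0.
rewrite [X in (_, X)]E' (big_morph (fun a => (0 : V, a)) (id1 := 0) (op1 := +%R)) //.
  by apply: eq_bigr => i _; case: cid => L /= ->; congr pair; rewrite scaler0.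
by move=> a b; congr pair; rewrite addr0.
Qed.

Lemma finite_basis_continuous V W (f : {linear V -> W}) :
  finite_basis V -> continuous f.
Proof.
move=> [m [e [c [cc E]]]].
have -> : (f : V -> W) = fun x => \sum_i c i x *: f (e i).
  by apply/funext => x; rewrite [in LHS](E x) linear_sum; apply: eq_bigr => i _; rewrite linearZ.
move=> x; apply: (@cvg_big _ _ +%R) => [|i _]; first exact: add_continuous.
by apply: cvgZr_tmp; apply: cc.
Qed.

End Basis.

(** * Calculus of maps of class C^k *)

Section CkTheory.
Variable R : realType.
Implicit Types V W : normedModType R.

Lemma Ck_sub V W k (U U' : set V) (f : V -> W) :
  U' `<=` U -> Ck k U f -> Ck k U' f.
Proof.
move=> sub; elim: k f => [|k IH] f /=; first by move=> h x /sub; apply: h.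
by move=> [h1 h2]; split=> [x /sub|v]; [exact: h1|exact/IH].
Qed.

Lemma Ck_pred V W k (U : set V) (f : V -> W) : Ck k.+1 U f -> Ck k U f.
Proof.
elim: k f => [|k IH] f /=.
  by move=> [h _] x Ux; apply: differentiable_continuous; exact: h.
by move=> [h1 h2]; split => // v; apply: IH; exact: h2.
Qed.

Lemma Ck_eq V W k (U : set V) (f g : V -> W) : open U ->
  (forall x, U x -> f x = g x) -> Ck k U f -> Ck k U g.
Proof.
move=> oU; have nU x : U x -> \forall y \near x, U y by move=> Ux; exact: open_nbhs_nbhs.
elim: k f g => [|k IH] f g fg /=.
  move=> cf x Ux; rewrite /continuous_at /prop_for -(fg x Ux).
  apply: cvg_trans (cf x Ux); apply: near_eq_cvg.
  by near=> y; rewrite fg//; near: y; exact: nU.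
move=> [h1 h2].
have E x : U x -> \forall y \near x, f y = g y.
  by move=> Ux; near=> y; apply: fg; near: y; exact: nU.
split=> [x Ux|v]; first exact: near_eq_differentiable (E _ Ux) (h1 _ Ux).
by apply: IH (h2 v) => x Ux; exact: near_eq_derive (E _ Ux).
Unshelve. all: by end_near. Qed.

Lemma Ck_cst V W k (U : set V) (a : W) : Ck k U (fun _ => a).
Proof.
elim: k a => [|k IH] a /=; first by move=> x _; exact: cvg_cst.
split=> [x _|v]; first exact: differentiable_cst.
rewrite (_ : 'D_v _ = (fun => 0)) //.
by apply: funext => x; exact: derive_cst.
Qed.

Lemma Ck_linear V W k (U : set V) (L : {linear V -> W}) :
  continuous L -> Ck k U L.
Proof.
move=> cL; case: k => [x _|k]; first exact: cL.
split=> [x _|v]; first exact: linear_differentiable.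
rewrite (_ : (fun x => _) = (fun => L v)); first exact: Ck_cst.
apply/funext => x; rewrite deriveE ?diff_lin//; exact: linear_differentiable.
Qed.

Lemma Ck_linear_comp V W W' k (U : set V) (f : V -> W) (L : {linear W -> W'}) :
  open U -> continuous L -> Ck k U f -> Ck k U (fun x => L (f x)).
Proof.
move=> oU cL; elim: k f => [|k IH] f /=.
  by move=> cf x Ux; apply: continuous_comp; [exact: cf|exact: cL].
move=> [h1 h2]; have dL x : differentiable L x by exact: linear_differentiable.
split=> [x Ux|v]; first by apply: (differentiable_comp (h1 _ Ux)).
apply: Ck_eq (IH _ (h2 v)) => // x Ux.
have h := h1 _ Ux.
rewrite [RHS]deriveE; last exact: (differentiable_comp h).
by rewrite (@diff_comp _ _ _ _ f L)//= diff_lin// deriveE.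
Qed.

Lemma CkD V W k (U : set V) (f g : V -> W) : open U ->
  Ck k U f -> Ck k U g -> Ck k U (fun x => f x + g x).
Proof.
move=> oU; elim: k f g => [|k IH] f g /=.
  by move=> cf cg x Ux; apply: cvgD; [exact: cf|exact: cg].
move=> [f1 f2] [g1 g2].
split=> [x Ux|v].
  by apply: (@differentiableD _ _ _ f g); [exact: f1|exact: g1].
apply: Ck_eq (IH _ _ (f2 v) (g2 v)) => // x Ux.
by rewrite -(@deriveD _ _ _ f g)//; apply: diff_derivable; [exact: f1|exact: g1].
Qed.

Lemma Ck_sum V W k (U : set V) I (r : seq I) (f : I -> V -> W) : open U ->
  (forall i, Ck k U (f i)) -> Ck k U (fun x => \sum_(i <- r) f i x).
Proof.
move=> oU h; elim: r => [|i r IH].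
  by rewrite (_ : (fun x => _) = fun=> 0); [exact: Ck_cst|apply/funext => x; rewrite big_nil].
rewrite (_ : (fun x => _) = fun x => f i x + \sum_(i <- r) f i x).
  exact: CkD.
by apply/funext => x; rewrite big_cons.
Qed.

Lemma CkM V k (U : set V) (f g : V -> R) : open U ->
  Ck k U f -> Ck k U g -> Ck k U (fun x => f x * g x).
Proof.
move=> oU; elim: k f g => [|k IH] f g.
  by move=> cf cg x Ux; apply: cvgM; [exact: cf|exact: cg].
move=> cf cg; have [f1 f2] := cf; have [g1 g2] := cg.
split=> [x Ux|v].
  by apply: (@differentiableM _ _ f g); [exact: f1|exact: g1].
apply: Ck_eq (CkD oU (IH _ _ (Ck_pred cf) (g2 v)) (IH _ _ (Ck_pred cg) (f2 v))) => // x Ux.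
by rewrite -(@deriveM _ _ f g)//; apply: diff_derivable; [exact: f1|exact: g1].
Qed.

Lemma Ck_scalel V W k (U : set V) (a : V -> R) (w : W) : open U ->
  Ck k U a -> Ck k U (fun x => a x *: w).
Proof.
move=> oU; elim: k a => [|k IH] a.
  by move=> ca x Ux; apply: cvgZr_tmp; exact: ca.
move=> [a1 a2]; split=> [x Ux|v]; first exact/differentiableZl/a1.
apply: Ck_eq (IH _ (a2 v)) => // x Ux; have da := a1 _ Ux.
by rewrite [RHS]deriveE ?diffZl//=; [rewrite deriveE|exact: differentiableZl].
Qed.

Lemma CkZ V W k (U : set V) (a : V -> R) (f : V -> W) : finite_basis W ->
  open U -> Ck k U a -> Ck k U f -> Ck k U (fun x => a x *: f x).
Proof.
move=> [m [e [c [cc E]]]] oU ca cf.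
rewrite (_ : (fun x => _) = fun x => \sum_i (a x * c i (f x)) *: e i).
  apply: Ck_sum => // i.
  by apply/Ck_scalel => //; apply: CkM => //; exact: (Ck_linear_comp oU (cc i) cf).
by apply/funext => x; rewrite [in LHS](E (f x)) scaler_sumr; apply: eq_bigr => i _; rewrite
    scalerA.
Qed.

Lemma Ck_pair V W W' k (U : set V) (f : V -> W) (g : V -> W') : open U ->
  Ck k U f -> Ck k U g -> Ck k U (fun x => (f x, g x)).
Proof.
move=> oU; elim: k f g => [|k IH] f g.
  by move=> cf cg x Ux; apply: cvg_pair; [exact: cf|exact: cg].
move=> [f1 f2] [g1 g2].
split=> [x Ux|v].
  by apply: differentiable_pair; [exact: f1|exact: g1].
apply: Ck_eq (IH _ _ (f2 v) (g2 v)) => // x Ux.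
have df := f1 _ Ux; have dg := g1 _ Ux.
rewrite [RHS]deriveE; last exact: differentiable_pair.
by rewrite diff_pair//= !deriveE.
Qed.

(** The derivative of the composite along v is the sum over i of c_i (D_v f) times (D_(e_i) g) o f.
    The induction hypothesis applies to each partial derivative of g, with the class of f lowered by
    one through [Ck_pred]. *)
Lemma Ck_comp V W W' k (U : set V) (U' : set W) (f : V -> W) (g : W -> W') :
  finite_basis W -> finite_basis W' -> open U -> open U' ->
  (forall x, U x -> U' (f x)) ->
  Ck k U f -> Ck k U' g -> Ck k U (fun x => g (f x)).
Proof.
move=> [m [e [c [cc E]]]] bW' oU oU' UU'; elim: k g => [|k IH] g.
  by move=> cf cg x Ux; apply: continuous_comp; [exact: cf|exact/cg/UU'].
move=> cf cg; have [f1 f2] := cf; have [g1 g2] := cg.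
split=> [x Ux|v].
  by apply: differentiable_comp; [exact: f1|exact/g1/UU'].
apply: (@Ck_eq _ _ _ _ (fun x => \sum_i c i ('D_v f x) *: 'D_(e i) g (f x))) => //.
  move=> x Ux; have df := f1 _ Ux; have dg := g1 _ (UU' _ Ux).
  rewrite [RHS]deriveE; last exact: differentiable_comp.
  rewrite (@diff_comp _ _ _ _ f g)//= [in RHS](E ('d f x v)) linear_sum.
  by apply: eq_bigr => i _; rewrite linearZ !deriveE.
apply: Ck_sum => // i; apply: CkZ => //.
  exact: (Ck_linear_comp oU (cc i) (f2 v)).
exact: (IH _ (Ck_pred cf) (g2 (e i))).
Qed.

(** In one variable the derivative along v is v f'. Thus a formula expressing f' through functions
    already treated gives smoothness by induction; inverse, square root, sine, arc cosine, the even
    series and the flat functions are all obtained in this way. *)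
Lemma Ck_derive1 k (U : set R) (f f' : R -> R) : open U ->
  (forall x, U x -> is_derive x 1 f (f' x)) -> Ck k U f' -> Ck k.+1 U f.
Proof.
move=> oU h cf'.
have df x : U x -> differentiable f x.
  by move=> /h [df _]; apply/derivable1_diffP.
split=> // v.
apply: (@Ck_eq _ _ _ _ (fun x => v * f' x)) => //; last first.
  by apply: CkM => //; exact: Ck_cst.
move=> x Ux; have [_ <-] := h _ Ux.
rewrite !deriveE; try exact: df.
by rewrite -[v in RHS]mulr1 -[v * 1]/(v *: 1) linearZ.
Qed.

End CkTheory.

(** * Closure properties of smooth maps on subsets *)

Section SmoothOn.
Variable R : realType.
Implicit Types V W : normedModType R.

Lemma smooth_on_eq V W (A : set V) (f g : V -> W) :
  (forall x, A x -> f x = g x) -> smooth_on A f -> smooth_on A g.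
Proof.
move=> fg h x Ax; have [U [F [oU Ux CF FE]]] := h _ Ax.
by exists U, F; split => // y Uy Ay; rewrite -fg// FE.
Qed.

Lemma smooth_on_sub V W (A B : set V) (f : V -> W) :
  B `<=` A -> smooth_on A f -> smooth_on B f.
Proof.
move=> BA h x /BA Ax; have [U [F [oU Ux CF FE]]] := h _ Ax.
by exists U, F; split => // y Uy /BA; exact: FE.
Qed.

Lemma smooth_on_local V W (A : set V) (f : V -> W) :
  (forall x, A x -> exists U, [/\ open U, U x & smooth_on (A `&` U) f]) ->
  smooth_on A f.
Proof.
move=> h x Ax; have [U [oU Ux sf]] := h _ Ax.
have [U' [F [oU' U'x CF FE]]] := sf x (conj Ax Ux).
exists (U `&` U'), F; split=> //; first exact: openI.
  by move=> k; apply: Ck_sub (CF k); exact: subIsetr.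
by move=> y [Uy U'y] Ay; apply: FE.
Qed.

Lemma smooth_on_open V W (U : set V) (f : V -> W) :
  open U -> (forall k, Ck k U f) -> smooth_on U f.
Proof. by move=> oU Cf x Ux; exists U, f; split. Qed.

(** Being of class C^k is a local property. The induction carries only the local form [H], which
    passes to directional derivatives. *)
Lemma smooth_on_Ck V W (U : set V) (f : V -> W) k :
  open U -> smooth_on U f -> Ck k U f.
Proof.
move=> oU h.
have H x : U x -> exists N : set V, [/\ open N, N x, N `<=` U & Ck k N f].
  move=> /[dup] Ux /h [N [F [oN Nx CF FE]]]; exists (U `&` N); split => //.
  - exact: openI.
  - apply: (@Ck_eq _ _ _ _ _ F); first exact: openI.
      by move=> y [Uy Ny]; rewrite FE.
    by apply: Ck_sub (CF k); exact: subIsetr.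
elim: k f {h} H => [|k IH] f H.
  by move=> x /H [N [oN Nx _]]; apply.
split=> [x /H [N [oN Nx _ [+ _]]]|v]; first by apply.
apply: IH => x /H [N [oN Nx NU [_ h]]].
by exists N; split => //; exact: h.
Qed.

Lemma smooth_on_cst V W (A : set V) (a : W) : smooth_on A (fun _ => a).
Proof.
by apply: (@smooth_on_sub _ _ setT) => //; apply: smooth_on_open; [exact: openT|move=> k;
    exact: Ck_cst].
Qed.

Lemma smooth_on_linear V W (A : set V) (f : V -> W) :
  finite_basis V -> linear f -> smooth_on A f.
Proof.
move=> bV /linear_pack[L <-].
apply: (@smooth_on_sub _ _ setT) => //; apply: smooth_on_open; first exact: openT.
by move=> k; apply: Ck_linear; exact: finite_basis_continuous.
Qed.

Lemma smooth_onD V W (A : set V) (f g : V -> W) :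
  smooth_on A f -> smooth_on A g -> smooth_on A (fun x => f x + g x).
Proof.
move=> hf hg x Ax; have [U [F [oU Ux CF FE]]] := hf _ Ax.
have [U' [G [oU' U'x CG GE]]] := hg _ Ax.
exists (U `&` U'), (fun x => F x + G x); split=> //; first exact: openI.
  move=> k; apply: CkD; first exact: openI.
    by apply: Ck_sub (CF k); exact: subIsetl.
  by apply: Ck_sub (CG k); exact: subIsetr.
by move=> y [Uy U'y] Ay; rewrite FE// GE.
Qed.

Lemma smooth_on_sum V W (A : set V) I (r : seq I) (f : I -> V -> W) :
  (forall i, smooth_on A (f i)) -> smooth_on A (fun x => \sum_(i <- r) f i x).
Proof.
move=> h; elim: r => [|i r IH].
  by apply: (@smooth_on_eq _ _ _ (fun=> 0)); [move=> x _; rewrite big_nil|exact: smooth_on_cst].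
by apply: smooth_on_eq (smooth_onD (h i) IH) => x _; rewrite big_cons.
Qed.

Lemma smooth_onM V (A : set V) (f g : V -> R) :
  smooth_on A f -> smooth_on A g -> smooth_on A (fun x => f x * g x).
Proof.
move=> hf hg x Ax; have [U [F [oU Ux CF FE]]] := hf _ Ax.
have [U' [G [oU' U'x CG GE]]] := hg _ Ax.
exists (U `&` U'), (fun x => F x * G x); split=> //; first exact: openI.
  move=> k; apply: CkM; first exact: openI.
    by apply: Ck_sub (CF k); exact: subIsetl.
  by apply: Ck_sub (CG k); exact: subIsetr.
by move=> y [Uy U'y] Ay; rewrite FE// GE.
Qed.

Lemma smooth_on_prod V (A : set V) I (r : seq I) (f : I -> V -> R) :
  (forall i, smooth_on A (f i)) -> smooth_on A (fun x => \prod_(i <- r) f i x).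
Proof.
move=> h; elim: r => [|i r IH].
  by apply: (@smooth_on_eq V R A (fun=> 1)); [move=> x _; rewrite big_nil|exact: smooth_on_cst].
by apply: smooth_on_eq (smooth_onM (h i) IH) => x _; rewrite big_cons.
Qed.

Lemma smooth_on_pair V W W' (A : set V) (f : V -> W) (g : V -> W') :
  smooth_on A f -> smooth_on A g -> smooth_on A (fun x => (f x, g x)).
Proof.
move=> hf hg x Ax; have [U [F [oU Ux CF FE]]] := hf _ Ax.
have [U' [G [oU' U'x CG GE]]] := hg _ Ax.
exists (U `&` U'), (fun x => (F x, G x)); split=> //; first exact: openI.
  move=> k; apply: Ck_pair; first exact: openI.
    by apply: Ck_sub (CF k); exact: subIsetl.
  by apply: Ck_sub (CG k); exact: subIsetr.
by move=> y [Uy U'y] Ay; rewrite FE// GE.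
Qed.

Lemma smooth_on_comp V W W' (A : set V) (B : set W) (f : V -> W) (g : W -> W') :
  finite_basis W -> finite_basis W' -> (forall x, A x -> B (f x)) ->
  smooth_on A f -> smooth_on B g -> smooth_on A (fun x => g (f x)).
Proof.
move=> bW bW' AB hf hg x Ax; have [U [F [oU Ux CF FE]]] := hf _ Ax.
have [U' [G [oU' U'x CG GE]]] := hg _ (AB _ Ax).
have oN : open (U `&` F @^-1` U').
  have /(continuous_inP _ oU) : {in U, continuous F}.
    by move=> y; rewrite inE => Uy; exact: (CF 0%N).
  exact.
exists (U `&` F @^-1` U'), (fun x => G (F x)); split=> //.
- by split=> //=; rewrite -FE.
- move=> k; apply: (Ck_comp bW bW' oN oU') => //; first by move=> y [].
  by apply: Ck_sub (CF k); exact: subIsetl.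
- by move=> y [Uy /= U'y] Ay; rewrite FE// GE// -FE//; exact: AB.
Qed.

Lemma smooth_onZ V W (A : set V) (a : V -> R) (f : V -> W) : finite_basis W ->
  smooth_on A a -> smooth_on A f -> smooth_on A (fun x => a x *: f x).
Proof.
move=> bW hf hg x Ax; have [U [F [oU Ux CF FE]]] := hf _ Ax.
have [U' [G [oU' U'x CG GE]]] := hg _ Ax.
exists (U `&` U'), (fun x => F x *: G x); split=> //; first exact: openI.
  move=> k; apply: CkZ => //; first exact: openI.
    by apply: Ck_sub (CF k); exact: subIsetl.
  by apply: Ck_sub (CG k); exact: subIsetr.
by move=> y [Uy U'y] Ay; rewrite FE// GE.
Qed.

Lemma smooth_on_linear_comp V W W' (A : set V) (f : V -> W) (L : W -> W') :
  finite_basis W -> finite_basis W' -> linear L -> smooth_on A f ->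
  smooth_on A (fun x => L (f x)).
Proof.
move=> bW bW' lL hf.
by apply: (@smooth_on_comp _ _ _ A setT f L) => //; exact: smooth_on_linear.
Qed.

Lemma smooth_onN V W (A : set V) (f : V -> W) : finite_basis W ->
  smooth_on A f -> smooth_on A (fun x => - f x).
Proof.
move=> bW; apply: (smooth_on_linear_comp bW bW) => a x y.
by rewrite scalerN opprD.
Qed.

Lemma smooth_onB V W (A : set V) (f g : V -> W) : finite_basis W ->
  smooth_on A f -> smooth_on A g -> smooth_on A (fun x => f x - g x).
Proof. by move=> bW hf hg; apply: smooth_onD => //; exact: smooth_onN. Qed.

(** Expanding the first argument in coordinates leaves scalar multiples of linear maps of the
    second. The case of interest is multiplication in the quaternions and Cayley numbers. *)
Lemma smooth_on_bilinear V W W' (X : normedModType R) (A : set V) (f : V -> W) (g : V -> W')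
    (B : W -> W' -> X) : finite_basis W -> finite_basis W' -> finite_basis X ->
  (forall y, linear (B^~ y)) -> (forall x, linear (B x)) ->
  smooth_on A f -> smooth_on A g -> smooth_on A (fun x => B (f x) (g x)).
Proof.
move=> bW bW' bX lB1 lB2 hf hg.
have [m [e [c [cc E]]]] := bW.
have h i : smooth_on A (fun x => c i (f x)).
  apply: (@smooth_on_linear_comp _ _ _ _ _ (c i)) => //.
    exact: finite_basis_real.
  exact: linearP.
apply: (@smooth_on_eq _ _ _ (fun x => \sum_i c i (f x) *: B (e i) (g x))).
  move=> x _; rewrite [in RHS](E (f x)).
  have [L LE] := linear_pack (lB1 (g x)).
  rewrite -[RHS](congr1 (fun h => h _) LE) linear_sum.
  by apply: eq_bigr => i _; rewrite linearZ LE.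
apply: smooth_on_sum => i; apply: smooth_onZ => //.
exact: (smooth_on_linear_comp bW' bX (lB2 (e i)) hg).
Qed.

End SmoothOn.

(** * Elementary functions of smooth real functions *)

Section Functions.
Variable R : realType.
Implicit Types V : normedModType R.

Lemma open_neq0 : open [set x : R | x != 0].
Proof.
have -> : [set x : R | x != 0] = ~` [set 0].
  by apply/seteqP; split => x /= /eqP.
rewrite openC; apply: accessible_closed_set1.
by apply: hausdorff_accessible; exact: norm_hausdorff.
Qed.

Lemma Ck_inv k : Ck k [set x : R | x != 0] (fun x => x^-1).
Proof.
elim: k => [|k IH]; first by move=> x /= x0; exact: inv_continuous.
apply: (@Ck_derive1 _ _ _ _ (fun x => - 1 * (x^-1 * x^-1))).
- exact: open_neq0.
- move=> x /= x0.
  have d : derivable (id : R -> R) x 1 by exact: derivable_id.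
  apply: DeriveDef; first exact: (@derivableV _ _ id).
  by rewrite (@deriveV _ _ id)// derive_id /GRing.scale/= mulr1 mulN1r expr2 invfM.
- apply: CkM; [exact: open_neq0|exact: Ck_cst|].
  by apply: CkM => //; exact: open_neq0.
Qed.

Lemma smooth_onV V (A : set V) (f : V -> R) : (forall x, A x -> f x != 0) ->
  smooth_on A f -> smooth_on A (fun x => (f x)^-1).
Proof.
move=> f0 hf; have bR := finite_basis_real R.
apply: (smooth_on_comp bR bR (B := [set x | x != 0])) => //.
by apply: smooth_on_open; [exact: open_neq0|exact: Ck_inv].
Qed.

Lemma Ck_sqrt k : @Ck R R R k [set x : R | 0 < x] Num.sqrt.
Proof.
have bR := finite_basis_real R; have o0 : open [set x : R | 0 < x] by exact: open_gt.
elim: k => [|k IH]; first by move=> x /= x0; exact: sqrt_continuous.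
apply: (@Ck_derive1 _ _ _ _ (fun x => (2 * Num.sqrt x)^-1)) => //.
apply: (@Ck_comp _ _ _ _ _ _ [set x : R | x != 0]  (fun x => 2 * Num.sqrt x) (fun x => x^-1))
    => //.
- by move=> x /= x0; rewrite mulf_neq0// gt_eqF// sqrtr_gt0.
- by apply: CkM => //; exact: Ck_cst.
- exact: Ck_inv.
Qed.

Lemma smooth_on_sqrt V (A : set V) (f : V -> R) : (forall x, A x -> 0 < f x) ->
  smooth_on A f -> @smooth_on R V R A (fun x => Num.sqrt (f x)).
Proof.
move=> f0 hf; have bR := finite_basis_real R.
apply: (@smooth_on_comp R V R R A [set x | 0 < x] f Num.sqrt) => //.
by apply: smooth_on_open; [exact: open_gt|exact: Ck_sqrt].
Qed.

Lemma Ck_sin_cos k : Ck k setT (@sin R) /\ Ck k setT (@cos R).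
Proof.
elim: k => [|k [IHs IHc]].
  by split=> x _; [exact: continuous_sin|exact: continuous_cos].
split; first by apply: (Ck_derive1 openT _ IHc) => x _; exact: is_derive_sin.
apply: (@Ck_derive1 _ _ _ _ (fun x => - 1 * sin x)) => //; first exact: openT.
  by move=> x _; rewrite mulN1r; exact: is_derive_cos.
by apply: CkM => //; [exact: openT|exact: Ck_cst].
Qed.

Lemma smooth_on_sin V (A : set V) (f : V -> R) :
  smooth_on A f -> smooth_on A (fun x => sin (f x)).
Proof.
move=> hf; have bR := finite_basis_real R.
apply: (smooth_on_comp bR bR (B := setT)) => //.
by apply: smooth_on_open; [exact: openT|move=> k; have [] := Ck_sin_cos k].
Qed.

Lemma smooth_on_cos V (A : set V) (f : V -> R) :
  smooth_on A f -> smooth_on A (fun x => cos (f x)).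
Proof.
move=> hf; have bR := finite_basis_real R.
apply: (smooth_on_comp bR bR (B := setT)) => //.
by apply: smooth_on_open; [exact: openT|move=> k; have [] := Ck_sin_cos k].
Qed.

Lemma smooth_on_acos V (A : set V) (f : V -> R) :
  (forall x, A x -> -1 < f x < 1) ->
  smooth_on A f -> smooth_on A (fun x => acos (f x)).
Proof.
move=> f1 hf; have bR := finite_basis_real R.
pose U := [set x : R | -1 < x < 1].
have oU : open U.
  have -> : U = [set x | -1 < x] `&` [set x | x < 1].
    by apply/seteqP; split => [x /= /andP[]//|x [/= a b]]; apply/andP.
  by apply: openI; [exact: open_gt|exact: open_lt].
apply: (smooth_on_comp bR bR (B := U)) => //.
apply: smooth_on_open => // -[|k].
  by move=> x /= x1; exact: continuous_acos.
apply: (Ck_derive1 oU (fun x x1 => is_derive1_acos x1)).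
have hid : smooth_on U (id : R -> R) by exact: smooth_on_linear.
apply: smooth_on_Ck => //.
apply: smooth_onN => //; apply: smooth_onV; last apply: smooth_on_sqrt.
- move=> x /= /andP[x1 x2]; rewrite gt_eqF// sqrtr_gt0 subr_gt0.
  by nra.
- by move=> x /= /andP[x1 x2]; nra.
- apply: smooth_onB => //; first exact: smooth_on_cst.
  exact: smooth_onM.
Qed.

End Functions.

(** * Cosine and the sine quotient as entire functions of the square *)

Section EvenSeries.
Variable R : realType.

(* [even_trig 0 (x ^+ 2) = cos x] and [even_trig 1 (x ^+ 2) = sin x / x]; the
   family is stable under differentiation. *)
Definition even_trig_coeff (m k : nat) : R := (-1) ^+ k / (k.*2 + m)`!%:R.
Definition even_trig (m : nat) (r : R) : R := limn (pseries (even_trig_coeff m) r).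

Lemma cvg_even_trig m r : cvgn (pseries (even_trig_coeff m) r).
Proof.
apply: normed_cvg; apply: (series_le_cvg _ _ _ (is_cvg_series_exp_coeff `|r|)).
- by move=> n; exact: normr_ge0.
- by move=> n; rewrite /exp_coeff/= divr_ge0// exprn_ge0.
- move=> n; rewrite /exp_coeff/even_trig_coeff/= !normrM normrX normrN1 expr1n mul1r.
  rewrite normfV normrX mulrC ler_wpM2l ?exprn_ge0//.
  rewrite ger0_norm// lef_pV2 ?posrE ?ltr0n ?fact_gt0// ler_nat.
  by apply: leq_fact; rewrite -addnn -addnA leq_addr.
Qed.

(** Write 2 (k + 1) = (2 k + m + 2) - m in the derived coefficient: the first term cancels the
    leading factor of the factorial, the second leaves the coefficient of index m + 2. *)
Lemma even_trig_diffs m : pseries_diffs (even_trig_coeff m) =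
  (fun k => - (1/2) * (even_trig_coeff m.+1 k - m%:R * even_trig_coeff m.+2 k)).
Proof.
apply/funext => k; rewrite /pseries_diffs /even_trig_coeff exprS.
rewrite doubleS !addSn !addnS !factS !natrM.
set F := ((_ `!)%:R : R); have F0 : F != 0 by rewrite pnatr_eq0 -lt0n fact_gt0.
have h1 : (k.*2 + m).+1%:R != 0 :> R by rewrite pnatr_eq0.
have h2 : (k.*2 + m).+2%:R != 0 :> R by rewrite pnatr_eq0.
move: h1 h2; rewrite -[k.*2]muln2 -!natr1 !natrD !natrM => h1 h2.
by field; rewrite h1 F0 h2.
Qed.

Lemma is_derive_even_trig m (r : R) : is_derive r 1 (even_trig m)
  (- (1/2) * (even_trig m.+1 r - m%:R * even_trig m.+2 r)).
Proof.
have lin (a b : R^nat) (u v x : R) : cvgn (pseries a x) -> cvgn (pseries b x) ->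
    pseries (fun k => u * (a k - v * b k)) x @ \oo -->
    u * (limn (pseries a x) - v * limn (pseries b x)).
  move=> ca cb.
  rewrite (_ : pseries _ _ = fun n => u * (pseries a x n - v * pseries b x n)).
    by apply: cvgM; [exact: cvg_cst|apply: cvgB => //; apply: cvgM => //; exact: cvg_cst].
  apply/funext => n; rewrite /pseries /series/= !big_mkord !mulr_sumr -sumrB mulr_sumr.
  by apply: eq_bigr => i _; ring.
have c m' x := @cvg_even_trig m' x.
have l m' x := lin _ _ (- (1/2)) m'%:R x (c m'.+1 x) (c m'.+2 x).
have cd m' x : cvgn (pseries (pseries_diffs (even_trig_coeff m')) x).
  by rewrite even_trig_diffs; apply/cvg_ex; eexists; exact: l.
rewrite (_ : - (1/2) * _ = limn (pseries (pseries_diffs (even_trig_coeff m)) r)).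
  (* Termwise differentiation at r asks the first two derived series to converge at some radius
     beyond |r|; here every radius would do. *)
  apply: (@pseries_snd_diffs _ _ (`|r| + 1)) => //.
    rewrite [pseries_diffs (even_trig_coeff m)]even_trig_diffs.
    rewrite (_ : pseries_diffs _ = fun k => - (1/2) * (pseries_diffs (even_trig_coeff m.+1) k
        - m%:R * pseries_diffs (even_trig_coeff m.+2) k)).
      by apply/cvg_ex; eexists; exact: lin.
    by apply/funext => k; rewrite /pseries_diffs; ring.
  by rewrite [ltRHS]ger0_norm ?ltrDl// addr_ge0.
by apply/esym/cvg_lim => //; rewrite even_trig_diffs; exact: l.
Qed.

Lemma Ck_even_trig k m : Ck k setT (even_trig m).
Proof.
elim: k m => [|k IH] m.
  move=> x _; have [/derivable1_diffP d _] := is_derive_even_trig m x.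
  exact: differentiable_continuous.
apply: (Ck_derive1 openT (fun x _ => is_derive_even_trig m x)).
have oT := @openT R.
apply: CkM => //; first exact: Ck_cst.
apply: CkD => //; apply: (@Ck_linear_comp _ _ _ _ _ _ _ -%R) => //.
  exact: opp_continuous.
by apply: CkM => //; exact: Ck_cst.
Qed.

Lemma smooth_on_even_trig (V : normedModType R) (A : set V) (f : V -> R) m :
  smooth_on A f -> smooth_on A (fun x => even_trig m (f x)).
Proof.
move=> hf; have bR := finite_basis_real R.
apply: (smooth_on_comp bR bR (B := setT)) => //.
by apply: smooth_on_open; [exact: openT|move=> k; exact: Ck_even_trig].
Qed.

Lemma cos_even_trig x : cos x = even_trig 0 (x ^+ 2).
Proof.
apply/esym/cvg_lim => //.
rewrite (_ : pseries _ _ = series (cos_coeff' x)); first exact: cvg_cos_coeff'.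
apply/funext => n; rewrite /series/pseries/=; apply: eq_bigr => i _.
by rewrite /cos_coeff' /even_trig_coeff addn0 -exprM mul2n mulrAC.
Qed.

Lemma sin_even_trig x : sin x = x * even_trig 1 (x ^+ 2).
Proof.
apply: (cvg_unique _ (@cvg_sin_coeff' R x)) => //.
rewrite (_ : series _ = fun n => x * pseries (even_trig_coeff 1) (x ^+ 2) n).
  by apply: cvgM; [exact: cvg_cst|exact: cvg_even_trig].
apply/funext => n; rewrite /pseries/series/= mulr_sumr; apply: eq_bigr => i _.
rewrite /sin_coeff' /even_trig_coeff addn1 -exprM mul2n exprS.
by rewrite -exprnP; ring.
Qed.

End EvenSeries.

(** * Flat functions and the smooth step *)

Section Step.
Variable R : realType.

(** The powers of 1/x in front of the exponential make the family stable under differentiation. *)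
Definition flat (k : nat) (x : R) : R :=
  if 0 < x then x^-1 ^+ k * expR (- x^-1) else 0.

(** A quadratic bound at 0 is what gives the flat functions derivative 0 there. *)
Lemma flat_le k : exists2 C : R, 0 < C & forall x, `|flat k x| <= C * x ^+ 2.
Proof.
(* With y = 1/x, raising y/n <= exp (y/n) to the power n gives y^n <= n^n exp y. Taking n = k + 2
   leaves the factor y^(-2) = x^2. *)
pose n := k.+2; exists (n%:R ^+ n); first by rewrite exprn_gt0.
move=> x; rewrite /flat; case: ifPn => x0; last by rewrite normr0 mulr_ge0// sqr_ge0.
have y0 : 0 < x^-1 by rewrite invr_gt0.
rewrite ger0_norm; last by rewrite mulr_ge0 ?exprn_ge0 ?expR_ge0 ?(ltW y0).
rewrite expRN ler_pdivrMr; last exact: expR_gt0.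
have : (x^-1 / n%:R) ^+ n <= expR x^-1.
  have -> : expR x^-1 = expR (x^-1 / n%:R) ^+ n.
    by rewrite -expRM_natl; congr expR; rewrite mulrC divfK// pnatr_eq0.
  apply: lerXn2r; rewrite ?nnegrE ?divr_ge0 ?expR_ge0 ?(ltW y0)//.
  by apply: le_trans (expR_ge1Dx _); rewrite lerDr.
rewrite expr_div_n ler_pdivrMr ?exprn_gt0// => h.
rewrite mulrC mulrA [expR _ * _]mulrC -mulrA.
apply: (@le_trans _ _ (x^-1 ^+ n * x ^+ 2)).
  by rewrite /n !exprS expr0 mulr1; rewrite [leRHS](_ : _ = x^-1 ^+ k)//; field; rewrite gt_eqF.
by rewrite [leRHS]mulrA [leRHS](_ : _ = (expR x^-1 * n%:R ^+ n) * x ^+ 2) ?ler_wpM2r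
    ?sqr_ge0//; ring.
Qed.

Lemma is_derive_flat k (x : R) :
  is_derive x 1 (flat k) (- k%:R * flat k.+1 x + flat k.+2 x).
Proof.
case: (ltrgtP x 0) => [x0|x0|->].
- have -> : - k%:R * flat k.+1 x + flat k.+2 x = 0.
    by rewrite /flat ltNge ltW//= mulr0 addr0.
  apply: (@near_eq_is_derive _ R R (cst 0)).
  near=> y; rewrite /flat ifF//; apply/negbTE; rewrite -leNgt ltW//.
  by near: y; exact: lt_nbhsl.
- have xn0 : x != 0 by rewrite gt_eqF.
  have di : is_derive x 1 (fun y : R => y^-1) (- (x^-1 * x^-1)).
    apply: DeriveDef; first exact: (@derivableV _ _ id).
    by rewrite (@deriveV _ _ id)// derive_id /GRing.scale/= mulr1 expr2 invfM.
  have de : is_derive x 1 (fun y : R => expR (- y^-1)) (expR (- x^-1) * (x^-1 * x^-1)).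
    have dn := is_deriveN di.
    have := @is_derive1_comp _ _ (fun y : R => - y^-1) x _ _ (is_derive_expR _) dn.
    by rewrite opprK.
  have h := is_deriveM (is_deriveX k di) de.
  apply: (near_eq_is_derive (f := (fun y : R => y^-1) ^+ k * (fun y : R => expR (- y^-1)))).
    near=> y; rewrite /flat ifT//.
      by rewrite [LHS]/(_ * _) fctE.
    by near: y; exact: lt_nbhsr.
  rewrite /flat x0; apply: (is_derive_eq h).
  rewrite exprfctE /GRing.scale/=; set y := x^-1; set E := expR _.
  case: (k) => [|k']; first by rewrite /= !exprS expr0; ring.
  by rewrite /= !exprS; ring.
- have -> : - k%:R * flat k.+1 0 + flat k.+2 0 = 0.
    by rewrite /flat ltxx mulr0 addr0.
  have [C C0 hC] := flat_le k.
  have [L LE] := @linear_pack R R R (fun=> 0) (fun a x y => esym (etrans (addr0 _) (mulr0 _))).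
  have [dd dE] : is_diff (0 : R) (flat k) L.
    apply: is_diff_eps; first by rewrite LE; exact: cst_continuous.
    move=> e e0; near=> h; rewrite LE addr0 {2}/flat ltxx !subr0.
    apply: le_trans (hC h) _; rewrite -(real_normK (num_real h)) expr2 mulrA ler_wpM2r//.
    rewrite mulrC -ler_pdivlMr//; near: h.
    exact: (@nbhs0_le R R _ (divr_gt0 e0 C0)).
  by apply: DeriveDef; [exact: diff_derivable|rewrite deriveE// dE LE].
Unshelve. all: by end_near. Qed.

Lemma Ck_flat n k : Ck n setT (flat k).
Proof.
elim: n k => [|n IH] k.
  move=> x _; have [/derivable1_diffP d _] := is_derive_flat k x.
  exact: differentiable_continuous.
apply: (Ck_derive1 openT (fun x _ => is_derive_flat k x)).
apply: CkD => //; first exact: openT.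
by apply: CkM => //; [exact: openT|exact: Ck_cst].
Qed.

(** A smooth transition from 0 on t <= 1/3 to 1 on t >= 2/3. The denominator never vanishes, since
    every t lies above 1/3 or below 2/3. *)
Definition step (t : R) : R :=
  flat 0 (t - 1/3) / (flat 0 (t - 1/3) + flat 0 (2/3 - t)).

Let flat_ge0 x : 0 <= flat 0 x.
Proof. by rewrite /flat; case: ifP => // _; rewrite expr0 mul1r expR_ge0. Qed.

Let flat_gt0 x : 0 < x -> 0 < flat 0 x.
Proof. by rewrite /flat => ->; rewrite expr0 mul1r expR_gt0. Qed.

Let step_den t : 0 < flat 0 (t - 1/3) + flat 0 (2/3 - t).
Proof.
have [h|h] := ltP (1/3) t; first by apply: ltr_pwDl => //; apply: flat_gt0; lra.
by apply: ltr_wpDl => //; apply: flat_gt0; lra.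
Qed.

Lemma step_itv t : 0 <= step t <= 1.
Proof.
rewrite divr_ge0//=; last exact: ltW.
by rewrite /step ler_pdivrMr// [leRHS]mul1r lerDl.
Qed.

Lemma step0 t : t <= 1/3 -> step t = 0.
Proof. by move=> h; rewrite /step {1}/flat ifF ?mul0r//; apply/negbTE; rewrite -leNgt; lra. Qed.

Lemma step1 t : 2/3 <= t -> step t = 1.
Proof.
move=> h; rewrite /step (_ : flat 0 (2/3 - t) = 0).
  by rewrite addr0 divff// gt_eqF//; apply: flat_gt0; lra.
by rewrite /flat ifF//; apply/negbTE; rewrite -leNgt; lra.
Qed.

Lemma smooth_on_step (V : normedModType R) (A : set V) (f : V -> R) :
  smooth_on A f -> smooth_on A (fun x => step (f x)).
Proof.
move=> hf; have bR := finite_basis_real R.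
have h g : smooth_on A g -> smooth_on A (fun x => flat 0 (g x)).
  move=> hg; apply: (smooth_on_comp bR bR (B := setT)) => //.
  by apply: smooth_on_open; [exact: openT|move=> k; exact: Ck_flat].
have h1 : smooth_on A (fun x => flat 0 (f x - 1/3)).
  by apply: h; apply: smooth_onB => //; exact: smooth_on_cst.
apply: smooth_onM => //; apply: smooth_onV => [x _|]; first by rewrite gt_eqF.
apply: smooth_onD => //; apply: h.
by apply: smooth_onB => //; exact: smooth_on_cst.
Qed.

End Step.

(** * Maps of spheres and their Jacobians *)

Section EuclideanNorm.
Variable R : realType.

Lemma enorm_ge0 n (x : 'rV[R]_n) : 0 <= enorm x.
Proof. exact: sqrtr_ge0. Qed.

Lemma enorm_sqr n (x : 'rV[R]_n) : enorm x ^+ 2 = \sum_i x 0 i ^+ 2.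
Proof. by rewrite sqr_sqrtr// sumr_ge0// => i _; exact: sqr_ge0. Qed.

Lemma enorm_eq0 n (x : 'rV[R]_n) : (enorm x == 0) = (x == 0).
Proof.
apply/idP/eqP => [/eqP h|->]; last first.
  by rewrite /enorm big1 ?sqrtr0// => i _; rewrite mxE expr0n.
have : \sum_i x 0 i ^+ 2 = 0 by rewrite -enorm_sqr h expr0n.
move=> /psumr_eq0P H; apply/rowP => i; rewrite mxE.
by apply/eqP; rewrite -sqrf_eq0; apply/eqP/H => // j _; exact: sqr_ge0.
Qed.

Lemma enorm_gt0 n (x : 'rV[R]_n) : (0 < enorm x) = (x != 0).
Proof. by rewrite lt_def enorm_ge0 andbT enorm_eq0. Qed.

Lemma enorm0 n : enorm (0 : 'rV[R]_n) = 0.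
Proof. by apply/eqP; rewrite enorm_eq0. Qed.

Lemma enormZ n (a : R) (x : 'rV[R]_n) : enorm (a *: x) = `|a| * enorm x.
Proof.
rewrite /enorm -sqrtr_sqr -sqrtrM ?sqr_ge0//; congr Num.sqrt.
by rewrite mulr_sumr; apply: eq_bigr => i _; rewrite mxE exprMn.
Qed.

Lemma enorm_row_mx n m (x : 'rV[R]_n) (y : 'rV[R]_m) :
  enorm (row_mx x y) ^+ 2 = enorm x ^+ 2 + enorm y ^+ 2.
Proof.
rewrite !enorm_sqr big_split_ord/=; congr (_ + _); apply: eq_bigr => i _.
  by rewrite row_mxEl.
by rewrite row_mxEr.
Qed.

Lemma enorm_scalar (a : R) : enorm (a%:M : 'rV[R]_1) = `|a|.
Proof. by rewrite /enorm big_ord1 mxE eqxx mulr1n sqrtr_sqr. Qed.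

Lemma sphere_neq0 n (x : 'rV[R]_n) : sphere R n x -> x != 0.
Proof. by rewrite /sphere/= -enorm_gt0 => ->. Qed.

Lemma sphere_normalize n (x : 'rV[R]_n) : x != 0 -> sphere R n ((enorm x)^-1 *: x).
Proof.
rewrite -enorm_gt0 => x0.
by rewrite /sphere/= enormZ ger0_norm ?invr_ge0 ?enorm_ge0// mulVf ?gt_eqF.
Qed.

Lemma open_rV_neq0 n : open [set x : 'rV[R]_n | x != 0].
Proof.
have -> : [set x : 'rV[R]_n | x != 0] = ~` [set 0].
  by apply/seteqP; split => x /= /eqP.
rewrite openC; apply: accessible_closed_set1.
by apply: hausdorff_accessible; exact: norm_hausdorff.
Qed.

Lemma smooth_on_coord (V : normedModType R) n (A : set V) (f : V -> 'rV[R]_n) i :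
  smooth_on A f -> @smooth_on R V R A (fun x => f x 0 i).
Proof.
apply: (@smooth_on_linear_comp R V 'rV[R]_n R A f (fun x => x 0 i)).
- exact: finite_basis_rV.
- exact: finite_basis_real.
- by move=> a x y; rewrite !mxE.
Qed.

Lemma smooth_on_enorm (V : normedModType R) n (A : set V) (f : V -> 'rV[R]_n) :
  (forall x, A x -> f x != 0) -> smooth_on A f ->
  @smooth_on R V R A (fun x => enorm (f x)).
Proof.
move=> f0 hf; apply: smooth_on_sqrt => [x Ax|].
  by rewrite -enorm_sqr exprn_gt0// enorm_gt0; exact: f0.
apply: smooth_on_sum => i.
by apply: smooth_onM; exact: smooth_on_coord.
Qed.

Lemma smooth_on_normalize (V : normedModType R) n (A : set V) (f : V -> 'rV[R]_n) :
  (forall x, A x -> f x != 0) -> smooth_on A f ->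
  smooth_on A (fun x => (enorm (f x))^-1 *: f x).
Proof.
move=> f0 hf; apply: smooth_onZ => //; first exact: finite_basis_rV.
apply: smooth_onV; last exact: smooth_on_enorm.
by move=> x Ax; rewrite enorm_eq0 f0.
Qed.

Lemma smooth_on_continuous (V W : normedModType R) (U : set V) (f : V -> W) :
  open U -> smooth_on U f -> forall x, U x -> {for x, continuous f}.
Proof. by move=> oU /(smooth_on_Ck 0 oU). Qed.

Lemma smooth_on_within (V W : normedModType R) (A : set V) (f : V -> W) :
  smooth_on A f -> {within A, continuous f}.
Proof.
move=> h; apply/subspace_continuousP => x Ax.
have [U [F [oU Ux CF FE]]] := h x Ax.
change (f y @[y --> within A (nbhs x)] --> f x).
rewrite FE//.
have cF : F y @[y --> within A (nbhs x)] --> F x.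
  by apply: cvg_within_filter; exact: (CF 0%N x Ux).
apply: (cvg_trans _ cF); apply: near_eq_cvg; near=> y; rewrite FE//.
  by near: y; apply: cvg_within; exact: open_nbhs_nbhs.
by near: y; exact: withinT.
Unshelve. all: by end_near. Qed.

Lemma sphere_compact n : compact (sphere R n).
Proof.
apply: bounded_closed_compact.
  exists 1; split; first exact: num_real.
  move=> M M1 x /= hx.
  rewrite /Num.norm/= mx_normrE; apply: bigmax_le; first by apply: ltW; apply: lt_trans M1.
  move=> [i j] _ /=; rewrite (ord1 i); apply: le_trans (ltW M1).
  rewrite -(@ler_pXn2r _ 2%N)// ?nnegrE// expr1n real_normK ?num_real//.
  rewrite -(expr1n R 2) -hx enorm_sqr (bigD1 j)//= lerDl.
  by apply: sumr_ge0 => k _; exact: sqr_ge0.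
have -> : sphere R n = (fun x => \sum_i x 0 i ^+ 2) @^-1` [set 1].
  apply/seteqP; split => x /=; rewrite -enorm_sqr; first by move=> ->; rewrite expr1n.
  move=> h; apply/eqP; rewrite -(@eqrXn2 _ 2%N)// ?enorm_ge0//; last by rewrite h expr1n.
apply: preimage_closed; last first.
  by apply: accessible_closed_set1; apply: hausdorff_accessible; exact: norm_hausdorff.
move=> x _; apply: (@smooth_on_continuous 'rV[R]_n R setT) => //; first exact: openT.
apply: smooth_on_sum => i; apply: smooth_onM; apply: smooth_on_coord.
  by apply: smooth_on_linear => //; exact: finite_basis_rV.
by apply: smooth_on_linear => //; exact: finite_basis_rV.
Qed.

End EuclideanNorm.

(** * Jacobians and the inverse function theorem *)

Section Jacobian.
Variable R : realType.

Lemma jacobianE n m (f : 'rV[R]_n -> 'rV[R]_m) (x : 'rV[R]_n) i j :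
  differentiable f x -> 'J f x i j = 'D_(delta_mx 0 i) f x 0 j.
Proof. by move=> df; rewrite mxE deriveE. Qed.

Lemma row_jacobian n m (f : 'rV[R]_n -> 'rV[R]_m) (x : 'rV[R]_n) i :
  differentiable f x -> row i ('J f x) = 'D_(delta_mx 0 i) f x.
Proof. by move=> df; rewrite rowE (deriveEjacobian _ df). Qed.

Lemma smooth_on_det (V : normedModType R) n (A : set V) (M : V -> 'M[R]_n) :
  (forall i j, @smooth_on R V R A (fun x => M x i j)) ->
  @smooth_on R V R A (fun x => \det (M x)).
Proof.
move=> h; apply: smooth_on_sum => s; apply: smooth_onM; first exact: smooth_on_cst.
by apply: smooth_on_prod => i.
Qed.

(** By Cramer's rule: cofactors divided by the determinant. *)
Lemma smooth_on_invmx (V : normedModType R) n (A : set V) (M : V -> 'M[R]_n) :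
  (forall x, A x -> \det (M x) != 0) ->
  (forall i j, @smooth_on R V R A (fun x => M x i j)) ->
  forall i j, @smooth_on R V R A (fun x => invmx (M x) i j).
Proof.
move=> d0 h i j.
apply: (@smooth_on_eq _ _ _ _ (fun x => (\det (M x))^-1 * ((-1) ^+ (j + i) * \det (row' j
    (col' i (M x)))))).
  by move=> x Ax; rewrite /invmx unitmxE unitfE d0// !mxE.
apply: smooth_onM; first by apply: smooth_onV => //; exact: smooth_on_det.
apply: smooth_onM; first exact: smooth_on_cst.
by apply: smooth_on_det => k l; apply: smooth_on_eq (h (lift j k) (lift i l)) => x _; rewrite
    !mxE.
Qed.

Lemma smooth_on_jacobian n m (U : set 'rV[R]_n) (f : 'rV[R]_n -> 'rV[R]_m) i j :
  open U -> smooth_on U f -> @smooth_on R _ R U (fun x => 'J f x i j).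
Proof.
move=> oU hf; have [d _] := smooth_on_Ck 1 oU hf.
apply: (@smooth_on_eq _ _ _ _ (fun x => 'D_(delta_mx 0 i) f x 0 j)).
  by move=> x Ux; rewrite jacobianE//; exact: d.
apply: smooth_on_coord; apply: smooth_on_open => // k.
by have [_] := smooth_on_Ck k.+1 oU hf; apply.
Qed.

(** Jacobian matrices act on row vectors from the right, whence the order of the factors. *)
Lemma jacobian_comp n m p (f : 'rV[R]_n -> 'rV[R]_m) (g : 'rV[R]_m -> 'rV[R]_p) x :
  differentiable f x -> differentiable g (f x) ->
  'J (g \o f) x = 'J f x *m 'J g (f x).
Proof.
move=> df dg; apply/row_matrixP => i.
by rewrite row_mul !rowE !mul_rV_lin1 diff_comp.
Qed.

Lemma jacobian_id n (x : 'rV[R]_n) : 'J id x = 1%:M.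
Proof.
have d : differentiable (id : 'rV[R]_n -> 'rV[R]_n) x by [].
apply/row_matrixP => i.
by rewrite !rowE mulmx1 mul_rV_lin1 -deriveE// derive_id.
Qed.

Lemma near_eq_jacobian n m (f g : 'rV[R]_n -> 'rV[R]_m) x :
  (\forall y \near x, f y = g y) -> differentiable f x -> 'J f x = 'J g x.
Proof.
move=> fg df; have dg := near_eq_differentiable fg df.
apply/row_matrixP => i.
exact: (etrans (row_jacobian i df) (etrans (near_eq_derive _ fg) (esym (row_jacobian i dg)))).
Qed.

(** An increment k of the argument and the increment h of G satisfy k = h J + o(h), that is h = k
    J^(-1) + o(h). Continuity of G makes h small, and then |h| is at most a constant times |k|, so
    that o(h) is o(k). *)
Lemma inverse_differentiable n (F G : 'rV[R]_n -> 'rV[R]_n) (y : 'rV[R]_n) :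
  (\forall z \near y, F (G z) = z) -> {for y, continuous G} ->
  differentiable F (G y) -> \det ('J F (G y)) != 0 ->
  is_diff y G (mulmxr (invmx ('J F (G y)))).
Proof.
move=> FG cG dF d0.
set J := 'J F (G y); set M := invmx J.
have uJ : J \in unitmx by rewrite unitmxE unitfE.
have cM : continuous (mulmxr M : 'rV[R]_n -> 'rV[R]_n).
  by apply: finite_basis_continuous; exact: finite_basis_rV.
have [C C0 hC] := linear_lipschitz cM.
apply: is_diff_eps => // e e0.
(* The first bound gives C d <= 1/2, by which the error term C d |h| is absorbed and |h| <= 2 C |k|.
   The second then bounds that error, at most 2 C^2 d |k|, by e |k|. *)
pose d := Num.min (1 / (2 * C)) (e / (2 * C * C)).
have d0' : 0 < d by rewrite lt_min !divr_gt0 ?mulr_gt0.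
have h1 := diff_eps dF d0'.
have /nbhs0P FG0 := FG.
have cG0 : (fun k => G (k + y) - G y) @ (0 : 'rV[R]_n) --> (0 : 'rV[R]_n).
  have c1 : (fun k => G (k + y)) @ (0 : 'rV[R]_n) --> G y.
    have E : (G \o shift y) @ (0 : 'rV[R]_n) = G @ y by rewrite cvg_comp_shift add0r.
    by rewrite -[X in X @ _ --> _]/(G \o shift y) E; exact: cG.
  by have := cvgB c1 (cvg_cst (G y)); rewrite subrr; apply.
have h2 : \forall k \near (0 : 'rV[R]_n),
    `|F (G (k + y) - G y + G y) - F (G y) - 'd F (G y) (G (k + y) - G y)|
      <= d * `|G (k + y) - G y| := cG0 _ h1.
near=> k.
pose h := G (k + y) - G y.
have E1 : F (h + G y) - F (G y) = k.
  rewrite /h subrK (nbhs_singleton FG) (addrC k y).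
  have -> : F (G (y + k)) = y + k by near: k.
  by rewrite addrAC subrr add0r.
have Eh : `|k - h *m J| <= d * `|h|.
  have : `|F (h + G y) - F (G y) - 'd F (G y) h| <= d * `|h|.
    by rewrite /h; near: k; exact: h2.
  by rewrite E1 /J mul_rV_lin1.
have E2 : h - k *m M = - ((k - h *m J) *m M).
  by rewrite mulmxBl -mulmxA mulmxV// mulmx1 opprB.
have le1 : `|h - k *m M| <= C * (d * `|h|).
  rewrite E2 normrN; apply: le_trans (hC _) _.
  by rewrite ler_pM2l.
have dC : C * d <= 1/2.
  by rewrite mulrC -ler_pdivlMr// ge_min; apply/orP; left; rewrite invfM mulrA.
have le2 : `|h| <= 2 * C * `|k|.
  have t1 : `|h| <= `|h - k *m M| + `|k *m M|.
    by rewrite -{1}(subrK (k *m M) h); exact: ler_normD.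
  have t2 : `|k *m M| <= C * `|k| := hC k.
  have t3 : C * (d * `|h|) <= 1/2 * `|h| by rewrite mulrA ler_wpM2r.
  lra.
apply: le_trans le1 _.
have de : C * d * (2 * C) <= e.
  have : d <= e / (2 * C * C) by rewrite ge_min lexx orbT.
  rewrite ler_pdivlMr ?mulr_gt0//; lra.
have : C * d * `|h| <= C * d * (2 * C * `|k|) by rewrite ler_wpM2l// mulr_ge0// ltW.
have : C * d * (2 * C) * `|k| <= e * `|k| by rewrite ler_wpM2r.
lra.
Unshelve. all: by end_near. Qed.

(** Bootstrap: the differential of G at y is the inverse of ['J F (G y)], whose entries are smooth
    functions of G y. Hence G is of class C^(k+1) as soon as it is of class C^k. *)
Lemma inverse_smooth n (U V : set 'rV[R]_n) (F G : 'rV[R]_n -> 'rV[R]_n) :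
  open U -> open V -> smooth_on U F ->
  (forall y, V y -> U (G y)) -> (forall y, V y -> F (G y) = y) ->
  (forall y, V y -> {for y, continuous G}) ->
  (forall x, U x -> \det ('J F x) != 0) ->
  forall k, Ck k V G.
Proof.
move=> oU oV sF GU FG cG d0.
have bn := finite_basis_rV R n.
have [dF _] := smooth_on_Ck 1 oU sF.
have dG y : V y -> is_diff y G (mulmxr (invmx ('J F (G y)))).
  move=> Vy; apply: inverse_differentiable.
  - by apply: filterS FG _; exact: open_nbhs_nbhs.
  - exact: cG.
  - exact/dF/GU.
  - exact/d0/GU.
have sM i j := @smooth_on_invmx _ _ U (fun x => 'J F x) d0
   (fun i j => smooth_on_jacobian i j oU sF) i j.
elim=> [|k IH]; first exact: cG.
split=> [y /dG [] //|v].
apply: (@Ck_eq _ _ _ _ _ (fun y => \sum_j (\sum_i v 0 i * invmx ('J F (G y)) i j) *: delta_mx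
    0 j)) => //.
  move=> y Vy; have [dGy dE] := dG y Vy.
  rewrite deriveE// dE /= [RHS]row_sum_delta.
  by apply: eq_bigr => j _; rewrite mxE.
apply: Ck_sum => // j; apply: Ck_scalel => //; apply: Ck_sum => // i.
apply: CkM => //; first exact: Ck_cst.
apply: (@Ck_comp _ _ _ _ _ _ U G (fun x => invmx ('J F x) i j)) => //.
  exact: finite_basis_real.
exact: smooth_on_Ck.
Qed.

End Jacobian.

(** * Radial extensions of maps of the sphere *)

Section Radial.
Variables (R : realType) (n : nat).
Local Notation S := (sphere R n).
Local Notation I := ([set` `[0, 1]] : set R).
Local Notation "'N0'" := ([set x : 'rV[R]_n | x != 0]).
Implicit Types f g : 'rV[R]_n -> 'rV[R]_n.

Lemma eq_radial_extension f g x : (forall z, S z -> f z = g z) ->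
  radial_extension f x = radial_extension g x.
Proof.
move=> fg; rewrite /radial_extension.
have [->|x0] := eqVneq x 0; first by rewrite enorm0 !scale0r.
by rewrite fg//; exact: sphere_normalize.
Qed.

Lemma radial_extension_sphere f x : S x -> radial_extension f x = f x.
Proof. by move=> h; rewrite /radial_extension h invr1 !scale1r. Qed.

Lemma enorm_radial_extension f x : set_fun S S f ->
  enorm (radial_extension f x) = enorm x.
Proof.
move=> Sf; have [->|x0] := eqVneq x 0; first by rewrite /radial_extension enorm0 scale0r enorm0.
rewrite enormZ (Sf _ (sphere_normalize x0)) mulr1 ger0_norm//.
exact: enorm_ge0.
Qed.

Lemma radial_extension_neq0 f x : set_fun S S f -> x != 0 ->
  radial_extension f x != 0.
Proof. by move=> Sf; rewrite -!enorm_gt0 enorm_radial_extension. Qed.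

Lemma radial_extension_comp f g x : set_fun S S f -> x != 0 ->
  radial_extension g (radial_extension f x) = radial_extension (g \o f) x.
Proof.
move=> Sf x0; rewrite {1}/radial_extension enorm_radial_extension//.
congr (_ *: g _); rewrite scalerA mulVf ?scale1r//.
by rewrite enorm_eq0.
Qed.

Lemma radial_extension_id (x : 'rV[R]_n) : radial_extension id x = x.
Proof.
rewrite /radial_extension; have [->|x0] := eqVneq x 0; first by rewrite enorm0 scale0r.
by rewrite scalerA divff ?scale1r// enorm_eq0.
Qed.

Lemma smooth_on_radial_extension f :
  smooth_on S f -> smooth_on N0 (radial_extension f).
Proof.
move=> sf; have bn := finite_basis_rV R n.
have hid : smooth_on N0 (id : 'rV[R]_n -> 'rV[R]_n) by exact: smooth_on_linear.
apply: smooth_onZ => //; first exact: smooth_on_enorm.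
apply: (smooth_on_comp (B := S) (g := f) bn bn) => //.
  by move=> x; exact: sphere_normalize.
exact: smooth_on_normalize.
Qed.

Lemma differentiable_radial_extension f x : smooth_on S f -> x != 0 ->
  differentiable (radial_extension f) x.
Proof.
move=> /smooth_on_radial_extension sf x0.
by have [+ _] := smooth_on_Ck 1 (@open_rV_neq0 R n) sf; apply.
Qed.

Let mul_eq1_neq0 (a b : R) : a * b = 1 -> a != 0.
Proof.
by move=> h; apply/eqP => a0; move: h; rewrite a0 mul0r => /esym/eqP; rewrite oner_eq0.
Qed.

(** The chain rule, applied to the radial extensions of f and g, gives two matrices whose product is
    the identity. *)
Lemma inverse_det_neq0 f g : set_fun S S f -> smooth_on S f -> smooth_on S g ->
  (forall x, S x -> g (f x) = x) ->
  forall x, x != 0 -> \det ('J (radial_extension f) x) != 0.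
Proof.
move=> Sf sf sg gf x x0.
have df := differentiable_radial_extension sf x0.
have dg := differentiable_radial_extension sg (radial_extension_neq0 Sf x0).
have E := jacobian_comp df dg.
have E1 : 'J (radial_extension g \o radial_extension f) x = 1%:M.
  apply: etrans (jacobian_id x).
  apply: near_eq_jacobian; last exact: differentiable_comp.
  near=> y; rewrite /= radial_extension_comp//.
    by rewrite -[RHS]radial_extension_id; exact: eq_radial_extension.
  by near: y; apply: open_nbhs_nbhs; split => //; exact: open_rV_neq0.
have := congr1 determinant (etrans (esym E) E1); rewrite det_mulmx det1 => h.
exact: (mul_eq1_neq0 h).
Unshelve. all: by end_near. Qed.

(** A continuous bijection of a compact space onto a Hausdorff space is a homeomorphism: the image
    under f of the part of the sphere outside a neighbourhood B of g (y/|y|) is compact, hence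
    closed, and misses y/|y|. *)
Lemma sphere_inverse_continuous f g : set_fun S S f -> smooth_on S f ->
  set_fun S S g -> (forall x, S x -> g (f x) = x) -> (forall x, S x -> f (g x) = x) ->
  forall y, y != 0 -> {for y, continuous (radial_extension g)}.
Proof.
move=> Sf sf Sg gf fg y y0.
have bn := finite_basis_rV R n.
have hid : smooth_on N0 (id : 'rV[R]_n -> 'rV[R]_n) by exact: smooth_on_linear.
have oN := @open_rV_neq0 R n.
have cn : {for y, continuous (fun x : 'rV[R]_n => (enorm x)^-1 *: x)}.
  by apply: (smooth_on_continuous oN) => //; exact: smooth_on_normalize.
have ce : {for y, continuous (fun x : 'rV[R]_n => enorm x : R)}.
  by apply: (@smooth_on_continuous R _ R _ _ oN) => //; exact: smooth_on_enorm.
apply: (cvgZ (s := fun x => enorm x) (k := enorm y) ce).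
move=> A /= ; rewrite nbhsE => -[B [oB By] BA].
pose K := S `&` ~` B.
have cK : compact (f @` K).
  apply: continuous_compact; last first.
    by apply: compact_closedI; [exact: sphere_compact|exact: open_closedC].
  by apply: continuous_subspaceW (smooth_on_within sf) => x [].
have clK : closed (f @` K) by apply: compact_closed => //; exact: norm_hausdorff.
have : \forall x \near y, (~` (f @` K)) ((enorm x)^-1 *: x).
  apply: cn; apply: open_nbhs_nbhs; split; first exact: closed_openC.
  move=> [z [Sz Bz] fz]; apply: Bz; suff -> : z = g ((enorm y)^-1 *: y) by [].
  by rewrite -fz gf.
move=> h; suff : \forall x \near y, A (g ((enorm x)^-1 *: x)) by [].
near=> x; apply: BA; apply: contrapT => nB.
have x0 : x != 0 by near: x; exact: open_nbhs_nbhs.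
have : (~` (f @` K)) ((enorm x)^-1 *: x) by near: x.
have Sx := sphere_normalize x0.
apply; exists (g ((enorm x)^-1 *: x)); last exact: fg.
by split => //; exact: Sg.
Unshelve. all: by end_near. Qed.

(** The inverse function theorem for a global bijection. It produces the smooth inverse of a
    boundary map, for which only slicewise inverses are at hand. *)
Lemma sphere_inverse_smooth f g : set_fun S S f -> smooth_on S f ->
  set_fun S S g -> (forall x, S x -> g (f x) = x) -> (forall x, S x -> f (g x) = x) ->
  (forall x, S x -> \det ('J (radial_extension f) x) != 0) ->
  smooth_on S g.
Proof.
move=> Sf sf Sg gf fg d0.
have oN := @open_rV_neq0 R n.
have sF := smooth_on_radial_extension sf.
(* The determinant is assumed nonzero on the sphere only. The inverse is treated on the open set [V]
   of points whose preimage lies in [U], and [V] contains the sphere. *)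
pose U := N0 `&` [set x | \det ('J (radial_extension f) x) != 0].
have sD : @smooth_on R _ R N0 (fun x => \det ('J (radial_extension f) x)).
  by apply: smooth_on_det => i j; exact: smooth_on_jacobian.
have oU : open U.
  have /(continuous_inP _ oN) h : {in N0, continuous (fun x => \det ('J (radial_extension f)
      x) : R)}.
    by move=> x; rewrite inE => x0; exact: (smooth_on_continuous oN sD).
  exact: (h _ (@open_neq0 R)).
have cG y (y0 : y != 0) := sphere_inverse_continuous Sf sf Sg gf fg y0.
pose V := N0 `&` radial_extension g @^-1` U.
have oV : open V.
  have /(continuous_inP _ oN) h : {in N0, continuous (radial_extension g)}.
    by move=> x; rewrite inE => x0; exact: cG.
  exact: h.
have CG : forall k, Ck k V (radial_extension g).
  have sU : smooth_on U (radial_extension f) by apply: smooth_on_sub sF => x [].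
  have GU y : V y -> U (radial_extension g y) by case.
  have FG y : V y -> radial_extension f (radial_extension g y) = y.
    move=> [y0 _]; rewrite radial_extension_comp// -[RHS]radial_extension_id.
    exact: eq_radial_extension.
  have cV y : V y -> {for y, continuous (radial_extension g)} by case=> y0 _; exact: cG.
  have dU x : U x -> \det ('J (radial_extension f) x) != 0 by case.
  exact: (inverse_smooth oU oV sU GU FG cV dU).
apply: (@smooth_on_eq _ _ _ _ (radial_extension g)).
  by move=> x; exact: radial_extension_sphere.
apply: (@smooth_on_sub _ _ _ V); last exact: smooth_on_open.
move=> x Sx; split; first exact: sphere_neq0.
rewrite /= radial_extension_sphere//; split; first exact/sphere_neq0/Sg.
exact/d0/Sg.
Qed.

Lemma Diffp_of_bij f g : set_fun S S f -> smooth_on S f ->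
  set_fun S S g -> (forall x, S x -> g (f x) = x) -> (forall x, S x -> f (g x) = x) ->
  orientation_preserving f -> Diffp f.
Proof.
move=> Sf sf Sg gf fg of_; split=> //; split => //; exists g; split => //.
by apply: (sphere_inverse_smooth Sf sf Sg gf fg) => x Sx; rewrite gt_eqF// of_.
Qed.

Lemma eq_orientation_preserving f g : (forall x, S x -> f x = g x) ->
  orientation_preserving f -> orientation_preserving g.
Proof.
move=> fg h x Sx; rewrite (_ : radial_extension g = radial_extension f); first exact: h.
by apply/funext => y; apply: eq_radial_extension => z /fg.
Qed.

Lemma eq_Diffp f g : (forall x, S x -> f x = g x) -> Diffp f -> Diffp g.
Proof.
move=> fg [[Sf sf [h [Sh sh hf fh]]] of_]; split; last exact: (eq_orientation_preserving fg of_).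
split.
- by move=> x Sx; rewrite -fg//; exact: Sf.
- exact: smooth_on_eq sf.
- exists h; split => // x Sx; first by rewrite -fg// hf.
  by rewrite -fg ?fh//; exact: Sh.
Qed.

Lemma Diffp_id : Diffp (id : 'rV[R]_n -> 'rV[R]_n).
Proof.
have sid : smooth_on S (id : 'rV[R]_n -> 'rV[R]_n).
  by apply: smooth_on_linear => //; exact: finite_basis_rV.
split; first by split => //; exists id; split.
move=> x Sx; rewrite (_ : radial_extension _ = id); last first.
  by apply/funext => y; exact: radial_extension_id.
by rewrite jacobian_id det1.
Qed.

Lemma family_smooth_on (a : R -> 'rV[R]_n -> 'rV[R]_n) t :
  smooth_on (I `*` S) (fun tx : R * 'rV[R]_n => a tx.1 tx.2) -> I t ->
  smooth_on S (a t).
Proof.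
move=> sa It.
have bn := finite_basis_rV R n; have bR := finite_basis_real R.
apply: (@smooth_on_comp _ _ _ _ S (I `*` S) (fun x => (t, x))
   (fun tx : R * 'rV[R]_n => a tx.1 tx.2)) => //.
  exact: finite_basis_prod.
apply: smooth_on_pair; first exact: smooth_on_cst.
exact: smooth_on_linear.
Qed.

Lemma smooth_on_family_radial_extension (a : R -> 'rV[R]_n -> 'rV[R]_n) :
  smooth_on (I `*` S) (fun tx : R * 'rV[R]_n => a tx.1 tx.2) ->
  smooth_on (I `*` N0) (fun tx : R * 'rV[R]_n => radial_extension (a tx.1) tx.2).
Proof.
move=> sa; have bn := finite_basis_rV R n; have bR := finite_basis_real R.
have bP := finite_basis_prod bR bn.
have s1 : smooth_on (I `*` N0) (fun tx : R * 'rV[R]_n => tx.1) by exact: smooth_on_linear.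
have s2 : smooth_on (I `*` N0) (fun tx : R * 'rV[R]_n => tx.2) by exact: smooth_on_linear.
apply: smooth_onZ => //.
  by apply: smooth_on_enorm => // -[t x] [].
apply: (@smooth_on_comp _ _ _ _ _ (I `*` S) (fun tx : R * 'rV[R]_n => (tx.1, (enorm tx.2)^-1
    *: tx.2))
   (fun tx : R * 'rV[R]_n => a tx.1 tx.2)) => //.
  by move=> [t x] [/= It x0]; split => //=; exact: sphere_normalize.
by apply: smooth_on_pair => //; apply: smooth_on_normalize => // -[t x] [].
Qed.

Lemma derive_partial (F : R * 'rV[R]_n -> 'rV[R]_n) t x v :
  'D_v (fun z => F (t, z)) x = 'D_((0 : R), v) F (t, x).
Proof.
rewrite /derive; apply: (congr1 (fun f : R -> 'rV[R]_n => lim (f @ 0^'))).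
apply/funext => h /=.
rewrite (_ : h *: (0, v) + (t, x) = (t, h *: v + x))//.
congr pair; change (h * 0 + t = t).
by rewrite mulr0 add0r.
Qed.

(** Only derivatives in x enter. For fixed s the radial extension agrees near x with a local
    extension F in both variables, so its partial derivatives are those of F in the directions (0,
    e_i), which are smooth in s up to the ends of the interval. *)
Lemma smooth_on_det_family (a : R -> 'rV[R]_n -> 'rV[R]_n) x : S x ->
  smooth_on (I `*` S) (fun tx : R * 'rV[R]_n => a tx.1 tx.2) ->
  @smooth_on R R R I (fun t => \det ('J (radial_extension (a t)) x)).
Proof.
move=> Sx sa; have x0 := sphere_neq0 Sx.
have bn := finite_basis_rV R n; have bR := finite_basis_real R.
have bP := finite_basis_prod bR bn.
apply: smooth_on_local => t It.
have [U [F [oU Ux CF FE]]] := smooth_on_family_radial_extension sa (conj It x0 : (I `*` N0)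
    (t, x)).
have sp (A : set R) : smooth_on A (fun t : R => (t, x)).
  by apply: smooth_on_pair; [exact: smooth_on_linear|exact: smooth_on_cst].
exists [set t | U (t, x)]; split => //.
  have /continuousP : continuous (fun t : R => (t, x)).
    by move=> s; apply: (smooth_on_continuous (@openT R)).
  exact.
apply: smooth_on_det => i j.
apply: (@smooth_on_eq _ _ _ _ (fun s => 'D_((0 : R), delta_mx 0 i) F (s, x) 0 j)).
  move=> s [Is Us]; rewrite jacobianE; last first.
    exact/differentiable_radial_extension/x0/family_smooth_on.
  congr (fun_of_matrix _ _ _).
  rewrite -derive_partial; apply: near_eq_derive.
  have cz : {for x, continuous (fun z : 'rV[R]_n => (s, z))}.
    apply: (smooth_on_continuous openT) => //.
    by apply: smooth_on_pair; [exact: smooth_on_cst|exact: smooth_on_linear].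
  near=> z.
  apply/esym; apply: (FE (s, z)).
    by near: z; apply: cz; exact: open_nbhs_nbhs.
  split => //=; near: z; apply: open_nbhs_nbhs; split => //; exact: open_rV_neq0.
apply: smooth_on_coord.
apply: (@smooth_on_comp _ _ _ _ _ U (fun s : R => (s, x)) ('D_((0 : R), delta_mx 0 i) F)) => //.
  by move=> s [].
apply: smooth_on_open => // k.
by have [_] := CF k.+1; apply.
Unshelve. all: by end_near. Qed.

Lemma continuous_nonvanishing_gt0 (d : R -> R) t0 t :
  {within I, continuous d} -> (forall t, I t -> d t != 0) ->
  I t0 -> 0 < d t0 -> I t -> 0 < d t.
Proof.
move=> cd d0 It0 dt0 It; rewrite lt_neqAle eq_sym d0//= leNgt; apply/negP => dt.
have sub a b : I a -> I b -> [set` `[a, b]] `<=` I.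
  move=> + + z; rewrite /= !in_itv/= => /andP[a0 a1] /andP[b0 b1] /andP[az zb].
  by rewrite (le_trans a0)//= (le_trans zb).
have [h|h] := leP t0 t.
  have [|c cI c0] := @IVT R d t0 t 0 h (continuous_subspaceW (sub _ _ It0 It) cd).
    by rewrite ge_min le_max (ltW dt0) (ltW dt) orbT.
  by have := d0 c (sub _ _ It0 It _ cI); rewrite c0 eqxx.
have [|c cI c0] := @IVT R d t t0 0 (ltW h) (continuous_subspaceW (sub _ _ It It0) cd).
  by rewrite ge_min le_max (ltW dt0) (ltW dt) orbT.
by have := d0 c (sub _ _ It It0 _ cI); rewrite c0 eqxx.
Qed.

Lemma path_orientation (a : R -> 'rV[R]_n -> 'rV[R]_n) t0 :
  smooth_on (I `*` S) (fun tx : R * 'rV[R]_n => a tx.1 tx.2) ->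
  (forall t, I t -> diffeo (a t)) -> I t0 -> orientation_preserving (a t0) ->
  forall t, I t -> Diffp (a t).
Proof.
move=> sa da It0 o0 t It; split; first exact: da.
move=> x Sx.
apply: (@continuous_nonvanishing_gt0 (fun t => \det ('J (radial_extension (a t)) x)) t0) => //.
- by apply: smooth_on_within; exact: smooth_on_det_family.
- move=> s Is; have [Sf sf [g [Sg sg gf fg]]] := da _ Is.
  exact: (inverse_det_neq0 Sf sf sg gf (sphere_neq0 Sx)).
- exact: o0.
Qed.

End Radial.

(** * Symmetry and transitivity of isotopy *)

Section Isotopy.
Variables (R : realType) (n : nat).
Local Notation S := (sphere R n).
Local Notation I := ([set` `[0, 1]] : set R).
Implicit Types f g h : 'rV[R]_n -> 'rV[R]_n.

Lemma smooth_on_reparam (V : normedModType R) (A : set V) (t : V -> R) (f : V -> 'rV[R]_n)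
    (a : R -> 'rV[R]_n -> 'rV[R]_n) (B : set 'rV[R]_n) :
  smooth_on (I `*` B) (fun tx : R * 'rV[R]_n => a tx.1 tx.2) ->
  (forall x, A x -> 0 <= t x <= 1) -> (forall x, A x -> B (f x)) ->
  @smooth_on R V R A t -> smooth_on A f -> smooth_on A (fun x => a (t x) (f x)).
Proof.
move=> sa tI fB st sf; have bn := finite_basis_rV R n; have bR := finite_basis_real R.
apply: (@smooth_on_comp R V _ _ A (I `*` B) (fun x => (t x, f x)) (fun tx : R * 'rV[R]_n => a
    tx.1 tx.2)) => //.
- exact: finite_basis_prod.
- by move=> x Ax; split => /=; [rewrite in_itv/=; exact: tI|exact: fB].
- exact: smooth_on_pair.
Qed.

Lemma smooth_on_fst (V W : normedModType R) (A : set (V * W)) :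
  finite_basis V -> finite_basis W -> smooth_on A (fun x : V * W => x.1).
Proof. by move=> bV bW; apply: smooth_on_linear => //; exact: finite_basis_prod. Qed.

Lemma smooth_on_snd (V W : normedModType R) (A : set (V * W)) :
  finite_basis V -> finite_basis W -> smooth_on A (fun x : V * W => x.2).
Proof. by move=> bV bW; apply: smooth_on_linear => //; exact: finite_basis_prod. Qed.

Lemma isotopic_sym f g : isotopic f g -> isotopic g f.
Proof.
move=> [H [sH dH H0 H1]]; have bn := finite_basis_rV R n; have bR := finite_basis_real R.
have sub s : I s -> 0 <= 1 - s <= 1.
  by rewrite /= in_itv/= => /andP[s0 s1]; apply/andP; split; lra.
exists (fun s => H (1 - s)); split.
- apply: (smooth_on_reparam (t := fun sx : R * 'rV[R]_n => 1 - sx.1) (f := snd) sH).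
  + by move=> [s x] [/sub].
  + by move=> [s x] [].
  + by apply: smooth_onB => //; [exact: smooth_on_cst|exact: smooth_on_fst].
  + exact: smooth_on_snd.
- by move=> s /sub sI; apply: dH; rewrite in_itv.
- by rewrite subr0.
- by rewrite subrr.
Qed.

Lemma isotopic_trans f g h : isotopic f g -> isotopic g h -> isotopic f h.
Proof.
move=> [F [sF dF F0 F1]] [G [sG dG G0 G1]].
have bn := finite_basis_rV R n; have bR := finite_basis_real R.
(* Concatenation slowed down by [step]: for s between 1/3 and 2/3 both branches are stationary at g,
   so they glue smoothly around s = 1/2. *)
pose K (s : R) := if s < 1/2 then F (step (2 * s)) else G (step (2 * s - 1)).
have KF s x : S x -> s < 2/3 -> K s x = F (step (2 * s)) x.
  move=> Sx s1; rewrite /K; case: ltP => // s2.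
  rewrite step0; last by lra.
  by rewrite step1 ?F1 ?G0//; lra.
have KG s x : S x -> 1/3 < s -> K s x = G (step (2 * s - 1)) x.
  move=> Sx s1; rewrite /K; case: ltP => // s2.
  rewrite step1; last by lra.
  by rewrite step0 ?F1 ?G0//; lra.
have s1 (A : set (R * 'rV[R]_n)) : smooth_on A (fun sx : R * 'rV[R]_n => 2 * sx.1).
  by apply: smooth_onM; [exact: smooth_on_cst|exact: smooth_on_fst].
have op1 : open [set sx : R * 'rV[R]_n | sx.1 < 2/3].
  apply: (@open_comp _ _ (fun sx : R * 'rV[R]_n => sx.1) [set s | s < 2/3]); last exact: open_lt.
  by move=> x _; exact: cvg_fst.
have op2 : open [set sx : R * 'rV[R]_n | 1/3 < sx.1].
  apply: (@open_comp _ _ (fun sx : R * 'rV[R]_n => sx.1) [set s | 1/3 < s]); last exact: open_gt.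
  by move=> x _; exact: cvg_fst.
exists K; split.
- apply: smooth_on_local => -[s x] [/= sI Sx].
  have [s2|s2] := ltP s (1/2).
    exists [set sx : R * 'rV[R]_n | sx.1 < 2/3]; split => //=; first by lra.
    apply: (@smooth_on_eq _ _ _ _ (fun sx : R * 'rV[R]_n => F (step (2 * sx.1)) sx.2)).
      by move=> [s' x'] [[/= _ Sx'] /= h']; rewrite KF.
    apply: (smooth_on_reparam (t := fun sx : R * 'rV[R]_n => step (2 * sx.1)) (f := snd) sF).
    + by move=> *; exact: step_itv.
    + by move=> [? ?] [[]].
    + exact: smooth_on_step.
    + exact: smooth_on_snd.
  exists [set sx : R * 'rV[R]_n | 1/3 < sx.1]; split => //=; first by lra.
  apply: (@smooth_on_eq _ _ _ _ (fun sx : R * 'rV[R]_n => G (step (2 * sx.1 - 1)) sx.2)).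
    by move=> [s' x'] [[/= _ Sx'] /= h']; rewrite KG.
  apply: (smooth_on_reparam (t := fun sx : R * 'rV[R]_n => step (2 * sx.1 - 1)) (f := snd) sG).
  + by move=> *; exact: step_itv.
  + by move=> [? ?] [[]].
  + apply: smooth_on_step; apply: smooth_onB => //; exact: smooth_on_cst.
  + exact: smooth_on_snd.
- move=> s _; rewrite /K; case: ifP => _; [apply: dF|apply: dG]; rewrite in_itv/=; exact:
    step_itv.
- by move=> x Sx; rewrite KF// ?step0 ?F0//; lra.
- by move=> x Sx; rewrite KG// ?step1 ?G1//; lra.
Qed.

End Isotopy.

(** * Inner products and derivatives of the Euclidean norm *)

Section DotProduct.
Variable R : realType.

(** The case w u = 0 of det (1 + u w) = 1 + w u, read off from two factorizations of the same block
    matrix into triangular blocks. *)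
Lemma det_add_rank1 n (u : 'cV[R]_n) (w : 'rV[R]_n) :
  w *m u = 0 -> \det (1%:M + u *m w) = 1.
Proof.
move=> wu.
have E : block_mx 1%:M 0 u 1%:M *m block_mx 1%:M (- w) 0 (1%:M + u *m w) =
         block_mx 1%:M (- w) 0 1%:M *m block_mx (1%:M : 'M[R]_1) 0 u (1%:M : 'M[R]_n).
  rewrite !mulmx_block !mulmx1 !mul1mx !mul0mx ?mulmx0 !addr0 !add0r.
  by rewrite mulNmx wu subr0 mulmxN addrC addrK.
have := congr1 determinant E.
by rewrite !det_mulmx !det_lblock !det_ublock !det1 !mul1r.
Qed.

Lemma dot_row n (x y : 'rV[R]_n) : (x *m y^T) 0 0 = \sum_i x 0 i * y 0 i.
Proof. by rewrite mxE; apply: eq_bigr => i _; rewrite mxE. Qed.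

Lemma enorm_sqr_dot n (x : 'rV[R]_n) : enorm x ^+ 2 = (x *m x^T) 0 0.
Proof. by rewrite enorm_sqr dot_row; apply: eq_bigr => i _; rewrite expr2. Qed.

Lemma derive_coord (V : normedModType R) n (f : V -> 'rV[R]_n) x v i :
  differentiable f x -> 'D_v (fun y => f y 0 i : R) x = 'D_v f x 0 i.
Proof.
move=> df; have h : derivable f x v by exact: diff_derivable.
by rewrite [in RHS](derive_mx h) mxE.
Qed.

Lemma derive_enorm_sqr (V : normedModType R) n (f : V -> 'rV[R]_n) x v :
  differentiable f x ->
  'D_v (fun y => enorm (f y) ^+ 2 : R) x = 2 * (f x *m ('D_v f x)^T) 0 0.
Proof.
move=> df; have dfi i : derivable (fun y => f y 0 i : R) x v.
  have h : derivable f x v by exact: diff_derivable.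
  exact: (derivable_mxP f x v).1.
rewrite (_ : (fun y => _) = \sum_i (fun y => f y 0 i : R) * (fun y => f y 0 i : R)); last first.
  apply/funext => y; rewrite enorm_sqr fct_sumE; apply: eq_bigr => i _.
  by rewrite expr2.
rewrite derive_sum; last by move=> i; exact: derivableM.
rewrite dot_row mulr_sumr; apply: eq_bigr => i _.
by rewrite deriveM// derive_coord// /GRing.scale/=; ring.
Qed.

Lemma differentiable_enorm n (y : 'rV[R]_n) : y != 0 ->
  differentiable (fun y : 'rV[R]_n => enorm y : R) y.
Proof.
move=> y0; have oN := @open_rV_neq0 R n.
have s : @smooth_on R _ R [set x : 'rV[R]_n | x != 0] (fun y => enorm y).
  by apply: smooth_on_enorm => //; apply: smooth_on_linear => //; exact: finite_basis_rV.
by have [+ _] := smooth_on_Ck 1 oN s; apply.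
Qed.

Lemma derive_enorm n (y v : 'rV[R]_n) : y != 0 ->
  'D_v (fun y : 'rV[R]_n => enorm y : R) y = (y *m v^T) 0 0 / enorm y.
Proof.
move=> y0; have dE := differentiable_enorm y0.
have e0 : enorm y != 0 by rewrite enorm_eq0.
have dd : derivable (fun y : 'rV[R]_n => enorm y : R) y v by exact: diff_derivable.
have h := @derive_enorm_sqr 'rV[R]_n n id y v (ex_diff (is_diff_def := is_diff_id y)).
have E := deriveM dd dd; rewrite derive_id in h.
have : 'D_v (fun y : 'rV[R]_n => enorm y ^+ 2 : R) y = enorm y *: 'D_v (fun y : 'rV[R]_n =>
    enorm y : R) y + enorm y *: 'D_v (fun y : 'rV[R]_n => enorm y : R) y.
  by rewrite -E; congr ('D_v _ y); apply/funext => x; rewrite expr2.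
rewrite h /GRing.scale/= => {}h.
by apply: (mulIf e0); rewrite divfK//; lra.
Qed.

End DotProduct.

(** * The boundary map *)

Section BoundaryOrientation.
Variables (R : realType) (n : nat).
Local Notation S := (sphere R n).
Local Notation S' := (sphere R (1 + n)).
Local Notation I := ([set` `[0, 1]] : set R).
Implicit Types (b : R -> 'rV[R]_n -> 'rV[R]_n) (y : 'rV[R]_(1 + n)).

Definition time_of (y : 'rV[R]_(1 + n)) : R := acos (- lsubmx y 0 0) / pi.

Lemma lsubmx_scalar m (x : 'rV[R]_(1 + m)) : lsubmx x = (lsubmx x 0 0)%:M.
Proof. exact: mx11_scalar. Qed.

Lemma enorm_split y : enorm y ^+ 2 = lsubmx y 0 0 ^+ 2 + enorm (rsubmx y) ^+ 2.
Proof.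
rewrite -{1}(hsubmxK y) enorm_row_mx; congr (_ + _).
by rewrite {1}lsubmx_scalar enorm_scalar real_normK ?num_real.
Qed.

Lemma sphere_split y : S' y -> lsubmx y 0 0 ^+ 2 + enorm (rsubmx y) ^+ 2 = 1.
Proof. by move=> Sy; rewrite -enorm_split Sy expr1n. Qed.

Lemma sphere_splitP y : lsubmx y 0 0 ^+ 2 + enorm (rsubmx y) ^+ 2 = 1 -> S' y.
Proof.
rewrite -enorm_split => h; apply/eqP; rewrite -(@eqrXn2 _ 2%N)// ?enorm_ge0//.
by rewrite h expr1n.
Qed.

Lemma height_itv y : S' y -> -1 <= lsubmx y 0 0 <= 1.
Proof.
by move=> /sphere_split h; have s := sqr_ge0 (enorm (rsubmx y)); apply/andP; split; nra.
Qed.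

Lemma height_lt1 y : S' y -> rsubmx y != 0 -> -1 < lsubmx y 0 0 < 1.
Proof.
move=> /sphere_split h; rewrite -enorm_gt0 => z0.
by have s := exprn_gt0 2 z0; apply/andP; split; nra.
Qed.

Lemma time_of_itv y : S' y -> 0 <= time_of y <= 1.
Proof.
move=> /height_itv /andP[h1 h2].
have h : -1 <= - lsubmx y 0 0 <= 1 by apply/andP; split; lra.
rewrite divr_ge0 ?acos_ge0 ?pi_ge0//= ler_pdivrMr ?pi_gt0// mul1r.
exact: acos_lepi.
Qed.

Lemma time_ofI y : S' y -> I (time_of y).
Proof. by move=> /time_of_itv h; rewrite /= in_itv. Qed.

Lemma cos_time_of y : S' y -> cos (pi * time_of y) = - lsubmx y 0 0.
Proof.
move=> /height_itv /andP[h1 h2].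
rewrite /time_of mulrC divfK ?gt_eqF ?pi_gt0// acosK// in_itv/=.
by apply/andP; split; lra.
Qed.

Lemma sin_time_of y : S' y -> sin (pi * time_of y) = enorm (rsubmx y).
Proof.
move=> Sy; have /andP[h1 h2] := height_itv Sy.
rewrite /time_of mulrC divfK ?gt_eqF ?pi_gt0// sin_acos; last by apply/andP; split; lra.
have -> : 1 - (- lsubmx y 0 0) ^+ 2 = enorm (rsubmx y) ^+ 2 by rewrite -(sphere_split Sy); ring.
by rewrite sqrtr_sqr ger0_norm ?enorm_ge0.
Qed.

Lemma time_of_gt0_lt1 y : S' y -> rsubmx y != 0 -> 0 < time_of y < 1.
Proof.
move=> Sy z0; have /andP[h1 h2] := height_lt1 Sy z0.
rewrite /time_of divr_gt0 ?pi_gt0 ?acos_gt0//=; last by apply/andP; split; lra.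
by rewrite ltr_pdivrMr ?pi_gt0// mul1r acos_ltpi//; apply/andP; split; lra.
Qed.

Lemma boundaryE b y : boundary b y =
  row_mx (lsubmx y) (radial_extension (b (time_of y)) (rsubmx y)).
Proof. by []. Qed.

Lemma eq_boundary b b' y : S' y -> (forall t, I t -> eq_on_sphere (b t) (b' t)) ->
  boundary b y = boundary b' y.
Proof.
move=> Sy E; rewrite !boundaryE; congr row_mx.
by apply: eq_radial_extension; apply: E; exact: time_ofI.
Qed.

Lemma boundary_sphere b : (forall t, I t -> set_fun S S (b t)) ->
  set_fun S' S' (boundary b).
Proof.
move=> Sb y Sy; apply: sphere_splitP.
rewrite boundaryE row_mxKl row_mxKr enorm_radial_extension ?sphere_split//.
by apply: Sb; exact: time_ofI.
Qed.

(** A boundary map preserves the height, hence the time, so boundary maps compose slice by slice. *)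
Lemma boundary_comp b b' y : (forall t, I t -> set_fun S S (b t)) -> S' y ->
  (forall t x, I t -> S x -> b' t (b t x) = x) -> boundary b' (boundary b y) = y.
Proof.
move=> Sb Sy K; have It := time_ofI Sy.
rewrite [boundary b y]boundaryE boundaryE row_mxKl row_mxKr /time_of row_mxKl.
rewrite -/(time_of y) -[RHS]hsubmxK; congr row_mx.
have [->|z0] := eqVneq (rsubmx y) 0.
  by rewrite /radial_extension enorm0 !scale0r enorm0 scale0r.
rewrite radial_extension_comp//; last exact: Sb.
by rewrite -[RHS]radial_extension_id; apply: eq_radial_extension => z Sz; exact: K.
Qed.

Lemma boundary_fixed b y : S' y -> eq_on_sphere (b (time_of y)) id ->
  boundary b y = y.
Proof.
move=> Sy E; rewrite boundaryE -[RHS]hsubmxK; congr row_mx.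
by rewrite (eq_radial_extension _ E) radial_extension_id.
Qed.

Lemma height_differentiable y :
  differentiable (fun x : 'rV[R]_(1 + n) => - lsubmx x 0 0 : R) y.
Proof.
have s : @smooth_on R _ R setT (fun x : 'rV[R]_(1 + n) => - lsubmx x 0 0).
  apply: smooth_onN; first exact: finite_basis_real.
  apply: smooth_on_coord; apply: smooth_on_linear; first exact: finite_basis_rV.
  by move=> a u w; rewrite linearP.
by have [+ _] := smooth_on_Ck 1 openT s; apply.
Qed.

(** The cosine of pi times the time of x / |x|, as a function homogeneous of degree 0 off the
    origin. *)
Definition slope (x : 'rV[R]_(1 + n)) : R := - lsubmx x 0 0 / enorm x.

Lemma slope_differentiable y : y != 0 -> differentiable slope y.
Proof.
move=> y0; apply: (@differentiableM _ _ (fun x => - lsubmx x 0 0 : R) (fun x => (enorm x)^-1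
    : R)).
  exact: height_differentiable.
by apply: differentiableV; rewrite ?enorm_eq0//; exact: differentiable_enorm.
Qed.

Lemma derive_slope y (v : 'rV[R]_n) : S' y ->
  'D_(row_mx 0 v) slope y = lsubmx y 0 0 * (v *m (rsubmx y)^T) 0 0.
Proof.
move=> Sy; have y0 := sphere_neq0 Sy.
have e0 : enorm y != 0 by rewrite enorm_eq0.
have dE := differentiable_enorm y0.
have dl := height_differentiable y.
have vE : derivable (fun x : 'rV[R]_(1 + n) => enorm x : R) y (row_mx 0 v) by exact:
    diff_derivable.
have vl : derivable (fun x : 'rV[R]_(1 + n) => - lsubmx x 0 0 : R) y (row_mx 0 v) by exact:
    diff_derivable.
have -> : slope = (fun x : 'rV[R]_(1 + n) => - lsubmx x 0 0 : R) * (fun x : 'rV[R]_(1 + n) =>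
    (enorm x)^-1 : R) by [].
rewrite deriveM//; last exact: derivableV.
rewrite deriveV// derive_enorm// Sy.
have -> : 'D_(row_mx 0 v) (fun x : 'rV[R]_(1 + n) => - lsubmx x 0 0 : R) y = 0.
  have dc : differentiable (lsubmx : 'rV[R]_(1 + n) -> 'rV[R]_1) y by exact:
      differentiable_lsubmx.
  have dc' : derivable (lsubmx : 'rV[R]_(1 + n) -> 'rV[R]_1) y (row_mx 0 v) by exact:
      diff_derivable.
  rewrite (@deriveN _ _ _ (fun x : 'rV[R]_(1 + n) => lsubmx x 0 0 : R)); last first.
    exact: ((derivable_mxP _ _ _).1 dc' 0 0).
  rewrite derive_coord// deriveE// diff_lin; last exact: continuous_lsubmx.
  by rewrite /= row_mxKl mxE oppr0.
rewrite scaler0 addr0 divr1 expr1n invr1 /GRing.scale/= mulN1r mulrN mulNr opprK.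
congr (_ * _); rewrite -{1}(hsubmxK y) tr_row_mx mul_row_col trmx0 mulmx0 add0r.
by rewrite -[rsubmx y *m v^T]trmxK trmx_mul trmxK mxE.
Qed.

(** The factor |x| disappears because the radial extension of a slice is itself homogeneous of
    degree 1. *)
Lemma boundary_radialE b x : x != 0 -> radial_extension (boundary b) x =
  row_mx (lsubmx x) (radial_extension (b (acos (slope x) / pi)) (rsubmx x)).
Proof.
move=> x0; have e0 : enorm x != 0 by rewrite enorm_eq0.
have ei : 0 < (enorm x)^-1 by rewrite invr_gt0 enorm_gt0.
rewrite {1}/radial_extension boundaryE scale_row_mx.
have -> : lsubmx ((enorm x)^-1 *: x) = (enorm x)^-1 *: lsubmx x by rewrite linearZ.
have -> : rsubmx ((enorm x)^-1 *: x) = (enorm x)^-1 *: rsubmx x by rewrite linearZ.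
rewrite scalerA divff// scale1r; congr row_mx.
have -> : time_of ((enorm x)^-1 *: x) = acos (slope x) / pi.
  rewrite /time_of /slope; congr (acos _ / pi).
  by rewrite linearZ mxE mulNr mulrC.
rewrite /radial_extension enormZ (gtr0_norm ei) !scalerA mulrA divff// mul1r.
have [->|z1] := eqVneq (rsubmx x) 0; first by rewrite enorm0 !scale0r.
suff -> : ((enorm x)^-1 * enorm (rsubmx x))^-1 / enorm x = (enorm (rsubmx x))^-1 by [].
by field; rewrite e0 enorm_eq0 z1.
Qed.

Lemma family_differentiable b (t : R) (z : 'rV[R]_n) :
  smooth_on (I `*` S) (fun tx : R * 'rV[R]_n => b tx.1 tx.2) -> 0 < t < 1 -> z != 0 ->
  differentiable (fun p : R * 'rV[R]_n => radial_extension (b p.1) p.2) (t, z).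
Proof.
move=> sb t01 z0.
have o1 : open ((fun p : R * 'rV[R]_n => p.1) @^-1` [set s : R | 0 < s < 1]).
  apply: open_comp; first by move=> x _; exact: cvg_fst.
  have -> : [set s : R | 0 < s < 1] = [set s | 0 < s] `&` [set s | s < 1].
    by apply/seteqP; split => [x /= /andP[]//|x [/= a a']]; apply/andP.
  by apply: openI; [exact: open_gt|exact: open_lt].
have o2 : open ((fun p : R * 'rV[R]_n => p.2) @^-1` [set z : 'rV[R]_n | z != 0]).
  by apply: open_comp; [move=> x _; exact: cvg_snd|exact: open_rV_neq0].
have o : open ([set s : R | 0 < s < 1] `*` [set z : 'rV[R]_n | z != 0]) := openI o1 o2.
have s : smooth_on ([set s : R | 0 < s < 1] `*` [set z : 'rV[R]_n | z != 0])
    (fun p : R * 'rV[R]_n => radial_extension (b p.1) p.2).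
  apply: smooth_on_sub (smooth_on_family_radial_extension sb) => -[s x] [/= /andP[s0 s1] x0].
  by split => //=; rewrite in_itv/= !ltW.
by have [+ _] := smooth_on_Ck 1 o s; apply.
Qed.

(** As a function of time, |B|^2 is constant on a neighbourhood of t, whence the open interval; its
    derivative is twice this inner product. *)
Lemma family_derive_dot b (t : R) (z : 'rV[R]_n) :
  smooth_on (I `*` S) (fun tx : R * 'rV[R]_n => b tx.1 tx.2) ->
  (forall t, I t -> set_fun S S (b t)) -> 0 < t < 1 -> z != 0 ->
  (radial_extension (b t) z *m
    ('D_((1 : R), (0 : 'rV[R]_n)) (fun p : R * 'rV[R]_n => radial_extension (b p.1) p.2) (t,
        z))^T) 0 0 = 0.
Proof.
move=> sb Sb t01 z0; have dB := family_differentiable sb t01 z0.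
set B := (fun p : R * 'rV[R]_n => _) in dB *; set c := 'D__ B _.
have dp : differentiable (fun s : R => (s, z)) t by exact: differentiable_pair.
have dBt : differentiable (fun s : R => B (s, z)) t := differentiable_comp dp dB.
have Ec : 'D_1 (fun s : R => B (s, z)) t = c.
  rewrite /c /derive; apply: (congr1 (fun f : R -> 'rV[R]_n => lim (f @ 0^'))).
  apply/funext => k /=; rewrite (_ : k *: ((1 : R), (0 : 'rV[R]_n)) + (t, z) = (k *: 1 + t, z))//.
  by congr pair; rewrite /= scaler0 add0r.
have E := derive_enorm_sqr (1 : R) dBt; rewrite Ec in E.
suff : 'D_1 (fun s : R => enorm (B (s, z)) ^+ 2 : R) t = 0.
  by rewrite E => /eqP; rewrite mulf_eq0 pnatr_eq0/= => /eqP.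
rewrite (@near_eq_derive _ _ _ _ (cst (enorm z ^+ 2 : R))) ?derive_cst//.
have /andP[t0 t1] := t01.
near=> s; rewrite /B/= enorm_radial_extension//; apply: Sb.
rewrite /= in_itv/=; apply/andP; split; apply: ltW; near: s.
  exact: lt_nbhsr.
exact: lt_nbhsl.
Unshelve. all: by end_near. Qed.

(** Half the derivative of |B z|^2 = |z|^2, written for all directions at once. *)
Lemma radial_jacobian_dot (f : 'rV[R]_n -> 'rV[R]_n) z :
  set_fun S S f -> smooth_on S f -> z != 0 ->
  'J (radial_extension f) z *m (radial_extension f z)^T = z^T.
Proof.
move=> Sf sf z0; have dB := differentiable_radial_extension sf z0.
set B := radial_extension f in dB *.
have zE (v : 'rV[R]_n) : v *m ('J B z *m (B z)^T) = v *m z^T.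
  have E1 := derive_enorm_sqr v dB.
  have E2 := @derive_enorm_sqr R _ n id z v (ex_diff (is_diff_def := is_diff_id z)).
  have E3 : (fun x => enorm (B x) ^+ 2 : R) = (fun x => enorm (id x) ^+ 2 : R).
    by apply/funext => x; rewrite enorm_radial_extension.
  rewrite E3 E2 derive_id in E1.
  have {}E1 : (z *m v^T) 0 0 = (B z *m ('D_v B z)^T) 0 0.
    by apply: (mulfI (_ : 2 != 0)) => //; rewrite pnatr_eq0.
  rewrite mulmxA -(deriveEjacobian _ dB).
  rewrite (mx11_scalar (v *m z^T)) (mx11_scalar ('D_v B z *m _)); congr (_%:M).
  rewrite -[v *m z^T]trmxK trmx_mul trmxK [RHS]mxE E1.
  by rewrite -['D_v B z *m _]trmxK trmx_mul trmxK [LHS]mxE.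
by apply/row_matrixP => i; rewrite !rowE.
Qed.

(** The chain rule through x |-> (time, z). In a horizontal direction (0, v) the time varies by a
    multiple of the inner product of v and z, and this proportionality is what makes the
    contribution of time to the Jacobian a matrix of rank at most one. *)
Lemma boundary_derive b y u :
  smooth_on (I `*` S) (fun tx : R * 'rV[R]_n => b tx.1 tx.2) ->
  S' y -> rsubmx y != 0 ->
  let t := time_of y in
  let z := rsubmx y in
  'D_u (radial_extension (boundary b)) y = row_mx (lsubmx u)
    ('D_u (fun x => acos (slope x) / pi : R) y *:
      'D_((1 : R), (0 : 'rV[R]_n)) (fun p : R * 'rV[R]_n => radial_extension (b p.1) p.2) (t, z)
     + 'D_(rsubmx u) (radial_extension (b t)) z)
  /\ exists k, forall v, 'D_(row_mx 0 v) (fun x => acos (slope x) / pi : R) y = k * (v *m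
      z^T) 0 0.
Proof.
move=> sb Sy z0 t z; have y0 := sphere_neq0 Sy.
have t01 := time_of_gt0_lt1 Sy z0.
have /andP[h1 h2] := height_lt1 Sy z0.
have dB := family_differentiable sb t01 z0.
set Bf := fun p : R * 'rV[R]_n => _ in dB *; set c := 'D__ Bf _.
have ds := slope_differentiable y0.
have sy : slope y = - lsubmx y 0 0 by rewrite /slope Sy divr1.
pose ac (s : R) : R := acos s / pi.
have dac : differentiable ac (slope y).
  have s1 : -1 < slope y < 1 by rewrite sy; apply/andP; split; lra.
  have [da _] := is_derive1_acos s1.
  apply/derivable1_diffP.
  by apply: (@derivableM _ _ acos (cst pi^-1)) => //; exact: derivable_cst.
pose A (x : 'rV[R]_(1 + n)) : R := ac (slope x).
have dA : differentiable A y := differentiable_comp ds dac.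
have Ay : A y = t by rewrite /A sy.
pose P (x : 'rV[R]_(1 + n)) : R * 'rV[R]_n := (A x, rsubmx x).
have dr : differentiable (rsubmx : 'rV[R]_(1 + n) -> 'rV[R]_n) y by exact: differentiable_rsubmx.
have dl : differentiable (lsubmx : 'rV[R]_(1 + n) -> 'rV[R]_1) y by exact: differentiable_lsubmx.
have dP : differentiable P y := differentiable_pair dA dr.
have Py : P y = (t, z) by rewrite /P Ay.
have dBP : differentiable Bf (P y) by rewrite Py.
have dBoP : differentiable (Bf \o P) y := differentiable_comp dP dBP.
split; last first.
  exists (lsubmx y 0 0 * 'd ac (slope y) 1) => v.
  rewrite -[fun x => _]/A deriveE// (diff_comp ds dac)/= -(deriveE _ ds) derive_slope//.
  have lz (e : R) : 'd ac (slope y) e = e * 'd ac (slope y) 1.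
    by rewrite -[e in LHS]mulr1 -[e * 1]/(e *: (1 : R)) linearZ.
  by rewrite lz; ring.
have bn := finite_basis_rV R n; have b1 := finite_basis_rV R 1.
have lL : linear (fun p : 'rV[R]_1 * 'rV[R]_n => row_mx p.1 p.2).
  by move=> a u' v'; rewrite scale_row_mx add_row_mx.
have [L LE] := linear_pack lL.
have cL : continuous L by apply: finite_basis_continuous; exact: finite_basis_prod.
pose Q (x : 'rV[R]_(1 + n)) : 'rV[R]_1 * 'rV[R]_n := (lsubmx x, (Bf \o P) x).
have dQ : differentiable Q y := differentiable_pair dl dBoP.
have dL : differentiable L (Q y) by exact: linear_differentiable.
have nE : \forall x \near y, radial_extension (boundary b) x = (L \o Q) x.
  have : \forall x \near y, x != 0.
    by apply: open_nbhs_nbhs; split => //; exact: open_rV_neq0.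
  by apply: filterS => x x0; rewrite boundary_radialE//= LE.
rewrite (near_eq_derive u nE) deriveE; last exact: (differentiable_comp dQ dL).
rewrite (diff_comp dQ dL)/= diff_lin// LE (diff_pair dl dBoP) (diff_comp dP dBP)/=.
congr row_mx; first by rewrite diff_lin//; exact: continuous_lsubmx.
have -> : 'd P y u = 'd A y u *: ((1 : R), (0 : 'rV[R]_n)) + (0, rsubmx u).
  rewrite /P (diff_pair dA dr) [X in (_, X)]/= diff_lin; last exact: continuous_rsubmx.
  congr pair; first by rewrite /= addr0 [RHS]mulr1.
  by rewrite /= scaler0 add0r.
rewrite linearD linearZ /= Py -!deriveE//; congr (_ + _).
by rewrite -derive_partial.
Qed.

(* In the coordinates (h, z), the Jacobian of the radial extension of the
   boundary map is block triangular with diagonal blocks 1 and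
   M = J + k z^T c, where J is the Jacobian of the radial extension B of b t
   and c the derivative of B in t. As the norm of B is that of z, one has
   c B^T = 0 and J B^T = z^T, so that the perturbation of J does not change the
   determinant. *)
Lemma boundary_det b y : smooth_on (I `*` S) (fun tx : R * 'rV[R]_n => b tx.1 tx.2) ->
  (forall t, I t -> set_fun S S (b t)) -> smooth_on S' (boundary b) ->
  S' y -> rsubmx y != 0 ->
  \det ('J (radial_extension (b (time_of y))) (rsubmx y)) != 0 ->
  \det ('J (radial_extension (boundary b)) y) =
  \det ('J (radial_extension (b (time_of y))) (rsubmx y)).
Proof.
move=> sb Sb sB Sy z0 dJ0; have t01 := time_of_gt0_lt1 Sy z0.
have y0 := sphere_neq0 Sy; have It := time_ofI Sy.
have JB := radial_jacobian_dot (Sb _ It) (family_smooth_on sb It) z0.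
have cB := family_derive_dot sb Sb t01 z0.
have dB := differentiable_radial_extension (family_smooth_on sb It) z0.
have Du u := boundary_derive u sb Sy z0.
have dFF := differentiable_radial_extension sB y0.
set t := time_of y in t01 dJ0 It JB cB dB Du *; set z := rsubmx y in z0 dJ0 JB cB dB Du *.
set c := 'D__ _ _ in cB Du; set J := 'J _ z in dJ0 JB *.
have uJ : J \in unitmx by rewrite unitmxE unitfE.
have [_ [k Dk]] := Du 0.
pose M := J + (k *: z^T) *m c.
have JE : 'J (radial_extension (boundary b)) y = block_mx 1%:M
   (rsubmx ('D_(row_mx 1%:M 0) (radial_extension (boundary b)) y)) 0 M.
  apply/row_matrixP => i; rewrite -(splitK i) rowE -(deriveEjacobian _ dFF).
  case: (fintype.split i) => j /=.
    rewrite rowKu row_row_mx row1 delta_mx_lshift (ord1 j).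
    have -> : delta_mx 0 0 = 1%:M :> 'rV[R]_1.
      by apply/rowP => l; rewrite !mxE (ord1 l) eqxx.
    rewrite row_id -[LHS]hsubmxK; congr row_mx.
    by have [-> _] := Du (row_mx 1%:M 0); rewrite !row_mxKl.
  rewrite rowKd row_row_mx row0 delta_mx_rshift.
  have [-> _] := Du (row_mx 0 (delta_mx 0 j)).
  rewrite row_mxKl row_mxKr Dk (deriveEjacobian _ dB); congr row_mx.
  rewrite rowE /M mulmxDr addrC; congr (_ + _).
  rewrite mulmxA -scalemxAr (mx11_scalar (delta_mx 0 j *m z^T)) mxE.
  by rewrite -scalemxAl mul_scalar_mx scalerA mxE.
have DE : \det ('J (radial_extension (boundary b)) y) = \det M.
  by rewrite JE det_ublock det1 mul1r.
apply: (etrans DE).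
have ME : M = (1%:M + (k *: z^T) *m (c *m invmx J)) *m J.
  by rewrite mulmxDl mul1mx -!mulmxA mulVmx// mulmx1.
rewrite ME det_mulmx det_add_rank1 ?mul1r//.
rewrite -scalemxAr -JB -mulmxA mulKmx// (mx11_scalar (c *m _)).
rewrite -[c *m _]trmxK trmx_mul trmxK mxE cB.
by rewrite raddf0 scaler0.
Qed.

End BoundaryOrientation.

(** * Isotopies of boundary maps of flat families *)

Section BoundaryIsotopy.
Variables (R : realType) (n : nat).
Local Notation S := (sphere R n).
Local Notation S' := (sphere R (1 + n)).
Local Notation I := ([set` `[0, 1]] : set R).

Lemma radial_extension_homogeneous (f : 'rV[R]_n -> 'rV[R]_n) l x : 0 < l ->
  radial_extension f (l *: x) = l *: radial_extension f x.
Proof.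
move=> l0; rewrite /radial_extension enormZ (gtr0_norm l0) !scalerA.
have [->|x0] := eqVneq x 0; first by rewrite enorm0 mulr0 !scale0r.
suff -> : (l * enorm x)^-1 * l = (enorm x)^-1 by [].
by field; rewrite enorm_eq0 x0 gt_eqF.
Qed.

(** The derivative of a map homogeneous of degree 1 is homogeneous of degree 0. A slice of the big
    sphere has radius |z| < 1 off the equator, whereas orientation is tested on unit vectors. *)
Lemma jacobian_homogeneous (f : 'rV[R]_n -> 'rV[R]_n) l x : 0 < l -> x != 0 ->
  smooth_on S f -> 'J (radial_extension f) (l *: x) = 'J (radial_extension f) x.
Proof.
move=> l0 x0 sf; have l1 : l != 0 by rewrite gt_eqF.
have lx0 : l *: x != 0 by rewrite scaler_eq0 negb_or l1.
have d1 := differentiable_radial_extension sf x0.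
have d2 := differentiable_radial_extension sf lx0.
set F := radial_extension f in d1 d2 *.
have ds : differentiable (fun y : 'rV[R]_n => l *: y) x.
  by apply: (@differentiableZ _ _ _ id).
have E v : 'D_v F (l *: x) = 'D_v F x.
  apply: (scalerI l1).
  have vF : derivable F x v by exact: diff_derivable.
  have E1 : 'D_v (fun y : 'rV[R]_n => l *: y) x = l *: v.
    by rewrite (@deriveZ _ _ _ id)// derive_id.
  have E2 : 'd (F \o (fun y : 'rV[R]_n => l *: y)) x v = l *: 'D_v F (l *: x).
    rewrite (diff_comp ds d2).
    apply: (@etrans _ _ ('d F (l *: x) (l *: v))).
      by apply: (congr1 ('d F (l *: x))); exact: (etrans (esym (deriveE v ds)) E1).
    by rewrite linearZ; apply: (congr1 ( *:%R l)); exact: (esym (deriveE v d2)).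
  apply: (etrans (esym E2)); apply: etrans (deriveZ l vF).
  apply: (etrans (esym (deriveE v (differentiable_comp ds d2)))).
  congr ('D_v _ x); apply/funext => y /=.
  by rewrite /F radial_extension_homogeneous.
apply/row_matrixP => i.
exact: (etrans (row_jacobian i d2) (etrans (E _) (esym (row_jacobian i d1)))).
Qed.

(** A height larger than this in absolute value has its time within e of 0 or 1. For e > 0 the
    minimum with 1/2 keeps the angle at most pi/2, so that the two polar caps are disjoint. *)
Definition polar_bound (e : R) : R := cos (pi * Num.min e (1/2)).

Lemma polar_bound_lt1 e : 0 < e -> polar_bound e < 1.
Proof.
move=> e0; rewrite /polar_bound -[ltRHS]cos0 ltr_cos ?in_itv/=.
- by rewrite mulr_gt0 ?pi_gt0// lt_min e0/=; lra.
- by rewrite lexx pi_ge0.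
- rewrite mulr_ge0 ?pi_ge0//=; last by rewrite le_min ltW//=; lra.
  by rewrite ger_pMr ?pi_gt0// ge_min; apply/orP; right; lra.
Qed.

Lemma near_pole e (y : 'rV[R]_(1 + n)) : 0 < e -> S' y ->
  polar_bound e < `|lsubmx y 0 0| -> time_of y < e \/ 1 - e < time_of y.
Proof.
move=> e0 Sy; have /andP[t0 t1] := time_of_itv Sy; have ct := cos_time_of Sy.
set m := Num.min e (1/2); have m0 : 0 < m by rewrite lt_min e0/=; lra.
have me : m <= e by rewrite ge_min lexx.
have m1 : m <= 1/2 by rewrite ge_min lexx orbT.
have pi0 := pi_gt0 R.
have inI (u : R) : 0 <= u <= 1 -> pi * u \in `[0, pi].
  by move=> /andP[u0 u1]; rewrite in_itv/= mulr_ge0 ?pi_ge0//= ger_pMr.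
have [h|h] := ltP (time_of y) m; first by left; exact: lt_le_trans me.
have [h'|h'] := ltP (1 - m) (time_of y); first by right; apply: le_lt_trans h'; lra.
have tI : pi * time_of y \in `[0, pi] by apply: inI; apply/andP.
have mI : pi * m \in `[0, pi] by apply: inI; apply/andP; split; lra.
have mI' : pi * (1 - m) \in `[0, pi] by apply: inI; apply/andP; split; lra.
have l1 : cos (pi * time_of y) <= cos (pi * m).
  rewrite leNgt ltr_cos//.
  by rewrite -leNgt ler_pM2l.
have l2 : cos (pi * (1 - m)) <= cos (pi * time_of y).
  rewrite leNgt ltr_cos//.
  by rewrite -leNgt ler_pM2l.
have c : cos (pi * (1 - m)) = - cos (pi * m).
  by rewrite mulrBr mulr1 cosB cospi sinpi mul0r addr0 mulN1r.
rewrite ltNge => /negP[]; rewrite ler_norml /polar_bound -/m; apply/andP; split; lra.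
Qed.

Lemma pole_height e (y : 'rV[R]_(1 + n)) : 0 < e -> S' y -> rsubmx y = 0 ->
  polar_bound e < `|lsubmx y 0 0|.
Proof.
move=> e0 /sphere_split + z0; rewrite z0 enorm0 expr0n addr0 => h.
suff -> : `|lsubmx y 0 0| = 1 by exact: polar_bound_lt1.
by apply/eqP; rewrite -(@eqrXn2 _ 2%N)// real_normK ?num_real// h expr1n.
Qed.

Variables (G : R -> R -> 'rV[R]_n -> 'rV[R]_n) (e : R).
Hypothesis sG : smooth_on (I `*` I `*` S)
  (fun stx : R * R * 'rV[R]_n => G stx.1.1 stx.1.2 stx.2).
Hypothesis dG : forall s t, I s -> I t -> Diffp (G s t).
Hypothesis e0 : 0 < e.
Hypothesis flatG : forall s t, I s -> I t -> t < e \/ 1 - e < t ->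
  eq_on_sphere (G s t) id.

Let bn := finite_basis_rV R n.
Let b1 := finite_basis_rV R (1 + n).
Let bR := finite_basis_real R.

Let polar_fixed s y : I s -> S' y -> polar_bound e < `|lsubmx y 0 0| ->
  boundary (G s) y = y.
Proof.
by move=> Is Sy h; apply: boundary_fixed => //; apply: flatG => //; [exact: time_ofI|exact:
    near_pole].
Qed.

Let open_polar : open [set y : 'rV[R]_(1 + n) | polar_bound e < `|lsubmx y 0 0|].
Proof.
apply: (@open_comp _ _ (fun y : 'rV[R]_(1 + n) => `|lsubmx y 0 0| : R) [set s : R |
    polar_bound e < s]); last exact: open_gt.
move=> y _; have c : {for y, continuous (fun y : 'rV[R]_(1 + n) => lsubmx y 0 0 : R)}.
  apply: (@smooth_on_continuous R _ R setT) => //; first exact: openT.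
  by apply: smooth_on_coord; apply: smooth_on_linear => // a u w; rewrite linearP.
by apply: continuous_comp; [exact: c|exact: norm_continuous].
Qed.

(** Two kinds of charts: on a polar cap flatness makes the map the identity, and off the poles time
    and direction are smooth functions of y. *)
Lemma boundary_family_smooth : smooth_on (I `*` S')
  (fun sy : R * 'rV[R]_(1 + n) => boundary (G sy.1) sy.2).
Proof.
apply: smooth_on_local => -[s y] [/= Is Sy].
have s1 (A : set (R * 'rV[R]_(1 + n))) : smooth_on A (fun sy : R * 'rV[R]_(1 + n) => sy.1) by
    exact: smooth_on_fst.
have s2 (A : set (R * 'rV[R]_(1 + n))) : smooth_on A (fun sy : R * 'rV[R]_(1 + n) => sy.2) by
    exact: smooth_on_snd.
have [z0|z0] := eqVneq (rsubmx y) 0.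
  exists ((fun sy : R * 'rV[R]_(1 + n) => sy.2) @^-1` [set y : 'rV[R]_(1 + n) | polar_bound e
      < `|lsubmx y 0 0|]).
  split => //.
  - by apply: open_comp => // x _; exact: cvg_snd.
  - exact: pole_height.
  - apply: (smooth_on_eq _ (s2 _)) => -[s' y'] [[/= Is' Sy'] h].
    by rewrite polar_fixed.
exists ((fun sy : R * 'rV[R]_(1 + n) => rsubmx sy.2) @^-1` [set z : 'rV[R]_n | z != 0]).
have sl (A : set (R * 'rV[R]_(1 + n))) : smooth_on A (fun sy : R * 'rV[R]_(1 + n) => lsubmx sy.2).
  apply: (smooth_on_linear_comp b1 (finite_basis_rV R 1) (L := lsubmx)) => //.
  by move=> a u w; rewrite linearP.
have sr (A : set (R * 'rV[R]_(1 + n))) : smooth_on A (fun sy : R * 'rV[R]_(1 + n) => rsubmx sy.2).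
  apply: (smooth_on_linear_comp b1 bn (L := rsubmx)) => //.
  by move=> a u w; rewrite linearP.
split => //.
  apply: open_comp; last exact: open_rV_neq0.
  by move=> x _; apply: (smooth_on_continuous openT).
set A := _ `&` _.
have Az x : A x -> rsubmx x.2 != 0 by case.
apply: (@smooth_on_eq _ _ _ _ (fun sy : R * 'rV[R]_(1 + n) => row_mx (lsubmx sy.2)
   (enorm (rsubmx sy.2) *: G sy.1 (time_of sy.2) ((enorm (rsubmx sy.2))^-1 *: rsubmx sy.2))))
       => //.
pose P (sy : R * 'rV[R]_(1 + n)) := (lsubmx sy.2 : 'rV[R]_1, (enorm (rsubmx sy.2) *: G sy.1
    (time_of sy.2) ((enorm (rsubmx sy.2))^-1 *: rsubmx sy.2)) : 'rV[R]_n).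
apply: (@smooth_on_linear_comp _ _ _ _ _ P (fun p : 'rV[R]_1 * 'rV[R]_n => row_mx p.1 p.2)) => //.
- by apply: finite_basis_prod => //; exact: finite_basis_rV.
- by move=> a u w; rewrite scale_row_mx add_row_mx.
apply: smooth_on_pair => //; apply: smooth_onZ => //; first exact: smooth_on_enorm.
pose Q (sy : R * 'rV[R]_(1 + n)) : R * R * 'rV[R]_n := (sy.1, time_of sy.2, (enorm (rsubmx
    sy.2))^-1 *: rsubmx sy.2).
apply: (@smooth_on_comp _ _ _ _ A (I `*` I `*` S) Q (fun stx : R * R * 'rV[R]_n => G stx.1.1
    stx.1.2 stx.2)) => //.
- by apply: finite_basis_prod => //; exact: finite_basis_prod.
- move=> [s' y'] [[/= Is' Sy'] h]; split => /=; last exact: sphere_normalize.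
  by split => //; exact: time_ofI.
apply: smooth_on_pair; last exact: smooth_on_normalize.
apply: smooth_on_pair => //; apply: smooth_onM; last exact: smooth_on_cst.
apply: smooth_on_acos.
  move=> [s' y'] [[/= Is' Sy'] h]; have /andP[h1 h2] := height_lt1 Sy' h.
  by apply/andP; split; lra.
by apply: smooth_onN => //; exact: smooth_on_coord.
Qed.

Lemma boundary_family_Diffp s : I s -> Diffp (boundary (G s)).
Proof.
move=> Is.
(* The slice inverses are merely chosen for each t; smoothness of the assembled inverse is left to
   [Diffp_of_bij]. *)
have inv t : I t -> {g | [/\ set_fun S S g, forall x, S x -> g (G s t x) = x & forall x, S x
    -> G s t (g x) = x]}.
  by move=> It; apply: cid; have [[_ _ [g [h1 _ h2 h3]]] _] := dG Is It; exists g.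
pose Gi t := if pselect (I t) is left It then sval (inv t It) else id.
have GiP t : I t -> [/\ set_fun S S (Gi t), forall x, S x -> Gi t (G s t x) = x & forall x, S
    x -> G s t (Gi t x) = x].
  by move=> It; rewrite /Gi; case: pselect => // It'; exact: (svalP (inv t It')).
have SG t : I t -> set_fun S S (G s t) by move=> It; have [[]] := dG Is It.
have SGi t : I t -> set_fun S S (Gi t) by move=> /GiP [].
have sB := @family_smooth_on R (1 + n) (fun s => boundary (G s)) s boundary_family_smooth Is.
apply: (@Diffp_of_bij _ _ _ (boundary Gi)) => //.
- exact: boundary_sphere.
- exact: boundary_sphere.
- by move=> y Sy; apply: boundary_comp => // t x It; have [_ + _] := GiP t It; apply.
- by move=> y Sy; apply: boundary_comp => // t x It; have [_ _ +] := GiP t It; apply.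
(* Orientation: around a pole the radial extension is the identity, and elsewhere its determinant is
   that of a slice. *)
move=> y Sy; have [z0|z0] := eqVneq (rsubmx y) 0.
  have E : 'J (radial_extension (boundary (G s))) y = 1%:M.
    apply: etrans (jacobian_id y).
    apply: near_eq_jacobian; last by apply: differentiable_radial_extension => //; exact:
        sphere_neq0.
    have cn : {for y, continuous (fun x : 'rV[R]_(1 + n) => (enorm x)^-1 *: x)}.
      apply: (smooth_on_continuous (@open_rV_neq0 R (1 + n))); last exact: sphere_neq0.
      by apply: smooth_on_normalize => //; exact: smooth_on_linear.
    have h1 : \forall x \near y, polar_bound e < `|lsubmx ((enorm x)^-1 *: x) 0 0|.
      apply: (cn [set z | polar_bound e < `|lsubmx z 0 0|]).
      apply: open_nbhs_nbhs; split => //=.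
      by rewrite Sy invr1 scale1r; exact: pole_height.
    have h2 : \forall x \near y, x != 0.
      by apply: open_nbhs_nbhs; split; [exact: open_rV_neq0|exact: sphere_neq0].
    apply: filterS2 h1 h2 => x h1 x0.
    rewrite /radial_extension polar_fixed//; last exact: sphere_normalize.
    by rewrite scalerA divff ?scale1r// enorm_eq0.
  by rewrite E det1.
have It := time_ofI Sy.
have sb : smooth_on (I `*` S) (fun tx : R * 'rV[R]_n => G s tx.1 tx.2).
  apply: (@smooth_on_comp _ _ _ _ _ (I `*` I `*` S) (fun tx : R * 'rV[R]_n => (s, tx.1,
      tx.2)) (fun stx : R * R * 'rV[R]_n => G stx.1.1 stx.1.2 stx.2)) => //.
  - by apply: finite_basis_prod => //; exact: finite_basis_prod.
  - by move=> [t x] [].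
  - apply: smooth_on_pair; last exact: smooth_on_snd.
    by apply: smooth_on_pair; [exact: smooth_on_cst|exact: smooth_on_fst].
have [[_ st _] ot] := dG Is It.
have dt : 0 < \det ('J (radial_extension (G s (time_of y))) (rsubmx y)).
  have zp : 0 < enorm (rsubmx y) by rewrite enorm_gt0.
  have h : enorm (rsubmx y) *: ((enorm (rsubmx y))^-1 *: rsubmx y) = rsubmx y.
    by rewrite scalerA divff ?scale1r// gt_eqF.
  have nz : (enorm (rsubmx y))^-1 *: rsubmx y != 0 by exact/sphere_neq0/sphere_normalize.
  have E := jacobian_homogeneous zp nz st; rewrite h in E.
  by rewrite E; apply: ot; exact: sphere_normalize.
have dn : \det ('J (radial_extension (G s (time_of y))) (rsubmx y)) != 0 by rewrite gt_eqF.
by rewrite (boundary_det sb SG sB Sy z0 dn).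
Qed.

Lemma boundary_isotopic : isotopic (boundary (G 0)) (boundary (G 1)).
Proof.
exists (fun s => boundary (G s)); split => //.
- exact: boundary_family_smooth.
- exact: boundary_family_Diffp.
Qed.

End BoundaryIsotopy.

(** * Quaternions and Cayley numbers *)

Section StarAlgebra.
Variable R : realType.

Definition dot n (x y : 'rV[R]_n) : R := (x *m y^T) 0 0.

Lemma dotE n (x y : 'rV[R]_n) : dot x y = \sum_i x 0 i * y 0 i.
Proof. exact: dot_row. Qed.

Lemma dotC n (x y : 'rV[R]_n) : dot x y = dot y x.
Proof. by rewrite !dotE; apply: eq_bigr => i _; rewrite mulrC. Qed.

Lemma dotDl n (x y z : 'rV[R]_n) : dot (x + y) z = dot x z + dot y z.
Proof. by rewrite /dot mulmxDl mxE. Qed.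

Lemma dotDr n (x y z : 'rV[R]_n) : dot z (x + y) = dot z x + dot z y.
Proof. by rewrite dotC dotDl !(dotC z). Qed.

Lemma dotZl n a (x y : 'rV[R]_n) : dot (a *: x) y = a * dot x y.
Proof. by rewrite /dot -scalemxAl mxE. Qed.

Lemma dotZr n a (x y : 'rV[R]_n) : dot y (a *: x) = a * dot y x.
Proof. by rewrite dotC dotZl dotC. Qed.

Lemma dotNl n (x y : 'rV[R]_n) : dot (- x) y = - dot x y.
Proof. by rewrite -scaleN1r dotZl mulN1r. Qed.

Lemma dotNr n (x y : 'rV[R]_n) : dot x (- y) = - dot x y.
Proof. by rewrite dotC dotNl dotC. Qed.

Lemma dot_row_mx n m (a c : 'rV[R]_n) (b e : 'rV[R]_m) :
  dot (row_mx a b) (row_mx c e) = dot a c + dot b e.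
Proof. by rewrite /dot tr_row_mx mul_row_col mxE. Qed.

Lemma enorm_dot n (x : 'rV[R]_n) : enorm x ^+ 2 = dot x x.
Proof. exact: enorm_sqr_dot. Qed.

Lemma kconjE d (x : 'rV[R]_(1 + d)) i :
  kconj x 0 i = if (i == 0 :> nat) then x 0 i else - x 0 i.
Proof.
rewrite /kconj -(splitK i); case: (fintype.split i) => j /=.
  by rewrite row_mxEl mxE (ord1 j).
by rewrite row_mxEr !mxE.
Qed.

Lemma koneE d i : kone R d 0 i = (i == 0 :> nat)%:R.
Proof.
rewrite /kone -(splitK i); case: (fintype.split i) => j /=.
  by rewrite row_mxEl mxE (ord1 j).
by rewrite row_mxEr !mxE.
Qed.

Lemma kconj_linear d : linear (@kconj R d).
Proof.
move=> a x y; apply/rowP => i.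
rewrite kconjE [RHS]mxE [X in _ = X + _]mxE !kconjE !mxE.
by case: ifP => // _; ring.
Qed.

Lemma kconjD d (x y : 'rV[R]_(1 + d)) : kconj (x + y) = kconj x + kconj y.
Proof. by have := kconj_linear 1 x y; rewrite !scale1r. Qed.

Lemma kconjN d (x : 'rV[R]_(1 + d)) : kconj (- x) = - kconj x.
Proof. by apply/rowP => i; rewrite kconjE [RHS]mxE kconjE !mxE; case: ifP. Qed.

Lemma kconjZ d a (x : 'rV[R]_(1 + d)) : kconj (a *: x) = a *: kconj x.
Proof. by apply/rowP => i; rewrite kconjE [RHS]mxE kconjE !mxE; case: ifP => // _; ring. Qed.

Lemma kconjK d (x : 'rV[R]_(1 + d)) : kconj (kconj x) = x.
Proof. by apply/rowP => i; rewrite !kconjE; case: (_ == 0%N); rewrite ?opprK. Qed.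

Lemma kconj1 d : kconj (kone R d) = kone R d.
Proof. by apply/rowP => i; rewrite !kconjE !koneE; case: eqP => // _; rewrite oppr0. Qed.

Lemma dot_conj d (x y : 'rV[R]_(1 + d)) : dot (kconj x) (kconj y) = dot x y.
Proof.
rewrite !dotE; apply: eq_bigr => i _; rewrite !kconjE.
by case: ifP => // _; rewrite mulrNN.
Qed.

Lemma kconj_trace d (x : 'rV[R]_(1 + d)) :
  kconj x = (2 * dot x (kone R d)) *: kone R d - x.
Proof.
have -> : dot x (kone R d) = x 0 0.
  rewrite dotE (bigD1 ord0)//= big1 ?koneE ?mulr1 ?addr0// => i i0.
  by rewrite koneE (_ : (i == 0 :> nat) = false) ?mulr0//; apply/negbTE; apply: contra i0.
apply/rowP => i; rewrite kconjE [RHS]mxE [X in _ = X + _]mxE [X in _ = _ + X]mxE koneE.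
case: eqP => [i0|_]; last by rewrite mulr0 add0r.
have -> : i = 0 by apply: val_inj.
by rewrite mulr1; ring.
Qed.

(** The identities that every Cayley-Dickson double inherits from its base without associativity.
    The last two say that multiplication by x and by its conjugate are adjoint for the Euclidean
    inner product. *)
Record star_algebra d (mul : 'rV[R]_(1 + d) -> 'rV[R]_(1 + d) -> 'rV[R]_(1 + d)) : Prop :=
  StarAlgebra {
    sa_linl : forall y, linear (mul^~ y);
    sa_linr : forall x, linear (mul x);
    sa_1l : forall x, mul (kone R d) x = x;
    sa_1r : forall x, mul x (kone R d) = x;
    sa_conj : forall x y, kconj (mul x y) = mul (kconj y) (kconj x);
    sa_norml : forall x, mul (kconj x) x = dot x x *: kone R d;
    sa_normr : forall x, mul x (kconj x) = dot x x *: kone R d;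
    sa_adjl : forall x y z, dot (mul x y) z = dot y (mul (kconj x) z);
    sa_adjr : forall x y z, dot (mul x y) z = dot x (mul z (kconj y)) }.

(** Since conj x = 2 Re x - x, these are the laws x (x y) = (x x) y and (y x) x = y (x x), combined
    with the value of the norm. *)
Definition alternative d (mul : 'rV[R]_(1 + d) -> 'rV[R]_(1 + d) -> 'rV[R]_(1 + d)) :=
  (forall x y, mul (kconj x) (mul x y) = dot x x *: y) /\
  (forall x y, mul (mul y x) (kconj x) = dot x x *: y).

Section Theory.
Variables (d : nat) (mul : 'rV[R]_(1 + d) -> 'rV[R]_(1 + d) -> 'rV[R]_(1 + d)).
Hypothesis A : star_algebra mul.

Lemma sa_mulDl x y z : mul (x + y) z = mul x z + mul y z.
Proof. by have := sa_linl A z 1 x y; rewrite !scale1r. Qed.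
Lemma sa_mulDr x y z : mul z (x + y) = mul z x + mul z y.
Proof. by have := sa_linr A z 1 x y; rewrite !scale1r. Qed.
Lemma sa_mul0l z : mul 0 z = 0.
Proof. by apply: (addrI (mul 0 z)); rewrite -sa_mulDl !addr0. Qed.
Lemma sa_mul0r z : mul z 0 = 0.
Proof. by apply: (addrI (mul z 0)); rewrite -sa_mulDr !addr0. Qed.
Lemma sa_mulZl a x z : mul (a *: x) z = a *: mul x z.
Proof. by have := sa_linl A z a x 0; rewrite !addr0 sa_mul0l addr0. Qed.
Lemma sa_mulZr a x z : mul z (a *: x) = a *: mul z x.
Proof. by have := sa_linr A z a x 0; rewrite !addr0 sa_mul0r addr0. Qed.
Lemma sa_mulNl x z : mul (- x) z = - mul x z.
Proof. by rewrite -scaleN1r sa_mulZl scaleN1r. Qed.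
Lemma sa_mulNr x z : mul z (- x) = - mul z x.
Proof. by rewrite -scaleN1r sa_mulZr scaleN1r. Qed.

(** Adjunction moves x to the other side, where conj x (x y) = |x|^2 y. *)
Lemma dot_mul x y : alternative mul -> dot (mul x y) (mul x y) = dot x x * dot y y.
Proof. by move=> [al _]; rewrite (sa_adjl A) al dotZr. Qed.

End Theory.

(** * Properties preserved by Cayley-Dickson doubling *)

Section Doubling.
Variables (d : nat) (mul : 'rV[R]_(1 + d) -> 'rV[R]_(1 + d) -> 'rV[R]_(1 + d)).
Hypothesis A : star_algebra mul.
Local Notation d' := (d + (1 + d))%N.
Local Notation mul' := (@doubling R d mul : 'rV[R]_(1 + d') -> 'rV[R]_(1 + d') -> 'rV[R]_(1 +
    d')).

(** The dimensions [(1 + d) + (1 + d)] and [1 + (d + (1 + d))] are convertible; [cd_pair] fixes the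
    second form, in which the double again has one real and [d'] imaginary coordinates. *)
Definition cd_pair (a b : 'rV[R]_(1 + d)) : 'rV[R]_(1 + d') := row_mx a b.

Lemma cd_pair_ind (P : 'rV[R]_(1 + d') -> Prop) :
  (forall a b, P (cd_pair a b)) -> forall x, P x.
Proof. by move=> h x; rewrite -[x](@hsubmxK R 1 (1 + d) (1 + d)); exact: h. Qed.

Lemma cd_pairD a b c e : cd_pair a b + cd_pair c e = cd_pair (a + c) (b + e).
Proof. exact: (@add_row_mx R 1 (1 + d) (1 + d)). Qed.

Lemma cd_pairZ k a b : k *: cd_pair a b = cd_pair (k *: a) (k *: b).
Proof. exact: (@scale_row_mx R 1 (1 + d) (1 + d)). Qed.

Lemma dot_cd_pair a b c e : dot (cd_pair a b) (cd_pair c e) = dot a c + dot b e.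
Proof. exact: (@dot_row_mx (1 + d) (1 + d)). Qed.

Lemma doublingE a b c e : mul' (cd_pair a b) (cd_pair c e) =
  cd_pair (mul a c - mul (kconj e) b) (mul e a + mul b (kconj c)).
Proof. by rewrite /doubling !row_mxKl !row_mxKr. Qed.

Lemma kconj_cd_pair a b : kconj (cd_pair a b) = cd_pair (kconj a) (- b).
Proof.
have El a' b' (j : 'I_(1 + d)) : cd_pair a' b' 0 (@lshift (1 + d) (1 + d) j) = a' 0 j by
    exact: row_mxEl.
have Er a' b' (j : 'I_(1 + d)) : cd_pair a' b' 0 (@rshift (1 + d) (1 + d) j) = b' 0 j by
    exact: row_mxEr.
apply/rowP => i; rewrite -[i](@splitK (1 + d) (1 + d)).
case: (fintype.split (i : 'I_((1 + d) + (1 + d)))) => j; rewrite kconjE [unsplit _]/=.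
  by rewrite !El kconjE.
by rewrite !Er mxE.
Qed.

Lemma kone_cd_pair : kone R d' = cd_pair (kone R d) 0.
Proof.
have El a' b' (j : 'I_(1 + d)) : cd_pair a' b' 0 (@lshift (1 + d) (1 + d) j) = a' 0 j by
    exact: row_mxEl.
have Er a' b' (j : 'I_(1 + d)) : cd_pair a' b' 0 (@rshift (1 + d) (1 + d) j) = b' 0 j by
    exact: row_mxEr.
apply/rowP => i; rewrite -[i](@splitK (1 + d) (1 + d)).
case: (fintype.split (i : 'I_((1 + d) + (1 + d)))) => j; rewrite koneE [unsplit _]/=.
  by rewrite !El koneE.
by rewrite !Er mxE.
Qed.

Lemma doubling_star_algebra : @star_algebra d' mul'.
Proof.
have c0 : kconj (0 : 'rV[R]_(1 + d)) = 0.
  by apply/rowP => i; rewrite kconjE mxE; case: ifP; rewrite ?oppr0.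
split.
- apply: cd_pair_ind => c e k; apply: cd_pair_ind => a b; apply: cd_pair_ind => a' b'.
  rewrite cd_pairZ cd_pairD !doublingE cd_pairZ cd_pairD.
  rewrite !(sa_mulDl A) !(sa_mulDr A) !(sa_mulZl A) !(sa_mulZr A).
  by congr cd_pair; apply/rowP => i; rewrite !mxE; ring.
- apply: cd_pair_ind => c e k; apply: cd_pair_ind => a b; apply: cd_pair_ind => a' b'.
  rewrite cd_pairZ cd_pairD !doublingE cd_pairZ cd_pairD.
  rewrite !kconjD !kconjZ !(sa_mulDl A) !(sa_mulDr A) !(sa_mulZl A) !(sa_mulZr A).
  congr cd_pair; move: (mul _ _) (mul _ _) (mul _ _) (mul _ _) => x y z t.
    by apply/rowP => i; rewrite !mxE; ring.
  by apply/rowP => i; rewrite !mxE; ring.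
- apply: cd_pair_ind => a b; rewrite kone_cd_pair doublingE.
  by rewrite !(sa_1l A) !(sa_1r A) (sa_mul0l A) (sa_mul0r A) subr0 addr0.
- apply: cd_pair_ind => a b; rewrite kone_cd_pair doublingE c0 kconj1.
  by rewrite !(sa_1r A) !(sa_mul0l A) subr0 add0r.
- apply: cd_pair_ind => a b; apply: cd_pair_ind => c e.
  rewrite doublingE !kconj_cd_pair doublingE.
  rewrite !kconjD !kconjN !(sa_conj A) !kconjK.
  rewrite !(sa_mulNl A) !(sa_mulNr A) !opprK.
  by congr cd_pair; rewrite opprD addrC.
- apply: cd_pair_ind => a b; rewrite kconj_cd_pair doublingE kone_cd_pair cd_pairZ scaler0
    dot_cd_pair.
  rewrite !(sa_mulNl A) ?(sa_mulNr A) !(sa_norml A) opprK subrr.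
  by rewrite -scalerDl.
- apply: cd_pair_ind => a b; rewrite kconj_cd_pair doublingE kone_cd_pair cd_pairZ scaler0
    dot_cd_pair.
  rewrite kconjN kconjK !(sa_mulNl A) (sa_norml A) (sa_normr A) opprK addNr.
  by rewrite -scalerDl.
- apply: cd_pair_ind => a b; apply: cd_pair_ind => c e; apply: cd_pair_ind => f g.
  rewrite kconj_cd_pair !doublingE !dot_cd_pair !dotDl !dotDr !dotNl !dotNr.
  rewrite ?(sa_mulNl A) ?(sa_mulNr A) ?dotNr ?opprK.
  rewrite (sa_adjl A a c f) (sa_adjr A e a g) (sa_adjr A (kconj e) b f).
  rewrite -(dot_conj (kconj e)) kconjK (sa_conj A) kconjK.
  rewrite (sa_adjl A b (kconj c) g) -(dot_conj (kconj c)) kconjK (sa_conj A) kconjK.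
  ring.
- apply: cd_pair_ind => a b; apply: cd_pair_ind => c e; apply: cd_pair_ind => f g.
  rewrite kconj_cd_pair !doublingE !dot_cd_pair !dotDl !dotDr !dotNl !dotNr.
  rewrite ?kconjN ?(sa_mulNl A) ?(sa_mulNr A) ?dotNr ?opprK kconjK.
  rewrite (sa_adjr A a c f) (sa_adjl A e a g) (sa_adjl A (kconj e) b f) kconjK.
  rewrite (sa_adjr A b (kconj c) g) kconjK.
  ring.
Qed.

Lemma doubling_associative : associative mul -> commutative mul -> associative mul'.
Proof.
move=> mA mC.
have m3 x y z : mul (mul x y) z = mul (mul x z) y by rewrite -mA (mC y) mA.
apply: cd_pair_ind => a b; apply: cd_pair_ind => c e; apply: cd_pair_ind => f g.
rewrite !doublingE !kconjD !kconjN !(sa_conj A) !kconjK.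
rewrite !(sa_mulDl A) !(sa_mulDr A) !(sa_mulNl A) !(sa_mulNr A) !mA.
congr cd_pair.
  have -> : mul (mul a (kconj g)) e = mul (mul (kconj g) e) a by rewrite (mC a) m3.
  have -> : mul (mul (kconj c) (kconj g)) b = mul (mul (kconj g) b) (kconj c).
    by rewrite (mC (kconj c)) m3.
  have -> : mul (mul f (kconj e)) b = mul (mul (kconj e) b) f by rewrite (mC f) m3.
  by apply/rowP => i; rewrite !mxE; ring.
have -> : mul (mul g c) a = mul (mul g a) c by rewrite m3.
have -> : mul (mul e (kconj f)) a = mul (mul e a) (kconj f) by rewrite m3.
have -> : mul (mul b (kconj f)) (kconj c) = mul (mul b (kconj c)) (kconj f) by rewrite m3.
have -> : mul (mul b (kconj e)) g = mul (mul g (kconj e)) b by rewrite (mC b) m3 (mC (kconj e)).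
by apply/rowP => i; rewrite !mxE; ring.
Qed.

Lemma doubling_alternative : associative mul -> alternative mul'.
Proof.
move=> mA.
have nl x y : mul (kconj x) (mul x y) = dot x x *: y.
  by rewrite mA (sa_norml A) (sa_mulZl A) (sa_1l A).
have nl' x y : mul x (mul (kconj x) y) = dot x x *: y.
  by rewrite mA (sa_normr A) (sa_mulZl A) (sa_1l A).
have nr x y : mul (mul y x) (kconj x) = dot x x *: y.
  by rewrite -mA (sa_normr A) (sa_mulZr A) (sa_1r A).
have nr' x y : mul (mul y (kconj x)) x = dot x x *: y.
  by rewrite -mA (sa_norml A) (sa_mulZr A) (sa_1r A).
split; apply: cd_pair_ind => a b; apply: cd_pair_ind => c e.
  rewrite kconj_cd_pair !doublingE !kconjD !kconjN !(sa_conj A) !kconjK.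
  rewrite !(sa_mulDl A) !(sa_mulDr A) !(sa_mulNl A) !(sa_mulNr A).
  rewrite dot_cd_pair cd_pairZ nl nr nr' nl' -(mA (kconj a)) (mA b).
  by congr cd_pair; apply/rowP => i; rewrite !mxE; ring.
rewrite kconj_cd_pair !doublingE !kconjN !kconjK.
rewrite !(sa_mulDl A) !(sa_mulDr A) !(sa_mulNl A) !(sa_mulNr A).
rewrite dot_cd_pair cd_pairZ nl nl' nr nr' -(mA (kconj b)) (mA b).
by congr cd_pair; apply/rowP => i; rewrite !mxE; ring.
Qed.

Lemma doubling_commutative : commutative mul -> (forall x : 'rV[R]_(1 + d), kconj x = x) ->
    commutative mul'.
Proof.
move=> mC k; apply: cd_pair_ind => a b; apply: cd_pair_ind => c e.
rewrite !doublingE !k (mC a c) (mC e b); congr cd_pair.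
by rewrite addrC; congr (_ + _); exact: mC.
Qed.

End Doubling.

Lemma real_mulE (a b : 'rV[R]_(1 + 0)) i : real_mul a b 0 i = a 0 0 * b 0 0.
Proof. by rewrite /real_mul mxE big_ord1 (ord1 i) (ord1 ord0). Qed.

Lemma kconj_real (x : 'rV[R]_(1 + 0)) : kconj x = x.
Proof. by apply/rowP => i; rewrite kconjE (ord1 i). Qed.

Lemma dot_real (x y : 'rV[R]_(1 + 0)) : dot x y = x 0 0 * y 0 0.
Proof. by rewrite dotE big_ord1. Qed.

Lemma real_star_algebra : star_algebra (@real_mul R).
Proof.
split => [y a x x'|x a y y'|x|x|x y|x|x|x y z|x y z]; rewrite ?kconj_real.
- by apply/rowP => i; rewrite real_mulE [RHS]mxE [X in _ = X + _]mxE !real_mulE !mxE; ring.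
- by apply/rowP => i; rewrite real_mulE [RHS]mxE [X in _ = X + _]mxE !real_mulE !mxE; ring.
- by apply/rowP => i; rewrite !real_mulE koneE (ord1 i) mul1r.
- by apply/rowP => i; rewrite !real_mulE koneE (ord1 i) mulr1.
- by apply/rowP => i; rewrite !real_mulE mulrC.
- by apply/rowP => i; rewrite real_mulE mxE koneE (ord1 i) mulr1 dot_real.
- by apply/rowP => i; rewrite real_mulE mxE koneE (ord1 i) mulr1 dot_real.
- by rewrite !dot_real !real_mulE; ring.
- by rewrite !dot_real !real_mulE; ring.
Qed.

Lemma real_mulA : associative (@real_mul R).
Proof. by move=> x y z; apply/rowP => i; rewrite !real_mulE mulrA. Qed.

Lemma real_mulC : commutative (@real_mul R).
Proof. by move=> x y; apply/rowP => i; rewrite !real_mulE mulrC. Qed.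

Lemma complex_star_algebra : star_algebra (@complex_mul R).
Proof. exact: (doubling_star_algebra real_star_algebra). Qed.

Lemma complex_mulA : associative (@complex_mul R).
Proof. exact: (doubling_associative real_star_algebra real_mulA real_mulC). Qed.

Lemma complex_mulC : commutative (@complex_mul R).
Proof. exact: (doubling_commutative real_mulC kconj_real). Qed.

Lemma quaternion_star_algebra : star_algebra (@quaternion_mul R).
Proof. exact: (doubling_star_algebra complex_star_algebra). Qed.

Lemma quaternion_mulA : associative (@quaternion_mul R).
Proof. exact: (doubling_associative complex_star_algebra complex_mulA complex_mulC). Qed.

Lemma kmul_star_algebra (K : hypercomplex) : star_algebra (@kmul R K).
Proof.
case: K; first exact: quaternion_star_algebra.
exact: (doubling_star_algebra quaternion_star_algebra).
Qed.

Lemma kmul_alternative (K : hypercomplex) : alternative (@kmul R K).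
Proof.
case: K; last exact: (doubling_alternative quaternion_star_algebra quaternion_mulA).
exact: (doubling_alternative complex_star_algebra complex_mulA).
Qed.

End StarAlgebra.

(** * Subalgebras generated by two elements *)

Section TwoGenerated.
Variables (R : realType) (d : nat).
Variable mul : 'rV[R]_(1 + d) -> 'rV[R]_(1 + d) -> 'rV[R]_(1 + d).
Hypotheses (A : star_algebra mul) (Alt : alternative mul).
Local Notation one := (kone R d).
Implicit Types b q u p : 'rV[R]_(1 + d).

Definition conjugation b q := mul (mul b q) (kconj b).

Lemma dot_one : dot one one = 1 :> R.
Proof.
rewrite dotE (bigD1 ord0)//= big1 ?koneE ?mulr1 ?addr0// => i i0.
by rewrite koneE (_ : (i == 0 :> nat) = false) ?mulr0//; apply/negbTE; apply: contra i0.
Qed.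

Section Model.
Variables u p : 'rV[R]_(1 + d).
Let tu := 2 * dot u one.
Let nu := dot u u.
Let tp := 2 * dot p one.
Let np := dot p p.
Let k := 2 * dot (mul u p) one.

(* By Artin's theorem the subalgebra generated by [u] and [p] is associative;
   it is spanned by 1, u, p and u p, in which [model_mul] gives the coordinates
   of a product. *)
Let model := (R * R * R * R)%type.
Let embed (x : model) : 'rV[R]_(1 + d) :=
  let: (a, b, c, e) := x in a *: one + b *: u + c *: p + e *: mul u p.
Let model_mul (x y : model) : model :=
  let: (a, b, c, e) := x in let: (a', b', c', e') := y in
  (a * a' - b * b' * nu + c * b' * (k - tp * tu) - c * c' * np - c * e' * (np * tu)
     - e * b' * (nu * tp) - e * e' * (nu * np),
   a * b' + b * a' + b * b' * tu + c * b' * tp + c * e' * np + e * b' * k - e * c' * np,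
   a * c' + c * a' - b * e' * nu + c * b' * tu + c * c' * tp + c * e' * k + e * b' * nu,
   a * e' + e * a' + b * c' + b * e' * tu - c * b' + e * c' * tp + e * e' * k).
Let model_conj (x : model) : model :=
  let: (a, b, c, e) := x in (a + b * tu + c * tp + e * k, - b, - c, - e).
Let model1 : model := (1, 0, 0, 0).
Let model_norm (x : model) : R := (model_mul x (model_conj x)).1.1.1.

Implicit Types x y z : model.

Let ku : kconj u = tu *: one - u. Proof. exact: kconj_trace. Qed.
Let kp : kconj p = tp *: one - p. Proof. exact: kconj_trace. Qed.
Let kup : kconj (mul u p) = k *: one - mul u p. Proof. exact: kconj_trace. Qed.

Let uu : mul u u = tu *: u - nu *: one.
Proof.
have := sa_norml A u; rewrite ku (sa_mulDl A) (sa_mulNl A) (sa_mulZl A) (sa_1l A) => <-.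
by rewrite opprB addrC subrK.
Qed.

Let pp : mul p p = tp *: p - np *: one.
Proof.
have := sa_norml A p; rewrite kp (sa_mulDl A) (sa_mulNl A) (sa_mulZl A) (sa_1l A) => <-.
by rewrite opprB addrC subrK.
Qed.

Let u_up : mul u (mul u p) = tu *: mul u p - nu *: p.
Proof.
have := Alt.1 u p; rewrite ku (sa_mulDl A) (sa_mulNl A) (sa_mulZl A) (sa_1l A) => <-.
by rewrite opprB addrC subrK.
Qed.

Let up_p : mul (mul u p) p = tp *: mul u p - np *: u.
Proof.
have := Alt.2 p u; rewrite kp (sa_mulDr A) (sa_mulNr A) (sa_mulZr A) (sa_1r A) => <-.
by rewrite opprB addrC subrK.
Qed.

Let up_up : mul (mul u p) (mul u p) = k *: mul u p - (nu * np) *: one.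
Proof.
have := sa_norml A (mul u p); rewrite (dot_mul A _ _ Alt) kup.
rewrite (sa_mulDl A) (sa_mulNl A) (sa_mulZl A) (sa_1l A) => <-.
by rewrite opprB addrC subrK.
Qed.

(** Conjugation turns u p into conj p conj u; expanding each conjugate as trace minus element
    expresses p u. *)
Let pu : mul p u = k *: one - (tp * tu) *: one + tp *: u + tu *: p - mul u p.
Proof.
have := sa_conj A u p; rewrite kup ku kp.
rewrite !(sa_mulDl A, sa_mulDr A, sa_mulNl A, sa_mulNr A, sa_mulZl A, sa_mulZr A, sa_1l A,
    sa_1r A) => h.
apply/rowP => i; have := congr1 (fun v : 'rV[R]_(1 + d) => v 0 i) h.
by rewrite !mxE => {}h; lra.
Qed.

(** Conjugation reduces this product to [up_p]: the conjugate of p (u p) is (k - u p) (tp - p). *)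
Let p_up : mul p (mul u p) = k *: p - (np * tu) *: one + np *: u.
Proof.
have := congr1 (@kconj R d) (sa_conj A p (mul u p)).
rewrite kconjK kup kp (sa_mulDl A) (sa_mulNl A) !(sa_mulDr A) !(sa_mulNr A) up_p => ->.
rewrite !(sa_mulZl A, sa_mulZr A, sa_1l A, sa_1r A).
rewrite !(kconjD, kconjN, kconjZ, kconj1) kup kp ku.
by apply/rowP => i; rewrite !mxE; ring.
Qed.

(** Conjugation reduces this product to [u_up]: the conjugate of (u p) u is (tu - u) (k - u p). *)
Let up_u : mul (mul u p) u = k *: u - (nu * tp) *: one + nu *: p.
Proof.
have := congr1 (@kconj R d) (sa_conj A (mul u p) u).
rewrite kconjK kup ku (sa_mulDl A) (sa_mulNl A) !(sa_mulDr A) !(sa_mulNr A) u_up => ->.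
rewrite !(sa_mulZl A, sa_mulZr A, sa_1l A, sa_1r A).
rewrite !(kconjD, kconjN, kconjZ, kconj1) kup kp ku.
by apply/rowP => i; rewrite !mxE; ring.
Qed.

Let embedM x y : mul (embed x) (embed y) = embed (model_mul x y).
Proof.
case: x => [[[a b] c] e]; case: y => [[[a' b'] c'] e']; rewrite /embed /model_mul.
rewrite !(sa_mulDl A) !(sa_mulDr A) !(sa_mulZl A) !(sa_mulZr A) !(sa_1l A) !(sa_1r A).
rewrite uu pp u_up up_p up_up pu p_up up_u.
by apply/rowP => i; rewrite !mxE; ring.
Qed.

Let embed_conj x : kconj (embed x) = embed (model_conj x).
Proof.
case: x => [[[a b] c] e]; rewrite /embed /model_conj.
rewrite !kconjD !kconjZ kconj1 ku kp kup.
by apply/rowP => i; rewrite !mxE; ring.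
Qed.

Let model_mulA x y z : model_mul x (model_mul y z) = model_mul (model_mul x y) z.
Proof.
case: x => [[[? ?] ?] ?]; case: y => [[[? ?] ?] ?]; case: z => [[[? ?] ?] ?].
rewrite /model_mul; move: tu nu tp np k => *.
congr (_, _, _, _); ring.
Qed.

Let model_mul1 x : model_mul model1 x = x.
Proof.
case: x => [[[? ?] ?] ?]; rewrite /model_mul /model1; move: tu nu tp np k => *.
congr (_, _, _, _); ring.
Qed.

Let model_1mul x : model_mul x model1 = x.
Proof.
case: x => [[[? ?] ?] ?]; rewrite /model_mul /model1; move: tu nu tp np k => *.
congr (_, _, _, _); ring.
Qed.

Let model_conjM x y : model_conj (model_mul x y) = model_mul (model_conj y) (model_conj x).
Proof.
case: x => [[[? ?] ?] ?]; case: y => [[[? ?] ?] ?].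
rewrite /model_mul /model_conj; move: tu nu tp np k => *.
congr (_, _, _, _); ring.
Qed.

Let model_conjK x : model_conj (model_conj x) = x.
Proof.
case: x => [[[? ?] ?] ?]; rewrite /model_conj; move: tu nu tp np k => *.
congr (_, _, _, _); ring.
Qed.

Let model_normr x : model_mul x (model_conj x) = (model_norm x, 0, 0, 0).
Proof.
case: x => [[[? ?] ?] ?]; rewrite /model_norm /model_mul /model_conj /=; move: tu nu tp np k => *.
congr (_, _, _, _); ring.
Qed.

Let model_norml x : model_mul (model_conj x) x = (model_norm x, 0, 0, 0).
Proof.
case: x => [[[? ?] ?] ?]; rewrite /model_norm /model_mul /model_conj /=; move: tu nu tp np k => *.
congr (_, _, _, _); ring.
Qed.

(** [embed] may fail to be injective when 1, u, p and u p are dependent, but it is injective on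
    multiples of 1, where the product of x and its conjugate lies. *)
Let model_norm1 x : dot (embed x) (embed x) = 1 -> model_norm x = 1.
Proof.
move=> n1; have := sa_normr A (embed x).
rewrite n1 embed_conj embedM model_normr /embed !scale0r !addr0 => h.
by have := congr1 (fun v => dot v one) h; rewrite !dotZl dot_one !mulr1.
Qed.

Let embed_u : embed (0, 1, 0, 0) = u.
Proof. by rewrite /embed !scale0r scale1r add0r !addr0. Qed.

Let embed_p : embed (0, 0, 1, 0) = p.
Proof. by rewrite /embed !scale0r scale1r !add0r !addr0. Qed.

Lemma conjugation_inv : dot u u = 1 -> conjugation (kconj u) (conjugation u p) = p.
Proof.
move=> n1; have := n1; rewrite -{1 2}embed_u => /model_norm1 m1.
rewrite /conjugation kconjK -embed_u -embed_p embed_conj !embedM.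
set U := (0, 1, 0, 0) in m1 *; set P := (0, 0, 1, 0).
by rewrite -!model_mulA model_norml m1 model_1mul model_mulA model_norml m1 model_mul1.
Qed.

Lemma conjugation_invariant c : let b := conjugation u p in
  dot b b = 1 -> c = b \/ c = kconj b ->
  conjugation (conjugation c u) (conjugation c p) = b.
Proof.
move=> b; pose U : model := (0, 1, 0, 0); pose P : model := (0, 0, 1, 0).
pose B := model_mul (model_mul U P) (model_conj U).
have bE : b = embed B.
  by rewrite /b /conjugation -embed_u -embed_p embed_conj !embedM.
rewrite bE => /model_norm1 m1.
have n1 : model_mul B (model_conj B) = model1 by rewrite model_normr m1.
have n2 : model_mul (model_conj B) B = model1 by rewrite model_norml m1.
(* In the associative model, conjugating both factors by a unit C telescopes to C B conj C. The
   choices C = B and C = conj B commute with B and so return B. *)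
have H C : model_mul (model_conj C) C = model1 ->
  conjugation (conjugation (embed C) u) (conjugation (embed C) p) =
  embed (model_mul (model_mul C B) (model_conj C)).
  move=> nC; rewrite /conjugation -embed_u -embed_p !embed_conj !embedM !embed_conj !embedM.
  congr embed; rewrite -/U -/P !model_conjM model_conjK -!model_mulA.
  rewrite (model_mulA (model_conj C) C) nC model_mul1.
  rewrite (model_mulA (model_conj C) C) nC model_mul1.
  by rewrite /B !model_mulA.
case=> ->.
  by rewrite H// -model_mulA n1 model_1mul.
by rewrite embed_conj H ?model_conjK ?n1// n2 model_mul1.
Qed.

End Model.

Lemma conjugation_linear b : linear (conjugation b).
Proof. by move=> a x y; rewrite /conjugation (sa_linr A b a x y) (sa_linl A). Qed.

Lemma conjugationD b x y : conjugation b (x + y) = conjugation b x + conjugation b y.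
Proof. by have := conjugation_linear b 1 x y; rewrite !scale1r. Qed.

Lemma conjugationZ b a x : conjugation b (a *: x) = a *: conjugation b x.
Proof. by rewrite /conjugation (sa_mulZr A) (sa_mulZl A). Qed.

Lemma conjugation1 b : dot b b = 1 -> conjugation b one = one.
Proof. by move=> n1; rewrite /conjugation (sa_1r A) (sa_normr A) n1 scale1r. Qed.

Lemma dot_conjugation1 b x : dot b b = 1 -> dot (conjugation b x) one = dot x one.
Proof.
move=> n1; rewrite /conjugation (sa_adjr A) kconjK (sa_1l A) (sa_adjl A) (sa_norml A) n1.
by rewrite scale1r.
Qed.

Lemma dot_conjugation b x : dot b b = 1 ->
  dot (conjugation b x) (conjugation b x) = dot x x.
Proof.
by move=> n1; rewrite /conjugation !(dot_mul A) // dot_conj n1 mul1r mulr1.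
Qed.

End TwoGenerated.

(** * The maps sigma and sigma_hat *)

Section Action.
Variables (R : realType) (K : hypercomplex).
Local Notation d := (imdim K).
Local Notation mul := (@kmul R K).
Let A := kmul_star_algebra R K.
Let Alt := kmul_alternative R K.
Implicit Types (b c q w : 'rV[R]_(1 + d)) (p : 'rV[R]_d) (z : 'rV[R]_(d + d)).

Lemma conj_byE b q : conj_by b q = conjugation mul b q.
Proof. by []. Qed.

Lemma row_mx_imag (h : 'rV[R]_1) p : row_mx h p = (h 0 0) *: kone R d + imag p.
Proof.
rewrite /kone /imag scale_row_mx add_row_mx scaler0 add0r addr0; congr row_mx.
by rewrite {1}(mx11_scalar h) scalemx1.
Qed.

Lemma dot_one_row_mx (h : 'rV[R]_1) p : dot (row_mx h p) (kone R d) = h 0 0.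
Proof.
rewrite /kone dot_row_mx [X in _ + X]dotE big1 ?addr0; last by move=> i _; rewrite mxE mulr0.
by rewrite dotE big_ord1 mxE eqxx mulr1.
Qed.

Lemma dot_one_lsubmx q : dot q (kone R d) = lsubmx q 0 0.
Proof. by rewrite -{1}[q]hsubmxK dot_one_row_mx. Qed.

Lemma imag_conj_im b p : dot b b = 1 -> imag (conj_im b p) = conj_by b (imag p).
Proof.
move=> n1; suff l0 : lsubmx (conj_by b (imag p)) = 0 by rewrite -[RHS]hsubmxK l0.
have := dot_conjugation1 A (imag p) n1.
rewrite -conj_byE !dot_one_lsubmx [in RHS]/imag row_mxKl [RHS]mxE => h.
by rewrite [LHS]mx11_scalar h raddf0.
Qed.

Lemma conj_by_row_mx b (h : 'rV[R]_1) p : dot b b = 1 ->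
  conj_by b (row_mx h p) = row_mx h (conj_im b p).
Proof.
move=> n1; rewrite !row_mx_imag conj_byE (conjugationD A) (conjugationZ A).
by rewrite (conjugation1 A)// imag_conj_im.
Qed.

Lemma imagZ a p : imag (a *: p) = a *: imag p.
Proof. by rewrite /imag scale_row_mx scaler0. Qed.

Lemma imag_inj : injective (@imag R d).
Proof. by move=> p p' /(congr1 rsubmx); rewrite !row_mxKr. Qed.

Lemma dot_imag p p' : dot (imag p) (imag p') = dot p p'.
Proof. by rewrite dot_row_mx [X in X + _]dotE big1 ?add0r// => i _; rewrite mxE mul0r. Qed.

Lemma enorm_dot_eq n m (x : 'rV[R]_n) (y : 'rV[R]_m) : dot x x = dot y y -> enorm x = enorm y.
Proof.
rewrite -!enorm_dot => h; apply/eqP.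
by rewrite -(@eqrXn2 _ 2%N) ?enorm_ge0//; apply/eqP.
Qed.

Lemma enorm_conj_im b p : dot b b = 1 -> enorm (conj_im b p) = enorm p.
Proof.
move=> n1; apply: enorm_dot_eq.
by rewrite -dot_imag imag_conj_im// conj_byE (dot_conjugation A Alt)// dot_imag.
Qed.

Lemma enorm_conj_by b w : dot b b = 1 -> enorm (conj_by b w) = enorm w.
Proof. by move=> n1; apply: enorm_dot_eq; rewrite conj_byE (dot_conjugation A Alt). Qed.

Lemma conj_imZ b a p : conj_im b (a *: p) = a *: conj_im b p.
Proof. by rewrite /conj_im imagZ conj_byE (conjugationZ A) linearZ. Qed.

Lemma conj_im_inv b p : dot b b = 1 -> conj_im (kconj b) (conj_im b p) = p.
Proof.
move=> n1; apply: imag_inj; rewrite imag_conj_im ?dot_conj// imag_conj_im//.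
exact: (conjugation_inv A Alt).
Qed.

Lemma exp_piE p : exp_pi p =
  cos (pi * enorm p) *: kone R d + (sin (pi * enorm p) / enorm p) *: imag p.
Proof. by rewrite /exp_pi row_mx_imag mxE eqxx mulr1n imagZ. Qed.

Lemma exp_pi_conj_im b p : dot b b = 1 -> exp_pi (conj_im b p) = conj_by b (exp_pi p).
Proof.
move=> n1; rewrite !exp_piE enorm_conj_im// conj_byE (conjugationD A) !(conjugationZ A).
by rewrite (conjugation1 A)// imag_conj_im.
Qed.

Lemma dot_exp_pi p : dot (exp_pi p) (exp_pi p) = 1.
Proof.
rewrite dot_row_mx [dot _%:M _]dotE big_ord1 mxE eqxx mulr1n dotZl dotZr -enorm_dot.
have [->|p0] := eqVneq (enorm p) 0; first by rewrite mulr0 cos0 expr0n !mulr0 addr0 mulr1.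
rewrite -(cos2Dsin2 (pi * enorm p)) expr2; congr (_ + _).
by field.
Qed.

Lemma bmap_neq0 p w : w != 0 ->
  bmap p w = conjugation mul ((enorm w)^-1 *: w) (exp_pi p).
Proof. by move=> w0; rewrite /bmap (negbTE w0). Qed.

Lemma dot_normalize n (w : 'rV[R]_n) : w != 0 ->
  dot ((enorm w)^-1 *: w) ((enorm w)^-1 *: w) = 1.
Proof. by move=> /sphere_normalize h; rewrite -enorm_dot h expr1n. Qed.

Lemma dot_bmap p w : dot (bmap p w) (bmap p w) = 1.
Proof.
have [->|w0] := eqVneq w 0.
  by rewrite /bmap eqxx dotNl dotNr opprK dot_one.
by rewrite bmap_neq0// (dot_conjugation A Alt) ?dot_exp_pi// dot_normalize.
Qed.

(** Conjugation by a unit commutes with normalization and with the exponential, so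
    [conjugation_invariant] applies to the pair w/|w| and e^(pi p). For w = 0 both sides are -1. *)
Lemma bmap_conj p w c : c = bmap p w \/ c = kconj (bmap p w) ->
  bmap (conj_im c p) (conj_by c w) = bmap p w.
Proof.
move=> hc; have n1 : dot c c = 1 by case: hc => ->; rewrite ?dot_conj dot_bmap.
have [w0|w0] := eqVneq w 0.
  have e0 : conj_by c w = 0.
    by apply/eqP; rewrite -enorm_eq0 enorm_conj_by// w0 enorm0.
  by rewrite e0 w0 /bmap !eqxx.
rewrite bmap_neq0; last by rewrite -enorm_eq0 enorm_conj_by// enorm_eq0.
rewrite enorm_conj_by// conj_byE -(conjugationZ A) exp_pi_conj_im// conj_byE bmap_neq0//.
apply: (conjugation_invariant A Alt); rewrite -bmap_neq0//.
exact: dot_bmap.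
Qed.

Definition act c z : 'rV[R]_(d + d) :=
  row_mx (conj_im c (lsubmx z)) (conj_im c (rsubmx z)).

Definition bsphere (y : 'rV[R]_(1 + (d + d))) : 'rV[R]_(1 + d) := bmap (p_of y) (w_of y).

Lemma dot_bsphere y : dot (bsphere y) (bsphere y) = 1.
Proof. exact: dot_bmap. Qed.

Lemma actZ c a z : act c (a *: z) = a *: act c z.
Proof. by rewrite /act !linearZ/= !conj_imZ scale_row_mx. Qed.

Lemma enorm_act c z : dot c c = 1 -> enorm (act c z) = enorm z.
Proof.
move=> n1; apply/eqP; rewrite -(@eqrXn2 _ 2%N) ?enorm_ge0// enorm_row_mx !enorm_conj_im//.
by rewrite -enorm_row_mx hsubmxK.
Qed.

Lemma act_inv c z : dot c c = 1 -> act (kconj c) (act c z) = z.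
Proof. by move=> n1; rewrite /act row_mxKl row_mxKr !conj_im_inv// hsubmxK. Qed.

Lemma act_inv' c z : dot c c = 1 -> act c (act (kconj c) z) = z.
Proof. by move=> n1; rewrite -{1}[c]kconjK act_inv// dot_conj. Qed.

Lemma bsphere_act (h : 'rV[R]_1) z c : let y := row_mx h z in
  c = bsphere y \/ c = kconj (bsphere y) -> bsphere (row_mx h (act c z)) = bsphere y.
Proof.
move=> y hc; have n1 : dot c c = 1 by case: hc => ->; rewrite ?dot_conj dot_bsphere.
have E := bmap_conj hc.
have Ep : p_of (row_mx h (act c z)) = conj_im c (p_of y).
  by rewrite /p_of /y !row_mxKr /act row_mxKl.
have Ew : w_of (row_mx h (act c z)) = conj_by c (w_of y).
  by rewrite /w_of /y !row_mxKl !row_mxKr conj_by_row_mx.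
by rewrite /bsphere Ep Ew E.
Qed.

(** Conjugation by a unit fixes Re w. In the coordinates (Re w, (p, Im w)) both sigma and
    [sigma_hat] thus become the diagonal action [act], by an element that depends on the point. *)
Lemma sigmaE y : sigma y = row_mx (lsubmx y) (act (bsphere y) (rsubmx y)).
Proof.
have n1 := dot_bsphere y.
have E : conj_by (bsphere y) (w_of y) =
    row_mx (lsubmx y) (conj_im (bsphere y) (rsubmx (rsubmx y))) by exact: conj_by_row_mx.
by rewrite /sigma -/(bsphere y) /pair_pt E row_mxKl row_mxKr.
Qed.

Lemma sigma_hatE t (x : 'rV[R]_(d + d)) :
  sigma_hat t x = act (bsphere (cylinder_to_sphere t x)) x.
Proof. by []. Qed.

End Action.

(** * Smoothness of b on the sphere *)

Section SigmaSmoothness.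
Variables (R : realType) (K : hypercomplex).
Local Notation d := (imdim K).
Local Notation S' := (sphere R (1 + (d + d))).
Let A := kmul_star_algebra R K.
Let Alt := kmul_alternative R K.
Let bR := finite_basis_real R.
Let bd := finite_basis_rV R (1 + d).
Implicit Types (V : normedModType R).

Lemma smooth_on_conj_by V (B : set V) (f g : V -> 'rV[R]_(1 + d)) :
  smooth_on B f -> smooth_on B g -> smooth_on B (fun x => conj_by (f x) (g x)).
Proof.
move=> sf sg.
have bil (f' g' : V -> 'rV[R]_(1 + d)) : smooth_on B f' -> smooth_on B g' ->
    smooth_on B (fun x => @kmul R K (f' x) (g' x)).
  by apply: (smooth_on_bilinear bd bd bd); [exact: (sa_linl A)|exact: (sa_linr A)].
apply: (bil _ _ (bil _ _ sf sg)).
by apply: (smooth_on_linear_comp bd bd) => //; exact: kconj_linear.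
Qed.

Lemma smooth_on_kconj V (B : set V) (f : V -> 'rV[R]_(1 + d)) :
  smooth_on B f -> smooth_on B (fun x => kconj (f x)).
Proof. by apply: (smooth_on_linear_comp bd bd); exact: kconj_linear. Qed.

Lemma smooth_on_lsubmx V (B : set V) n1 n2 (f : V -> 'rV[R]_(n1 + n2)) :
  smooth_on B f -> smooth_on B (fun x => lsubmx (f x)).
Proof.
apply: smooth_on_linear_comp; [exact: finite_basis_rV|exact: finite_basis_rV|].
by move=> a u v; rewrite linearP.
Qed.

Lemma smooth_on_rsubmx V (B : set V) n1 n2 (f : V -> 'rV[R]_(n1 + n2)) :
  smooth_on B f -> smooth_on B (fun x => rsubmx (f x)).
Proof.
apply: smooth_on_linear_comp; [exact: finite_basis_rV|exact: finite_basis_rV|].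
by move=> a u v; rewrite linearP.
Qed.

Lemma smooth_on_row_mx V (B : set V) n1 n2 (f : V -> 'rV[R]_n1) (g : V -> 'rV[R]_n2) :
  smooth_on B f -> smooth_on B g -> smooth_on B (fun x => row_mx (f x) (g x)).
Proof.
move=> sf sg.
apply: (@smooth_on_linear_comp _ _ _ _ _ (fun x => (f x, g x)) (fun p : 'rV[R]_n1 * 'rV[R]_n2
    => row_mx p.1 p.2)).
- by apply: finite_basis_prod; exact: finite_basis_rV.
- exact: finite_basis_rV.
- by move=> a u w; rewrite scale_row_mx add_row_mx.
- exact: smooth_on_pair.
Qed.

Lemma smooth_on_dot V (B : set V) n (f : V -> 'rV[R]_n) :
  smooth_on B f -> @smooth_on R V R B (fun x => dot (f x) (f x)).
Proof.
move=> sf; apply: (@smooth_on_eq R V R B (fun x => \sum_i f x 0 i * f x 0 i)).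
  by move=> x _; rewrite dotE.
by apply: smooth_on_sum => i; apply: smooth_onM; exact: smooth_on_coord.
Qed.

Lemma smooth_on_act V (B : set V) (c : V -> 'rV[R]_(1 + d)) (z : V -> 'rV[R]_(d + d)) :
  smooth_on B c -> smooth_on B z -> smooth_on B (fun x => act (c x) (z x)).
Proof.
move=> sc sz.
have im (f : V -> 'rV[R]_d) : smooth_on B f -> smooth_on B (fun x => conj_im (c x) (f x)).
  move=> sf; apply: smooth_on_rsubmx; apply: smooth_on_conj_by => //.
  by apply: smooth_on_row_mx => //; exact: smooth_on_cst.
by apply: smooth_on_row_mx; apply: im; [exact: smooth_on_lsubmx|exact: smooth_on_rsubmx].
Qed.

Lemma sphere_p_w (y : 'rV[R]_(1 + (d + d))) : S' y ->
  dot (p_of y) (p_of y) + dot (w_of y) (w_of y) = 1.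
Proof.
move=> Sy; have <- : dot y y = 1 by rewrite -enorm_dot Sy expr1n.
have E : dot y y = dot (row_mx (lsubmx y) (row_mx (lsubmx (rsubmx y)) (rsubmx (rsubmx y))))
    (row_mx (lsubmx y) (row_mx (lsubmx (rsubmx y)) (rsubmx (rsubmx y)))).
  by rewrite !hsubmxK.
rewrite E /w_of /p_of !dot_row_mx; ring.
Qed.

(** The two factors 1/|w| combine into 1/|w|^2, and the trigonometric terms become entire functions
    of |p|^2. The formula is therefore smooth across p = 0. *)
Lemma bsphere_neq0 (y : 'rV[R]_(1 + (d + d))) : w_of y != 0 -> bsphere y =
  even_trig 0 (pi ^+ 2 * dot (p_of y) (p_of y)) *: kone R d +
  (pi * even_trig 1 (pi ^+ 2 * dot (p_of y) (p_of y)) / dot (w_of y) (w_of y)) *: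
    conj_by (w_of y) (imag (p_of y)).
Proof.
move=> w0; rewrite /bsphere bmap_neq0// exp_piE (conjugationD A) !(conjugationZ A).
set w := w_of y in w0 *; set p := p_of y.
have n1 := dot_normalize w0; rewrite (conjugation1 A)//; congr (_ *: _ + _).
  by rewrite cos_even_trig exprMn enorm_dot.
have -> : conjugation (@kmul R K) ((enorm w)^-1 *: w) (imag p) =
    (dot w w)^-1 *: conj_by w (imag p).
  rewrite conj_byE /conjugation (sa_mulZl A) kconjZ (sa_mulZl A) (sa_mulZr A).
  by rewrite scalerA -enorm_dot expr2 invfM.
rewrite scalerA.
(* At p = 0 the coefficients differ, sin 0 / 0 being 0 while the series gives pi, but both multiply
   the zero vector. *)
have [p0|p0] := eqVneq p 0.
  have -> : imag p = 0 by rewrite p0 /imag row_mx0.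
  by rewrite conj_byE /conjugation (sa_mul0r A) (sa_mul0l A) !scaler0.
congr (_ *: _); rewrite sin_even_trig exprMn enorm_dot.
have e0 : enorm p != 0 by rewrite enorm_eq0.
have r0 : dot w w != 0 by rewrite -enorm_dot expf_eq0 enorm_eq0.
by field; rewrite e0 r0.
Qed.

(* Near w = 0, where |p| = sqrt (1 - r) with r = |w|^2, one has
   sin (pi |p|) = sin (pi - pi |p|) and 1 - |p| = r / (1 + |p|). *)
Lemma bsphere_p_neq0 (y : 'rV[R]_(1 + (d + d))) : S' y -> p_of y != 0 ->
  let s := enorm (p_of y) in
  bsphere y = even_trig 0 (pi ^+ 2 * dot (p_of y) (p_of y)) *: kone R d +
  (pi / (1 + s) * even_trig 1 ((pi * dot (w_of y) (w_of y) / (1 + s)) ^+ 2) / s) *: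
    conj_by (w_of y) (imag (p_of y)).
Proof.
move=> Sy p0 s; have := sphere_p_w Sy; rewrite -[dot (p_of y) _]enorm_dot -/s => h.
have s0 : 0 < s by rewrite enorm_gt0.
have [w0|w0] := eqVneq (w_of y) 0.
  rewrite w0 conj_byE /conjugation !(sa_mul0l A) scaler0 addr0.
  rewrite /bsphere w0 /bmap eqxx.
  have s1 : s ^+ 2 = 1 by move: h; rewrite w0 [dot 0 0]dotE big1 ?addr0// => i _; rewrite mxE
      mul0r.
  by rewrite s1 mulr1 -cos_even_trig cospi scaleN1r.
rewrite bsphere_neq0// -[dot (p_of y) _]enorm_dot -/s; congr (_ + _ *: _).
set r := dot (w_of y) (w_of y) in h *.
have r0 : r != 0 by rewrite /r -enorm_dot expf_eq0 enorm_eq0.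
have e1 : pi * s * even_trig 1 (pi ^+ 2 * s ^+ 2) = sin (pi * s).
  by rewrite sin_even_trig exprMn.
have e2 : (pi * r / (1 + s)) * even_trig 1 ((pi * r / (1 + s)) ^+ 2) = sin (pi * r / (1 + s)).
  by rewrite -sin_even_trig.
have e3 : pi * r / (1 + s) = pi - pi * s.
  have -> : r = (1 - s) * (1 + s) by rewrite -subr_sqr expr1n -h; ring.
  by field; rewrite gt_eqF//; lra.
have e4 : sin (pi * r / (1 + s)) = sin (pi * s).
  by rewrite e3 sinB sinpi cospi mul0r mulN1r sub0r opprK.
have s1 : 1 + s != 0 by rewrite gt_eqF//; lra.
have sn : s != 0 by rewrite gt_eqF.
have pi0 : (pi : R) != 0 by rewrite gt_eqF ?pi_gt0.
have -> : pi * even_trig 1 (pi ^+ 2 * s ^+ 2) / r = sin (pi * s) / (s * r).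
  by rewrite -e1; field; rewrite sn r0.
by rewrite -e4 -e2; field; rewrite sn r0 s1.
Qed.

(** The domains w <> 0 and p <> 0 of the two preceding formulas cover the sphere. *)
Lemma smooth_on_bsphere : smooth_on S' (@bsphere R K).
Proof.
have by_ := finite_basis_rV R (1 + (d + d)).
have sid (B : set 'rV[R]_(1 + (d + d))) : smooth_on B id by exact: smooth_on_linear.
have sp (B : set 'rV[R]_(1 + (d + d))) : smooth_on B (@p_of R K).
  by apply: smooth_on_lsubmx; exact: smooth_on_rsubmx.
have sw (B : set 'rV[R]_(1 + (d + d))) : smooth_on B (@w_of R K).
  by apply: smooth_on_row_mx; [exact: smooth_on_lsubmx|apply: smooth_on_rsubmx; exact:
      smooth_on_rsubmx].
have oT (n : nat) (f : 'rV[R]_(1 + (d + d)) -> 'rV[R]_n) : smooth_on setT f ->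
    open [set y | f y != 0].
  move=> sf; apply: (@open_comp _ _ f [set x | x != 0]); last exact: open_rV_neq0.
  by move=> x _; exact: (smooth_on_continuous openT sf).
have se (B : set 'rV[R]_(1 + (d + d))) m (f : 'rV[R]_(1 + (d + d)) -> R) :
    smooth_on B f -> smooth_on B (fun y => even_trig m (f y)) by exact: smooth_on_even_trig.
have sc (B : set 'rV[R]_(1 + (d + d))) :
    smooth_on B (fun y => conj_by (w_of y) (imag (p_of y)) : 'rV[R]_(1 + d)).
  apply: smooth_on_conj_by => //; apply: smooth_on_row_mx => //; exact: smooth_on_cst.
have s0 (B : set 'rV[R]_(1 + (d + d))) :
    @smooth_on R _ R B (fun y : 'rV[R]_(1 + (d + d)) => pi ^+ 2 * dot (p_of y) (p_of y)).
  by apply: smooth_onM; [exact: smooth_on_cst|exact: smooth_on_dot].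
apply: smooth_on_local => y Sy.
have [w0|w0] := eqVneq (w_of y) 0; last first.
  exists [set y | w_of y != 0]; split => //; first exact: oT.
  apply: (smooth_on_eq (f := fun y => even_trig 0 (pi ^+ 2 * dot (p_of y) (p_of y)) *: kone R d +
    (pi * even_trig 1 (pi ^+ 2 * dot (p_of y) (p_of y)) / dot (w_of y) (w_of y)) *:
      conj_by (w_of y) (imag (p_of y)))).
    by move=> x [_ /= x0]; rewrite bsphere_neq0.
  apply: smooth_onD; first by apply: smooth_onZ => //; [exact: se|exact: smooth_on_cst].
  apply: smooth_onZ => //; apply: smooth_onM.
    by apply: smooth_onM; [exact: smooth_on_cst|exact: se].
  apply: smooth_onV; last exact: smooth_on_dot.
  by move=> x [_ /= x0]; rewrite -enorm_dot expf_eq0 enorm_eq0.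
have p0 : p_of y != 0.
  apply/eqP => p0; have := sphere_p_w Sy; rewrite w0 p0 !dotE !big1 ?addr0.
  - by move/eqP; rewrite eq_sym oner_eq0.
  - by move=> i _; rewrite mxE mul0r.
  - by move=> i _; rewrite mxE mul0r.
exists [set y | p_of y != 0]; split => //; first exact: oT.
set B := _ `&` _; have Bp x : B x -> p_of x != 0 by case.
have sn : @smooth_on R _ R B (fun y : 'rV[R]_(1 + (d + d)) => enorm (p_of y)).
  exact: smooth_on_enorm.
have sV : @smooth_on R _ R B (fun y : 'rV[R]_(1 + (d + d)) => (1 + enorm (p_of y))^-1).
  apply: smooth_onV; last by apply: smooth_onD => //; exact: smooth_on_cst.
  by move=> x _; rewrite gt_eqF// ltr_pwDl// enorm_ge0.
apply: (smooth_on_eq (f := fun y => even_trig 0 (pi ^+ 2 * dot (p_of y) (p_of y)) *: kone R d +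
  (pi / (1 + enorm (p_of y)) * even_trig 1 ((pi * dot (w_of y) (w_of y) / (1 + enorm (p_of
      y))) ^+ 2)
     / enorm (p_of y)) *: conj_by (w_of y) (imag (p_of y)))).
  by move=> x [Sx /= x0]; rewrite bsphere_p_neq0.
apply: smooth_onD; first by apply: smooth_onZ => //; [exact: se|exact: smooth_on_cst].
apply: smooth_onZ => //; apply: smooth_onM; last first.
  by apply: smooth_onV => // x /Bp; rewrite enorm_eq0.
apply: smooth_onM; first by apply: smooth_onM => //; exact: smooth_on_cst.
have sX : @smooth_on R _ R B (fun y : 'rV[R]_(1 + (d + d)) => pi * dot (w_of y) (w_of y) / (1
    + enorm (p_of y))).
  apply: smooth_onM => //; apply: smooth_onM; first exact: smooth_on_cst.
  exact: smooth_on_dot.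
apply: se; apply: (smooth_on_eq (f := fun y => (pi * dot (w_of y) (w_of y) / (1 + enorm (p_of
    y))) * (pi * dot (w_of y) (w_of y) / (1 + enorm (p_of y))))).
  by move=> x _; rewrite -expr2.
exact: smooth_onM.
Qed.

End SigmaSmoothness.

(** * The loop and the deformation of sigma *)

Section SigmaLoop.
Variables (R : realType) (K : hypercomplex).
Local Notation d := (imdim K).
Local Notation S := (sphere R (d + d)).
Local Notation S' := (sphere R (1 + (d + d))).
Local Notation I := ([set` `[0, 1]] : set R).
Local Notation cyl := (@cylinder_to_sphere R (d + d)).
Let A := kmul_star_algebra R K.
Let Alt := kmul_alternative R K.
Let bR := finite_basis_real R.
Let bn := finite_basis_rV R (d + d).
Let b1 := finite_basis_rV R (1 + (d + d)).
Implicit Types (V : normedModType R) (x z : 'rV[R]_(d + d)) (y : 'rV[R]_(1 + (d + d))).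

Lemma cylinder_to_sphere_sphere t x : S x -> S' (cyl t x).
Proof.
move=> Sx; apply: sphere_splitP; rewrite row_mxKl row_mxKr enormZ Sx mulr1.
by rewrite real_normK ?num_real// mxE eqxx mulr1n sqrrN cos2Dsin2.
Qed.

Lemma smooth_on_scalar V (B : set V) (f : V -> R) :
  @smooth_on R V R B f -> smooth_on B (fun v => (f v)%:M : 'rV[R]_1).
Proof.
move=> sf; apply: (@smooth_on_eq _ _ _ _ (fun v => f v *: (1%:M : 'rV[R]_1))).
  by move=> v _; rewrite scalemx1.
by apply: smooth_onZ => //; [exact: finite_basis_rV|exact: smooth_on_cst].
Qed.

Lemma smooth_on_bsphere_cylinder V (B : set V) (t : V -> R) (f : V -> 'rV[R]_(d + d)) :
  (forall v, B v -> S (f v)) -> smooth_on B t -> smooth_on B f ->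
  smooth_on B (fun v => bsphere (cyl (t v) (f v))).
Proof.
move=> Sf st sf.
apply: (smooth_on_comp (B := S') (f := fun v => cyl (t v) (f v)) b1 (finite_basis_rV R (1 + d))).
- by move=> v /Sf; exact: cylinder_to_sphere_sphere.
- have sp : smooth_on B (fun v => pi * t v) by apply: smooth_onM => //; exact: smooth_on_cst.
  apply: smooth_on_row_mx.
    by apply: smooth_on_scalar; apply: smooth_onN => //; exact: smooth_on_cos.
  by apply: smooth_onZ => //; exact: smooth_on_sin.
- exact: smooth_on_bsphere.
Qed.

Lemma bsphere_cylinder_act t x c : let b := bsphere (cyl t x) in
  c = b \/ c = kconj b -> bsphere (cyl t (act c x)) = b.
Proof. by move=> b hc; rewrite {1}/cylinder_to_sphere -actZ; exact: bsphere_act. Qed.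

Lemma act_kone z : act (kone R d) z = z.
Proof.
have E p : conj_im (kone R d) p = p.
  by rewrite /conj_im conj_byE /conjugation kconj1 (sa_1l A) (sa_1r A) row_mxKr.
by rewrite /act !E hsubmxK.
Qed.

Lemma bsphere_pole y : S' y -> rsubmx y = 0 -> bsphere y = kone R d.
Proof.
move=> Sy z0; have p0 : p_of y = 0 by rewrite /p_of z0 linear0.
have w0 : w_of y != 0.
  apply/eqP => w0; have := sphere_p_w Sy; rewrite w0 p0 -!enorm_dot !enorm0 expr0n addr0.
  by move/eqP; rewrite eq_sym oner_eq0.
rewrite /bsphere bmap_neq0// p0 exp_piE enorm0 mulr0 cos0 sin0 mul0r scale0r addr0 scale1r.
by rewrite (conjugation1 A)//; exact: dot_normalize.
Qed.

(** A vanishing sine places the point at a pole, where p = 0 and hence b = 1. *)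
Lemma sigma_hat_end t : sin (pi * t) = 0 -> eq_on_sphere (@sigma_hat R K t) id.
Proof.
move=> h x Sx; rewrite sigma_hatE bsphere_pole ?act_kone//.
  exact: cylinder_to_sphere_sphere.
by rewrite row_mxKr h scale0r.
Qed.

Lemma sigma_hat0 : eq_on_sphere (@sigma_hat R K 0) id.
Proof. by apply: sigma_hat_end; rewrite mulr0 sin0. Qed.

Lemma sigma_hat1 : eq_on_sphere (@sigma_hat R K 1) id.
Proof. by apply: sigma_hat_end; rewrite mulr1 sinpi. Qed.

Lemma sigma_hat_diffeo t : diffeo (@sigma_hat R K t).
Proof.
have sid : smooth_on S id by exact: smooth_on_linear.
have sb : smooth_on S (fun x => bsphere (cyl t x)).
  by apply: smooth_on_bsphere_cylinder => //; exact: smooth_on_cst.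
split.
- by move=> x Sx; rewrite sigma_hatE /sphere /= enorm_act// dot_bsphere.
- exact: smooth_on_act.
exists (fun x => act (kconj (bsphere (cyl t x))) x); split.
- by move=> x Sx; rewrite /sphere /= enorm_act// dot_conj dot_bsphere.
- by apply: smooth_on_act => //; exact: smooth_on_kconj.
- by move=> x Sx; rewrite sigma_hatE bsphere_cylinder_act ?act_inv ?dot_bsphere//; left.
- by move=> x Sx; rewrite sigma_hatE bsphere_cylinder_act ?act_inv' ?dot_bsphere//; right.
Qed.

Lemma sigma_hat_smooth : smooth_on (I `*` S)
  (fun tx : R * 'rV[R]_(d + d) => @sigma_hat R K tx.1 tx.2).
Proof.
have s2 : smooth_on (I `*` S) (fun tx : R * 'rV[R]_(d + d) => tx.2) by exact: smooth_on_snd.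
apply: smooth_on_act => //; apply: smooth_on_bsphere_cylinder => //; last exact: smooth_on_fst.
by move=> [t x] [].
Qed.

Lemma sigma_hat_loop : smooth_loop (@sigma_hat R K).
Proof.
split; [exact: sigma_hat_smooth| |exact: sigma_hat0|exact: sigma_hat1].
apply: (path_orientation (t0 := 0) sigma_hat_smooth).
- by move=> t _; exact: sigma_hat_diffeo.
- by rewrite /= in_itv/= lexx ler01.
- apply: (@eq_orientation_preserving _ _ id); first by move=> x /sigma_hat0.
  by have [] := @Diffp_id R (d + d).
Qed.

Lemma act0 c : act c (0 : 'rV[R]_(d + d)) = 0.
Proof. by rewrite -[0](scale0r 0) actZ !scale0r. Qed.

(** Used with u the identity, to recover sigma, and with [u = step], at the end of the
    deformation. *)
Lemma boundary_sigma_hat_reparam (u : R -> R) y : S' y ->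
  boundary (fun t => @sigma_hat R K (u t)) y =
  row_mx (lsubmx y) (act (bsphere (cyl (u (time_of y)) ((enorm (rsubmx y))^-1 *: rsubmx y)))
      (rsubmx y)).
Proof.
move=> Sy; rewrite boundaryE; congr row_mx; rewrite /radial_extension sigma_hatE actZ.
have [->|z0] := eqVneq (rsubmx y) 0; first by rewrite enorm0 scale0r act0.
by rewrite scalerA divff ?scale1r// enorm_eq0.
Qed.

Lemma boundary_sigma_hat : eq_on_sphere (boundary (@sigma_hat R K)) (@sigma R K).
Proof.
move=> y Sy; apply: (etrans (boundary_sigma_hat_reparam id Sy)).
rewrite sigmaE; apply: (congr1 (row_mx (lsubmx y))).
have [z0|z0] := eqVneq (rsubmx y) 0; first by rewrite z0 !act0.
suff -> : cyl (time_of y) ((enorm (rsubmx y))^-1 *: rsubmx y) = y by [].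
rewrite /cylinder_to_sphere cos_time_of// sin_time_of//.
by rewrite opprK -lsubmx_scalar scalerA divff ?scale1r ?hsubmxK// enorm_eq0.
Qed.

(* [slide s y] moves y along the meridian through y, from the position of y to
   the height of parameter [step (time_of y)]. *)
Definition slide_height s y : R :=
  (1 - s) * lsubmx y 0 0 - s * cos (pi * step (time_of y)).
Definition slide_width s y : R :=
  (1 - s) + s * (sin (pi * step (time_of y)) / enorm (rsubmx y)).
(** Off the poles this is the segment from y to its target; normalizing it keeps the point on the
    meridian of y. *)
Definition slide_vect s y : 'rV[R]_(1 + (d + d)) :=
  row_mx (slide_height s y)%:M (slide_width s y *: rsubmx y).
Definition slide s y : 'rV[R]_(1 + (d + d)) :=
  (enorm (slide_vect s y))^-1 *: slide_vect s y.

Let third_gt0 : 0 < 1/3 :> R. Proof. by lra. Qed.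

(** In a polar cap [step] is constant and the target is the pole itself. This removes the time and
    the division by |z| from the formulas near the poles. *)
Lemma polar_step y : S' y -> polar_bound (1/3) < `|lsubmx y 0 0| ->
  (lsubmx y 0 0 < 0 /\ step (time_of y) = 0) \/ (0 < lsubmx y 0 0 /\ step (time_of y) = 1).
Proof.
move=> Sy h; have /andP[t0 t1] := time_of_itv Sy; have ct := cos_time_of Sy.
have pi0 := pi_gt0 R.
have [t|t] := near_pole third_gt0 Sy h.
  left; rewrite step0 ?ltW//; split => //.
  by rewrite -oppr_gt0 -ct cos_gt0_pihalf//; apply/andP; split; nra.
right; rewrite step1; last by lra.
split => //; have -> : lsubmx y 0 0 = cos (pi * (1 - time_of y)).
  by rewrite mulrBr mulr1 cosB cospi sinpi mul0r addr0 mulN1r ct opprK.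
by rewrite cos_gt0_pihalf//; apply/andP; split; nra.
Qed.

(** At a pole the two heights that are interpolated have the same sign. Elsewhere the width is a sum
    of nonnegative terms, so its vanishing forces s = 1 and a zero sine, and then the height is the
    nonzero number - cos. *)
Lemma slide_vect_neq0 s y : I s -> S' y -> slide_vect s y != 0.
Proof.
rewrite /= in_itv/= => /andP[s0 s1] Sy; apply/eqP => E.
have E1 : slide_height s y = 0.
  have := congr1 (fun v : 'rV[R]_(1 + (d + d)) => lsubmx v 0 0) E.
  by rewrite row_mxKl linear0 !mxE eqxx mulr1n.
have E2 : slide_width s y *: rsubmx y = 0.
  by have := congr1 rsubmx E; rewrite row_mxKr linear0.
move: E1; rewrite /slide_height.
have [z0|z0] := eqVneq (rsubmx y) 0.
  have [[h ->]|[h ->]] := polar_step Sy (pole_height third_gt0 Sy z0).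
    by rewrite mulr0 cos0; nra.
  by rewrite mulr1 cospi; nra.
move/eqP: E2; rewrite scaler_eq0 (negbTE z0) orbF /slide_width => /eqP.
have /andP[u0 u1] := step_itv (time_of y); have pi0 := pi_gt0 R.
have sn : 0 <= sin (pi * step (time_of y)).
  by apply: sin_ge0_pi; apply/andP; split; nra.
have zp : 0 < enorm (rsubmx y) by rewrite enorm_gt0.
have q0 : 0 <= sin (pi * step (time_of y)) / enorm (rsubmx y) by rewrite divr_ge0// ltW.
set q := _ / _ in q0 * => El.
have es : s = 1 by nra.
move: El; rewrite es subrr add0r mul1r => /eqP; rewrite mulf_eq0 invr_eq0 (gt_eqF zp) orbF =>
    /eqP sn0.
rewrite mul0r sub0r mul1r => /eqP; rewrite oppr_eq0 => /eqP cs0.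
have := cos2Dsin2 (pi * step (time_of y)); rewrite sn0 cs0 expr0n addr0.
by move/eqP; rewrite eq_sym oner_eq0.
Qed.

Lemma slide_sphere s y : I s -> S' y -> S' (slide s y).
Proof. by move=> Is Sy; apply: sphere_normalize; exact: slide_vect_neq0. Qed.

Lemma slide0 y : S' y -> slide 0 y = y.
Proof.
move=> Sy; suff E : slide_vect 0 y = y by rewrite /slide E Sy invr1 scale1r.
rewrite /slide_vect /slide_height /slide_width !mul0r !subr0 addr0 mul1r scale1r.
by rewrite -lsubmx_scalar hsubmxK.
Qed.

Lemma slide1 y : rsubmx y != 0 ->
  slide 1 y = cyl (step (time_of y)) ((enorm (rsubmx y))^-1 *: rsubmx y).
Proof.
move=> z0.
have E : slide_vect 1 y = cyl (step (time_of y)) ((enorm (rsubmx y))^-1 *: rsubmx y).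
  rewrite /slide_vect /slide_height /slide_width subrr mul0r sub0r mul1r add0r mul1r.
  by rewrite /cylinder_to_sphere scalerA.
by rewrite /slide E (cylinder_to_sphere_sphere _ (sphere_normalize z0)) invr1 scale1r.
Qed.

(** Height and width depend on y only through h and |z|, which [act] preserves. *)
Lemma slide_act s (h : 'rV[R]_1) z c : dot c c = 1 -> let v := slide s (row_mx h z) in
  slide s (row_mx h (act c z)) = row_mx (lsubmx v) (act c (rsubmx v)).
Proof.
move=> n1 v.
have E : slide_vect s (row_mx h (act c z)) =
    row_mx (lsubmx (slide_vect s (row_mx h z))) (act c (rsubmx (slide_vect s (row_mx h z)))).
  rewrite /slide_vect !row_mxKl !row_mxKr actZ /slide_height /slide_width /time_of.
  by rewrite !row_mxKl !row_mxKr enorm_act.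
have N : enorm (slide_vect s (row_mx h (act c z))) = enorm (slide_vect s (row_mx h z)).
  apply/eqP; rewrite -(@eqrXn2 _ 2%N) ?enorm_ge0// E enorm_row_mx enorm_act//.
  by rewrite -enorm_row_mx hsubmxK.
by rewrite /v /slide N E scale_row_mx -actZ !linearZ.
Qed.

Lemma bsphere_slide_act s (h : 'rV[R]_1) z c : let b := bsphere (slide s (row_mx h z)) in
  c = b \/ c = kconj b -> bsphere (slide s (row_mx h (act c z))) = b.
Proof.
move=> b hc; have n1 : dot c c = 1 by case: hc => ->; rewrite ?dot_conj dot_bsphere.
rewrite slide_act// bsphere_act ?hsubmxK//.
Qed.

Lemma slide_vect_smooth : smooth_on (I `*` S')
  (fun sy : R * 'rV[R]_(1 + (d + d)) => slide_vect sy.1 sy.2).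
Proof.
pose T := (R * 'rV[R]_(1 + (d + d)))%type.
have s1 (B : set T) : smooth_on B (fun sy : T => sy.1) by exact: smooth_on_fst.
have s2 (B : set T) : smooth_on B (fun sy : T => sy.2) by exact: smooth_on_snd.
have s1' (B : set T) : @smooth_on R T R B (fun sy => 1 - sy.1).
  by apply: smooth_onB => //; exact: smooth_on_cst.
have sl (B : set T) : @smooth_on R T R B (fun sy => lsubmx sy.2 0 0).
  by apply: smooth_on_coord; exact: smooth_on_lsubmx.
have sr (B : set T) : smooth_on B (fun sy : T => rsubmx sy.2) by exact: smooth_on_rsubmx.
have oT (f : T -> R) (c : R) : @smooth_on R T R setT f -> open [set sy | c < f sy].
  move=> sf; apply: (@open_comp _ _ f [set r | c < r]); last exact: open_gt.
  by move=> x _; exact: (@smooth_on_continuous R T R _ _ openT sf).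
(* Here a is the height of the pole. On its cap the vector is ((1 - s) h + s a, (1 - s) z),
   polynomial in s and y. *)
have polar (a : R) : 0 <= polar_bound (R := R) (1/3) -> a = 1 \/ a = -1 -> smooth_on
    ((I `*` S') `&` [set sy : T | polar_bound (1/3) < a * lsubmx sy.2 0 0])
    (fun sy : T => slide_vect sy.1 sy.2).
  move=> pb ha.
  apply: (@smooth_on_eq _ _ _ _ (fun sy : T => row_mx ((1 - sy.1) * lsubmx sy.2 0 0 + sy.1 * a)%:M
      ((1 - sy.1) *: rsubmx sy.2))).
    move=> [s y] [[/= Is Sy] h]; rewrite /slide_vect /slide_height /slide_width.
    have h' : polar_bound (1/3) < `|lsubmx y 0 0|.
      apply: (lt_le_trans h); case: ha => ->; rewrite ?mul1r ?mulN1r ?ler_norm//.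
      by rewrite -normrN ler_norm.
    have [[g ->]|[g ->]] := polar_step Sy h'.
      have -> : a = -1 by case: ha h => // ->; lra.
      by rewrite mulr0 cos0 sin0 mul0r mulr0 addr0 mulrN.
    have -> : a = 1 by case: ha h => // ->; lra.
    by rewrite !mulr1 cospi sinpi mul0r mulr0 addr0 mulrN mulr1 opprK.
  apply: smooth_on_row_mx; last by apply: smooth_onZ.
  apply: smooth_on_scalar; apply: smooth_onD; apply: smooth_onM => //.
  exact: smooth_on_cst.
have pb : 0 <= polar_bound (R := R) (1/3).
  apply: ltW; rewrite /polar_bound (_ : Num.min _ _ = 1/3); last by apply/min_idPl; lra.
  have pi0 := pi_gt0 R.
  by rewrite cos_gt0_pihalf//; apply/andP; split; nra.
apply: smooth_on_local => -[s y] [/= Is Sy].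
have [z0|z0] := eqVneq (rsubmx y) 0.
  have := pole_height third_gt0 Sy z0; rewrite ltr_normr => /orP[h|h].
    exists [set sy : T | polar_bound (1/3) < 1 * lsubmx sy.2 0 0]; split => //=.
    - by apply: oT; apply: smooth_onM => //; exact: smooth_on_cst.
    - by rewrite [1 * lsubmx _ _ _]mul1r.
    - by apply: polar => //; left.
  exists [set sy : T | polar_bound (1/3) < -1 * lsubmx sy.2 0 0]; split => //=.
  - by apply: oT; apply: smooth_onM => //; exact: smooth_on_cst.
  - by rewrite mulN1r.
  - by apply: polar => //; right.
exists ((fun sy : T => rsubmx sy.2) @^-1` [set z | z != 0]); split => //.
  apply: open_comp; last exact: open_rV_neq0.
  by move=> x _; apply: (smooth_on_continuous openT).
set B := _ `&` _.
have Bz v : B v -> rsubmx v.2 != 0 by case.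
have st : @smooth_on R T R B (fun sy => pi * step (time_of sy.2)).
  apply: smooth_onM; first exact: smooth_on_cst.
  apply: smooth_on_step; apply: smooth_onM; last exact: smooth_on_cst.
  apply: smooth_on_acos; last exact: smooth_onN.
  move=> [s' y'] [[/= Is' Sy'] h]; have /andP[h1 h2] := height_lt1 Sy' h.
  by apply/andP; split; lra.
apply: smooth_on_row_mx.
  apply: smooth_on_scalar; apply: smooth_onB => //; apply: smooth_onM => //.
  exact: smooth_on_cos.
apply: smooth_onZ => //; apply: smooth_onD => //; apply: smooth_onM => //.
apply: smooth_onM; first exact: smooth_on_sin.
apply: smooth_onV; last exact: smooth_on_enorm.
by move=> v /Bz; rewrite enorm_eq0.
Qed.

Definition slide_sigma s y : 'rV[R]_(1 + (d + d)) :=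
  row_mx (lsubmx y) (act (bsphere (slide s y)) (rsubmx y)).

Lemma bsphere_slide_smooth : smooth_on (I `*` S')
  (fun sy : R * 'rV[R]_(1 + (d + d)) => bsphere (slide sy.1 sy.2)).
Proof.
apply: (smooth_on_comp (B := S') (f := fun sy : R * 'rV[R]_(1 + (d + d)) => slide sy.1 sy.2)
  b1 (finite_basis_rV R (1 + d))); last exact: smooth_on_bsphere.
  by move=> [s y] [/= Is Sy]; exact: slide_sphere.
apply: smooth_on_normalize; last exact: slide_vect_smooth.
by move=> [s y] [/= Is Sy]; exact: slide_vect_neq0.
Qed.

Lemma slide_sigma_smooth : smooth_on (I `*` S')
  (fun sy : R * 'rV[R]_(1 + (d + d)) => slide_sigma sy.1 sy.2).
Proof.
have s2 : smooth_on (I `*` S') (fun sy : R * 'rV[R]_(1 + (d + d)) => sy.2) by exact: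
    smooth_on_snd.
apply: smooth_on_row_mx; first exact: smooth_on_lsubmx.
by apply: smooth_on_act; [exact: bsphere_slide_smooth|exact: smooth_on_rsubmx].
Qed.

Lemma slide_sigma_diffeo s : I s -> diffeo (slide_sigma s).
Proof.
move=> Is.
have sid : smooth_on S' id by exact: smooth_on_linear.
have sb : smooth_on S' (fun y => bsphere (slide s y)).
  apply: (@smooth_on_comp _ _ _ _ S' (I `*` S') (fun y => (s, y))
    (fun sy : R * 'rV[R]_(1 + (d + d)) => bsphere (slide sy.1 sy.2))) => //.
  - exact: finite_basis_prod.
  - exact: finite_basis_rV.
  - by apply: smooth_on_pair => //; exact: smooth_on_cst.
  - exact: bsphere_slide_smooth.
have SE y c : dot c c = 1 -> S' y -> S' (row_mx (lsubmx y) (act c (rsubmx y))).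
  move=> n1 Sy; apply: sphere_splitP; rewrite row_mxKl row_mxKr enorm_act//.
  exact: sphere_split.
split.
- by move=> y Sy; apply: SE => //; exact: dot_bsphere.
- apply: smooth_on_row_mx; first exact: smooth_on_lsubmx.
  by apply: smooth_on_act => //; exact: smooth_on_rsubmx.
exists (fun y => row_mx (lsubmx y) (act (kconj (bsphere (slide s y))) (rsubmx y))); split.
- by move=> y Sy; apply: SE => //; rewrite dot_conj dot_bsphere.
- apply: smooth_on_row_mx; first exact: smooth_on_lsubmx.
  by apply: smooth_on_act; [exact: smooth_on_kconj|exact: smooth_on_rsubmx].
- move=> y Sy; rewrite /slide_sigma row_mxKl row_mxKr bsphere_slide_act hsubmxK; last by left.
  by rewrite act_inv ?dot_bsphere// hsubmxK.
- move=> y Sy; rewrite /slide_sigma row_mxKl row_mxKr bsphere_slide_act hsubmxK; last by right.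
  by rewrite act_inv' ?dot_bsphere// hsubmxK.
Qed.

Lemma slide_sigma0 : eq_on_sphere (slide_sigma 0) (@sigma R K).
Proof. by move=> y Sy; rewrite /slide_sigma slide0// sigmaE. Qed.

Lemma slide_sigma1 :
  eq_on_sphere (slide_sigma 1) (boundary (fun t => @sigma_hat R K (step t))).
Proof.
move=> y Sy; apply: (etrans _ (esym (boundary_sigma_hat_reparam (@step R) Sy))).
apply: (congr1 (row_mx (lsubmx y))).
have [z0|z0] := eqVneq (rsubmx y) 0; first by rewrite z0 !act0.
by rewrite (slide1 z0).
Qed.

End SigmaLoop.

(** * Isotopy classes of boundary maps *)

Section SigmaClass.
Variables (R : realType) (n : nat).
Local Notation S := (sphere R n).
Local Notation S' := (sphere R (1 + n)).
Local Notation I := ([set` `[0, 1]] : set R).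
Let bR := finite_basis_real R.
Let bn := finite_basis_rV R n.

Lemma eq_isotopic m (f f' g g' : 'rV[R]_m -> 'rV[R]_m) :
  eq_on_sphere f f' -> eq_on_sphere g g' -> isotopic f g -> isotopic f' g'.
Proof.
move=> ff gg [H [sH dH H0 H1]]; exists H; split => // x Sx.
- by rewrite H0// ff.
- by rewrite H1// gg.
Qed.

Lemma convex_itv (s t t' : R) : 0 <= s <= 1 -> 0 <= t <= 1 -> 0 <= t' <= 1 ->
  0 <= (1 - s) * t + s * t' <= 1.
Proof. by move=> /andP[? ?] /andP[? ?] /andP[? ?]; apply/andP; split; nra. Qed.

Lemma smooth_on_reparam2 (V : normedModType R) (B : set V) (u v : V -> R)
    (f : V -> 'rV[R]_n) (H : R -> R -> 'rV[R]_n -> 'rV[R]_n) :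
  smooth_on (I `*` I `*` S) (fun stx : R * R * 'rV[R]_n => H stx.1.1 stx.1.2 stx.2) ->
  (forall x, B x -> 0 <= u x <= 1) -> (forall x, B x -> 0 <= v x <= 1) ->
  (forall x, B x -> S (f x)) ->
  @smooth_on R V R B u -> @smooth_on R V R B v -> smooth_on B f ->
  smooth_on B (fun x => H (u x) (v x) (f x)).
Proof.
move=> sH uI vI fS su sv sf.
apply: (@smooth_on_comp R V _ _ B (I `*` I `*` S) (fun x => (u x, v x, f x))
  (fun stx : R * R * 'rV[R]_n => H stx.1.1 stx.1.2 stx.2)) => //.
- by apply: finite_basis_prod => //; exact: finite_basis_prod.
- by move=> x Bx; split; [split; rewrite /= in_itv/=; [exact: uI|exact: vI]|exact: fS].
- by apply: smooth_on_pair => //; exact: smooth_on_pair.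
Qed.

Let T := (R * R * 'rV[R]_n)%type.
Let sfst (B : set T) : @smooth_on R T R B (fun stx => stx.1.1).
Proof.
apply: smooth_on_linear; last by [].
by apply: finite_basis_prod => //; exact: finite_basis_prod.
Qed.
Let ssnd (B : set T) : @smooth_on R T R B (fun stx => stx.1.2).
Proof.
apply: smooth_on_linear; last by [].
by apply: finite_basis_prod => //; exact: finite_basis_prod.
Qed.
Let sthd (B : set T) : smooth_on B (fun stx : T => stx.2).
Proof.
apply: smooth_on_linear; last by [].
by apply: finite_basis_prod => //; exact: finite_basis_prod.
Qed.

Lemma step_flat (b : R -> 'rV[R]_n -> 'rV[R]_n) t :
  eq_on_sphere (b 0) id -> eq_on_sphere (b 1) id -> t < 1/3 \/ 1 - 1/3 < t ->
  eq_on_sphere (b (step t)) id.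
Proof.
move=> b0 b1 [h|h]; first by rewrite step0// ltW.
by rewrite step1//; lra.
Qed.

Lemma smooth_loop_reparam (b : R -> 'rV[R]_n -> 'rV[R]_n) (u : R -> R) :
  smooth_loop b -> (forall t, 0 <= t <= 1 -> 0 <= u t <= 1) -> u 0 = 0 -> u 1 = 1 ->
  @smooth_on R R R I u -> smooth_loop (fun t => b (u t)).
Proof.
move=> [sb db b0 b1] uI u0 u1 su; split.
- apply: (smooth_on_reparam (t := fun tx : R * 'rV[R]_n => u tx.1) (f := snd) sb).
  + by move=> [t x] [/= h _]; apply: uI; move: h; rewrite in_itv.
  + by move=> [t x] [].
  + apply: (smooth_on_comp (B := I) bR bR) => //; first by move=> [t x] [].
    exact: smooth_on_fst.
  + exact: smooth_on_snd.
- by move=> t tI; apply: db; rewrite in_itv/= uI//; move: tI; rewrite in_itv.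
- by rewrite u0.
- by rewrite u1.
Qed.

Lemma smooth_on_convex (V : normedModType R) (B : set V) (s t t' : V -> R) :
  @smooth_on R V R B s -> @smooth_on R V R B t -> @smooth_on R V R B t' ->
  @smooth_on R V R B (fun x => (1 - s x) * t x + s x * t' x).
Proof.
move=> ss st st'; apply: smooth_onD; apply: smooth_onM => //.
by apply: smooth_onB => //; exact: smooth_on_cst.
Qed.

Lemma boundary_reparam_Diffp (b : R -> 'rV[R]_n -> 'rV[R]_n) :
  smooth_loop b -> Diffp (boundary (fun t => b (step t))).
Proof.
move=> [sb db b0 b1].
(* The family is constant in its first parameter, taken at 0. *)
apply: (@boundary_family_Diffp R n (fun _ t => b (step t)) (1/3)  _ _ _ _ 0).
- apply: (smooth_on_reparam (t := fun stx : T => step stx.1.2) (f := snd) sb).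
  + by move=> *; exact: step_itv.
  + by move=> [? ?] [].
  + exact: smooth_on_step.
  + exact: sthd.
- by move=> s t _ _; apply: db; rewrite in_itv/= step_itv.
- by lra.
- by move=> s t _ _; exact: step_flat.
- by rewrite /= in_itv/= lexx ler01.
Qed.

Lemma loop_homotopic_boundary (a b : R -> 'rV[R]_n -> 'rV[R]_n) :
  loop_homotopic a b ->
  isotopic (boundary (fun t => a (step t))) (boundary (fun t => b (step t))).
Proof.
move=> [H [sH lH H0 H1]].
have sI (t : R) : step t \in `[0, 1] by rewrite in_itv/= step_itv.
apply: (eq_isotopic (f := boundary (fun t => H 0 (step t))) (g := boundary (fun t => H 1
    (step t)))).
- by move=> y Sy; apply: eq_boundary => // t _; exact: (H0 _ (sI t)).
- by move=> y Sy; apply: eq_boundary => // t _; exact: (H1 _ (sI t)).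
apply: (@boundary_isotopic R n (fun s t => H s (step t)) (1/3)).
- apply: (smooth_on_reparam2 (u := fun stx : T => stx.1.1) (v := fun stx : T => step stx.1.2)
    (f := snd) sH).
  + by move=> [[s t] x] [[/= + _] _]; rewrite in_itv.
  + by move=> *; exact: step_itv.
  + by move=> [? ?] [].
  + exact: sfst.
  + exact: smooth_on_step.
  + exact: sthd.
- by move=> s t /lH [_ + _ _] _; apply.
- by lra.
- by move=> s t /lH [_ _ h0 h1] _; exact: step_flat.
Qed.

Lemma flat_boundary_reparam (b : R -> 'rV[R]_n -> 'rV[R]_n) :
  smooth_loop b -> flat_at_ends b ->
  isotopic (boundary (fun t => b (step t))) (boundary b).
Proof.
move=> [sb db b0 b1] [e e0 be].
pose u s t : R := (1 - s) * step t + s * t.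
have uI s t : I s -> I t -> 0 <= u s t <= 1.
  rewrite /= !in_itv/= => sI tI; apply: convex_itv => //; exact: step_itv.
apply: (eq_isotopic (f := boundary (fun t => b (u 0 t))) (g := boundary (fun t => b (u 1 t)))).
- by move=> y Sy; apply: eq_boundary => // t _; rewrite /u subr0 mul1r mul0r addr0.
- by move=> y Sy; apply: eq_boundary => // t _; rewrite /u subrr mul1r mul0r add0r.
(* For t below both e and 1/3 one has [step t = 0], so [u s t = s * t] stays below e; symmetrically
   at the other end. *)
have m0 : 0 < Num.min e (1/3) by rewrite lt_min e0/=; lra.
have me : Num.min e (1/3) <= e by rewrite ge_min lexx.
have m3 : Num.min e (1/3) <= 1/3 by rewrite ge_min lexx orbT.
apply: (@boundary_isotopic R n (fun s t => b (u s t)) (Num.min e (1/3))) => //.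
- apply: (smooth_on_reparam (t := fun stx : T => u stx.1.1 stx.1.2) (f := snd) sb).
  + by move=> [[s t] x] [[/= ? ?] _]; exact: uI.
  + by move=> [? ?] [].
  + by apply: smooth_on_convex => //; exact: smooth_on_step.
  + exact: sthd.
- by move=> s t Is It; apply: db; rewrite in_itv/= uI.
- move=> s t Is It h; apply: be; first by rewrite in_itv/= uI.
  move: Is It; rewrite /= !in_itv/= => /andP[s0 s1] /andP[t0 t1].
  by rewrite /u; case: h => h; [left; rewrite step0; nra|right; rewrite step1; nra].
Qed.

(** Provides a representative of the class of b that is flat at its ends. *)
Lemma step_loop_homotopic (b : R -> 'rV[R]_n -> 'rV[R]_n) :
  smooth_loop b -> loop_homotopic b (fun t => b (step t)).
Proof.
move=> lb; have [sb _ _ _] := lb.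
exists (fun s t => b ((1 - s) * t + s * step t)); split.
- apply: (smooth_on_reparam (t := fun stx : T => (1 - stx.1.1) * stx.1.2 + stx.1.1 * step
    stx.1.2) (f := snd) sb).
  + move=> [[s t] x] [[/= ]]; rewrite !in_itv/= => Is It _.
    by apply: convex_itv => //; exact: step_itv.
  + by move=> [? ?] [].
  + by apply: smooth_on_convex => //; exact: smooth_on_step.
  + exact: sthd.
- move=> s; rewrite in_itv/= => sI.
  apply: (smooth_loop_reparam (u := fun t => (1 - s) * t + s * step t) lb).
  + by move=> t tI; apply: convex_itv => //; exact: step_itv.
  + by rewrite step0 ?mulr0 ?addr0//; lra.
  + by rewrite step1 ?mulr1 ?subrK//; lra.
  + apply: smooth_on_convex; [exact: smooth_on_cst|exact: smooth_on_linear|].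
    by apply: smooth_on_step; exact: smooth_on_linear.
- by move=> t _ x Sx; rewrite subr0 mul1r mul0r addr0.
- by move=> t _ x Sx; rewrite subrr mul0r mul1r add0r.
Qed.

(** Any flat representative c is isotopic, after taking boundaries, to c reparametrized by [step],
    and a homotopy from b to c links the latter to b reparametrized. Conversely, b reparametrized is
    itself a flat representative. *)
Lemma boundary_class_reparam (b : R -> 'rV[R]_n -> 'rV[R]_n) : smooth_loop b ->
  boundary_class (pi1_class b) = pi0_class (boundary (fun t => b (step t))).
Proof.
move=> lb; have [_ _ b0 b1] := lb; apply/seteqP; split => [g [c [[lc bc] fc cg]]|g bg].
  apply: isotopic_trans cg; apply: isotopic_trans (flat_boundary_reparam lc fc).
  exact: loop_homotopic_boundary.
exists (fun t => b (step t)); split => //.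
- split; last exact: step_loop_homotopic.
  apply: (smooth_loop_reparam (u := @step R) lb).
  + by move=> *; exact: step_itv.
  + by rewrite step0//; lra.
  + by rewrite step1//; lra.
  + by apply: smooth_on_step; exact: smooth_on_linear.
- by exists (1/3); [lra|move=> t _; exact: step_flat].
Qed.

End SigmaClass.

(** Orientation is known at s = 1, where the map is the boundary of a flat loop; the path carries it
    back to s = 0, that is, to sigma itself. *)
Lemma slide_sigma_Diffp (R : realType) (K : hypercomplex) s :
  s \in `[0, 1] -> Diffp (@slide_sigma R K s).
Proof.
apply: (path_orientation (t0 := 1) (@slide_sigma_smooth R K)).
- by move=> t; exact: slide_sigma_diffeo.
- by rewrite /= in_itv/= lexx ler01.
- apply: (@eq_orientation_preserving _ _ (boundary (fun t => @sigma_hat R K (step t)))).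
    by move=> y /slide_sigma1.
  by have [] := boundary_reparam_Diffp (@sigma_hat_loop R K).
Qed.

Lemma sigma_isotopic (R : realType) (K : hypercomplex) :
  isotopic (@sigma R K) (boundary (fun t => @sigma_hat R K (step t))).
Proof.
exists (@slide_sigma R K); split.
- exact: slide_sigma_smooth.
- exact: slide_sigma_Diffp.
- exact: slide_sigma0.
- exact: slide_sigma1.
Qed.

Theorem lemma1 (R : realType) (K : hypercomplex) :
  [/\ @Diffp R (1 + (imdim K + imdim K)) (@sigma R K),
      smooth_loop (@sigma_hat R K),
      eq_on_sphere (boundary (@sigma_hat R K)) (@sigma R K) &
      boundary_class (pi1_class (@sigma_hat R K)) = pi0_class (@sigma R K)].
Proof.
have lsh := @sigma_hat_loop R K.
split => //; last first.
- rewrite boundary_class_reparam//; have h := @sigma_isotopic R K.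
  apply/seteqP; split => g hg; first exact: isotopic_trans hg.
  by apply: isotopic_trans hg; exact: isotopic_sym.
- exact: boundary_sigma_hat.
apply: (@eq_Diffp _ _ (@slide_sigma R K 0)); first by move=> y /slide_sigma0.
by apply: slide_sigma_Diffp; rewrite in_itv/= lexx ler01.
Qed.
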